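(* Let $\mathcal D=\{(z_1,z_2)\in\mathbb C^2: |z_1|+|z_2|<1\}$, let $\kappa_{\mathcal D}$ be the Kobayashi--Royden metric of $\mathcal D$ and let $k_{\mathcal D}$ be the Kobayashi distance of $\mathcal D$. Let $F:\mathcal D\to\mathcal D$ be any map (no continuity or regularity is assumed). The following conditions are equivalent: (1) $F$ is of class $C^1$ (in the real sense) and $\kappa_{\mathcal D}(F(z);dF_zX)=\kappa_{\mathcal D}(z;X)$ for all $z\in\mathcal D$ and all $X\in\mathbb C^2$; (2) $k_{\mathcal D}(F(z),F(w))=k_{\mathcal D}(z,w)$ for all $z,w\in\mathcal D$; (3) up to a permutation of the coordinates, $F$ is of one of the two forms $F(z_1,z_2)=(\omega_1z_1,\omega_2z_2)$ or $F(z_1,z_2)=(\omega_1\overline{z_1},\omega_2\overline{z_2})$ with $|\omega_1|=|\omega_2|=1$; that is, there exist $\omega_1,\omega_2\in\mathbb C$ with $|\omega_1|=|\omega_2|=1$ and a permutation $\sigma$ of $\{1,2\}$ such that either $F(z_1,z_2)=(\omega_1z_{\sigma(1)},\omega_2z_{\sigma(2)})$ for all $(z_1,z_2)\in\mathcal D$, or $F(z_1,z_2)=(\omega_1\overline{z_{\sigma(1)}},\omega_2\overline{z_{\sigma(2)}})$ for all $(z_1,z_2)\in\mathcal D$.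
   Context: Let $\mathbb D=\{\lambda\in\mathbb C:|\lambda|<1\}$ and let $p$ be the Poincaré distance on $\mathbb D$, $p(\lambda,\mu)=\operatorname{arctanh}\left|\frac{\lambda-\mu}{1-\overline{\mu}\lambda}\right|$. For a domain $\Omega\subset\mathbb C^n$, $z\in\Omega$ and $X\in\mathbb C^n$, the Kobayashi--Royden metric is $\kappa_\Omega(z;X)=\inf\{|\alpha|: \alpha\in\mathbb C,\ \text{there is a holomorphic } \varphi:\mathbb D\to\Omega \text{ with } \varphi(0)=z,\ \alpha\varphi'(0)=X\}$. The Kobayashi distance $k_\Omega(z,w)$ is the infimum of $\sum_{j=1}^N p(\lambda_j,\mu_j)$ over all $N\ge1$, all holomorphic maps $\varphi_1,\dots,\varphi_N:\mathbb D\to\Omega$ and all $\lambda_j,\mu_j\in\mathbb D$ with $\varphi_1(\lambda_1)=z$, $\varphi_j(\mu_j)=\varphi_{j+1}(\lambda_{j+1})$ for $1\le j<N$, and $\varphi_N(\mu_N)=w$. $dF_z:\mathbb C^2\to\mathbb C^2$ denotes the real differential of $F$ at $z$ (an $\mathbb R$-linear map, with $\mathbb C^2$ identified with $\mathbb R^4$). *)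

(* Defs.v *)
From Stdlib Require Import Reals.
From Coquelicot Require Import Coquelicot.

Open Scope R_scope.

Definition artanh (x : R) : R := / 2 * ln ((1 + x) / (1 - x)).

Definition disc (l : C) : Prop := Cmod l < 1.

Definition poincare (l m : C) : R :=
  artanh (Cmod ((l - m) / (1 - Cconj m * l))%C).

(* A disc is a total function on C; only its values on the unit disc matter. *)
Definition holomorphic_disc {V : NormedModule C_AbsRing}
    (Omega : V -> Prop) (phi : C -> V) : Prop :=
  forall l : C, disc l -> @ex_derive C_AbsRing V phi l /\ Omega (phi l).

(* Infima are taken in the extended reals, so the infimum of the empty set
   is p_infty. *)
Definition kobayashi_metric {V : NormedModule C_AbsRing}
    (Omega : V -> Prop) (z X : V) : Rbar :=
  Glb_Rbar (fun r : R =>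
    exists (alpha : C) (phi : C -> V) (v : V),
      holomorphic_disc Omega phi /\
      phi (RtoC 0) = z /\
      @is_derive C_AbsRing V phi (RtoC 0) v /\
      @scal C_AbsRing V alpha v = X /\
      r = Cmod alpha).

(* The chain has N + 1 discs, indexed by 0, ..., N. *)
Definition kobayashi_dist {V : NormedModule C_AbsRing}
    (Omega : V -> Prop) (z w : V) : Rbar :=
  Glb_Rbar (fun r : R =>
    exists (N : nat) (phi : nat -> C -> V) (l m : nat -> C),
      (forall j : nat, (j <= N)%nat ->
         holomorphic_disc Omega (phi j) /\ disc (l j) /\ disc (m j)) /\
      phi 0%nat (l 0%nat) = z /\
      (forall j : nat, (j < N)%nat -> phi j (m j) = phi (S j) (l (S j))) /\
      phi N (m N) = w /\
      r = sum_n (fun j => poincare (l j) (m j)) N).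

(* The set C * C as a complex and as a real normed space. *)
Definition C2 : NormedModule C_AbsRing :=
  prod_NormedModule C_AbsRing C_NormedModule C_NormedModule.

Definition C2_R : NormedModule R_AbsRing :=
  prod_NormedModule R_AbsRing C_R_NormedModule C_R_NormedModule.

(* For open U: F is of class C^1 on U in the real sense, with differential
   dF z at z. In finite dimension, continuity of z |-> dF z X for every fixed
   X is continuity of z |-> dF z in operator norm. *)
Definition C1_differential (U : C * C -> Prop)
    (F : C * C -> C * C) (dF : C * C -> C * C -> C * C) : Prop :=
  (forall z : C * C, U z ->
     @filterdiff R_AbsRing C2_R C2_R F (@locally C2_R z) (dF z)) /\
  (forall X z : C * C, U z ->
     @continuous C2_R C2_R (fun y => dF y X) z).

Definition l1_ball (z : C * C) : Prop := Cmod (fst z) + Cmod (snd z) < 1.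

Definition coordinate_permutation (sigma : C * C -> C * C) : Prop :=
  (forall z, sigma z = z) \/ (forall z, sigma z = (snd z, fst z)).

(* Main.v *)
(* Write N(z) = |z1| + |z2|, k and kappa for the Kobayashi distance and metric of the ball D = {N < 1}.
   Lower bounds for k and kappa come from holomorphic functions D -> disc (the maps u1 z1 + u2 z2 and
   z2 / (1 - u z1) with |u| = |u1| = |u2| = 1), upper bounds from explicit discs.

   The origin is the only point c whose indicatrix is R-linearly isometric to the l1 ball. Indeed, up to
   a symmetry c = (c1, c2) with c1 > 0, c2 >= 0; the discs through c on which z1 + z2 is a coordinate
   produce a segment in the boundary of the indicatrix, whose endpoints would be the two extreme
   directions, and estimating kappa_c at e2 in terms of these endpoints gives a contradiction.

   An isometry F of kappa therefore fixes 0 and has no other zero. It does not increase k, and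
   minimizing k(0, F(z)) + t k(z0, z) for t < 1 (Ekeland) gives N(F(z)) = N(z).
   For an isometry F of k, which is neither assumed surjective nor differentiable, Figiel's argument for
   isometric embeddings of normed spaces, applied at small scales around 0, gives again an R-linear
   isometry between the indicatrices at 0 and at F(0); so F(0) = 0, and F has a linear blow-up at 0.

   In both cases F is a non-expanding map with N(F(z)) = N(z) and a blow-up U at 0 which is an R-linear
   isometry of N. Following radial geodesics, the coordinates of F(z) have the arguments of those of U(z).
   Hence F maps the axes to the axes, and comparing distances to the axes gives F = U. Finally the
   maps (z1, z2) -> (z1, conj z2) are excluded by one explicit disc. *)
Require Import Defs.
From Stdlib Require Import Reals Lra Lia Psatz ClassicalEpsilon.
From Coquelicot Require Import Coquelicot.
Open Scope R_scope.

(** * Complex derivatives and holomorphic discs *)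

(** Holomorphy is mere pointwise complex differentiability here, so even the Schwarz lemma has to
    start from Goursat's bisection. Only the bound on the derivative at the centre is taken from
    Cauchy theory: every distance estimate is an integrated infinitesimal one, through a mean value
    inequality for functions that, like norms and distances, need not be differentiable. The common
    obstacle is that [F] is not known to be onto, so neither an inverse isometry nor the Mazur-Ulam
    theorem is at hand. For the metric, surjectivity is needed only infinitesimally: the
    differential is injective, hence onto, and as long as [F z] is not 0 a suitable motion of [z]
    moves [F z] towards 0 at the same Kobayashi speed; a penalty of slope below 1 cannot compensate
    this. For the distance, finite dimension helps: a limit of norming functionals gives a linear
    map under which every vector is seen to have a preimage, and such a map is bijective. The
    blow-up controls arguments of coordinates but not their moduli, and no argument where a
    coordinate vanishes; hence the separate treatment of the axes. *)

Definition cderiv (f : C -> C) (z d : C) : Prop :=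
  forall eps, 0 < eps -> exists delta, 0 < delta /\
    forall h : C, Cmod h < delta ->
      Cmod (f (z + h) - f z - d * h)%C <= eps * Cmod h.

Lemma Cmod_sub_sym (a b : C) : Cmod (a - b)%C = Cmod (b - a)%C.
Proof. rewrite <- Cmod_opp. f_equal. ring. Qed.

Lemma Cmod_le_sub (a b : C) : Cmod a <= Cmod (a - b)%C + Cmod b.
Proof. replace a with ((a - b) + b)%C at 1 by ring. apply Cmod_triangle. Qed.

Lemma Cmod_abs_sub (a b : C) : Rabs (Cmod a - Cmod b) <= Cmod (a - b)%C.
Proof.
  pose proof (Cmod_le_sub a b). pose proof (Cmod_le_sub b a).
  rewrite (Cmod_sub_sym b a) in *. apply Rabs_le; lra.
Qed.

Lemma cderiv_locally_lipschitz (f : C -> C) (z d : C) :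
  cderiv f z d -> exists delta, 0 < delta /\
    forall h, Cmod h < delta -> Cmod (f (z + h) - f z)%C <= (Cmod d + 1) * Cmod h.
Proof.
  intros H. destruct (H 1 Rlt_0_1) as [dl [Hd Hh]].
  exists dl; split; [exact Hd|]. intros h Hl. specialize (Hh h Hl).
  pose proof (Cmod_le_sub (f (z + h) - f z)%C (d * h)%C) as T.
  rewrite Cmod_mult in T. lra.
Qed.

Lemma cderiv_continuous (f : C -> C) (z d : C) :
  cderiv f z d -> forall eps, 0 < eps -> exists delta, 0 < delta /\
    forall h, Cmod h < delta -> Cmod (f (z + h) - f z)%C < eps.
Proof.
  intros H eps He. destruct (cderiv_locally_lipschitz f z d H) as [dl [Hd Hh]].
  pose proof (Cmod_ge_0 d).
  exists (Rmin dl (eps / (Cmod d + 2))). split.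
  { apply Rmin_pos; [lra|]. apply Rdiv_lt_0_compat; lra. }
  intros h Hl. pose proof (Rmin_l dl (eps / (Cmod d + 2))).
  pose proof (Rmin_r dl (eps / (Cmod d + 2))).
  specialize (Hh h ltac:(lra)).
  assert (Cmod h * (Cmod d + 2) < eps).
  { apply (Rmult_lt_reg_r (/ (Cmod d + 2))).
    - apply Rinv_0_lt_compat; lra.
    - rewrite Rmult_assoc, Rinv_r by lra. unfold Rdiv in *. lra. }
  pose proof (Cmod_ge_0 h). nra.
Qed.

Lemma cderiv_ext_near (f g : C -> C) (z d : C) (r : R) :
  0 < r -> (forall h, Cmod h < r -> f (z + h)%C = g (z + h)%C) ->
  cderiv f z d -> cderiv g z d.
Proof.
  intros Hr E H eps He. destruct (H eps He) as [dl [Hd Hh]].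
  exists (Rmin dl r). split; [now apply Rmin_pos|]. intros h Hl.
  pose proof (Rmin_l dl r). pose proof (Rmin_r dl r).
  rewrite <- E by lra. replace (g z) with (f z). apply Hh; lra.
  replace z with (z + 0)%C by ring. apply E. rewrite Cmod_0; lra.
Qed.

Lemma cderiv_ext (f g : C -> C) (z d : C) :
  (forall w, f w = g w) -> cderiv f z d -> cderiv g z d.
Proof. intros E. apply (cderiv_ext_near f g z d 1); [lra|]. intros; apply E. Qed.

Lemma cderiv_eq (f : C -> C) (z d e : C) : cderiv f z d -> d = e -> cderiv f z e.
Proof. now intros H <-. Qed.

Lemma cderiv_const (c z : C) : cderiv (fun _ => c) z 0%C.
Proof.
  intros eps He. exists 1; split; [lra|]. intros h _.
  replace (c - c - 0 * h)%C with (RtoC 0) by ring.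
  rewrite Cmod_0. pose proof (Cmod_ge_0 h). nra.
Qed.

Lemma cderiv_id (z : C) : cderiv (fun w => w) z 1%C.
Proof.
  intros eps He. exists 1; split; [lra|]. intros h _.
  replace (z + h - z - 1 * h)%C with (RtoC 0) by ring.
  rewrite Cmod_0. pose proof (Cmod_ge_0 h). nra.
Qed.

Lemma cderiv_plus (f g : C -> C) (z d e : C) :
  cderiv f z d -> cderiv g z e -> cderiv (fun w => f w + g w)%C z (d + e)%C.
Proof.
  intros Hf Hg eps He.
  destruct (Hf (eps / 2) ltac:(lra)) as [d1 [H1 K1]].
  destruct (Hg (eps / 2) ltac:(lra)) as [d2 [H2 K2]].
  exists (Rmin d1 d2). split; [now apply Rmin_pos|]. intros h Hl.
  pose proof (Rmin_l d1 d2). pose proof (Rmin_r d1 d2).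
  specialize (K1 h ltac:(lra)). specialize (K2 h ltac:(lra)).
  replace (f (z + h) + g (z + h) - (f z + g z) - (d + e) * h)%C with
    ((f (z + h) - f z - d * h) + (g (z + h) - g z - e * h))%C by ring.
  eapply Rle_trans; [apply Cmod_triangle|]. lra.
Qed.

Lemma cderiv_mult (f g : C -> C) (z d e : C) :
  cderiv f z d -> cderiv g z e ->
  cderiv (fun w => f w * g w)%C z (d * g z + f z * e)%C.
Proof.
  intros Hf Hg eps He.
  set (M := Cmod (f z) + Cmod (g z) + Cmod e + 2).
  pose proof (Cmod_ge_0 (f z)). pose proof (Cmod_ge_0 (g z)). pose proof (Cmod_ge_0 e).
  assert (HM : 0 < M) by (unfold M; lra).
  set (t := eps / (3 * M)).
  assert (Ht : 0 < t) by (apply Rdiv_lt_0_compat; lra).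
  destruct (Hf t Ht) as [d1 [H1' K1]].
  destruct (Hg t Ht) as [d2 [H2' K2]].
  destruct (cderiv_continuous f z d Hf (Rmin 1 t)) as [d3 [H3' K3]].
  { apply Rmin_pos; lra. }
  exists (Rmin d1 (Rmin d2 d3)). split.
  { repeat apply Rmin_pos; lra. }
  intros h Hl.
  pose proof (Rmin_l d1 (Rmin d2 d3)). pose proof (Rmin_r d1 (Rmin d2 d3)).
  pose proof (Rmin_l d2 d3). pose proof (Rmin_r d2 d3).
  specialize (K1 h ltac:(lra)). specialize (K2 h ltac:(lra)). specialize (K3 h ltac:(lra)).
  pose proof (Rmin_l 1 t). pose proof (Rmin_r 1 t).
  replace (f (z + h) * g (z + h) - f z * g z - (d * g z + f z * e) * h)%C with
    (f (z + h) * (g (z + h) - g z - e * h) + ((f (z + h) - f z) * (e * h)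
      + g z * (f (z + h) - f z - d * h)))%C by ring.
  eapply Rle_trans; [apply Cmod_triangle|].
  eapply Rle_trans; [apply Rplus_le_compat_l, Cmod_triangle|].
  rewrite !Cmod_mult.
  assert (Cmod (f (z + h)%C) <= M).
  { pose proof (Cmod_le_sub (f (z + h)%C) (f z)). unfold M. lra. }
  assert (E : eps = t * (3 * M)) by (unfold t; field; lra).
  rewrite E.
  pose proof (Cmod_ge_0 h).
  pose proof (Cmod_ge_0 (g (z + h) - g z - e * h)%C).
  pose proof (Cmod_ge_0 (f (z + h) - f z - d * h)%C).
  pose proof (Cmod_ge_0 (f (z + h) - f z)%C).
  assert (A1 : Cmod (f (z + h)%C) * Cmod (g (z + h) - g z - e * h)%C <= M * (t * Cmod h)).
  { apply Rmult_le_compat; try apply Cmod_ge_0; lra. }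
  assert (A2 : Cmod (f (z + h) - f z)%C * (Cmod e * Cmod h) <= t * (M * Cmod h)).
  { apply Rmult_le_compat; try apply Cmod_ge_0; try lra.
    - apply Rmult_le_pos; apply Cmod_ge_0.
    - apply Rmult_le_compat_r; [apply Cmod_ge_0|unfold M; lra]. }
  assert (A3 : Cmod (g z) * Cmod (f (z + h) - f z - d * h)%C <= M * (t * Cmod h)).
  { apply Rmult_le_compat; try apply Cmod_ge_0; try lra. unfold M; lra. }
  lra.
Qed.

Lemma cderiv_cmult (c : C) (f : C -> C) (z d : C) :
  cderiv f z d -> cderiv (fun w => c * f w)%C z (c * d)%C.
Proof.
  intros H. replace (c * d)%C with (0 * f z + c * d)%C by ring.
  apply (cderiv_mult (fun _ => c) f); [apply cderiv_const|exact H].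
Qed.

Lemma cderiv_minus (f g : C -> C) (z d e : C) :
  cderiv f z d -> cderiv g z e -> cderiv (fun w => f w - g w)%C z (d - e)%C.
Proof.
  intros Hf Hg. replace (d - e)%C with (d + (-1) * e)%C by ring.
  apply (cderiv_ext (fun w => f w + (-1) * g w)%C); [intros; ring|].
  apply cderiv_plus; [exact Hf|]. now apply cderiv_cmult.
Qed.

Lemma cderiv_comp (f g : C -> C) (z d e : C) :
  cderiv f z d -> cderiv g (f z) e -> cderiv (fun w => g (f w)) z (e * d)%C.
Proof.
  intros Hf Hg eps He.
  pose proof (Cmod_ge_0 d). pose proof (Cmod_ge_0 e).
  set (t1 := eps / (2 * (Cmod d + 1))). set (t2 := eps / (2 * (Cmod e + 1))).
  assert (Ht1 : 0 < t1) by (apply Rdiv_lt_0_compat; lra).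
  assert (Ht2 : 0 < t2) by (apply Rdiv_lt_0_compat; lra).
  destruct (Hg t1 Ht1) as [d1 [H1' K1]].
  destruct (Hf t2 Ht2) as [d2 [H2' K2]].
  destruct (cderiv_locally_lipschitz f z d Hf) as [d3 [H3' K3]].
  destruct (cderiv_continuous f z d Hf d1 H1') as [d4 [H4' K4]].
  exists (Rmin d2 (Rmin d3 d4)). split.
  { repeat apply Rmin_pos; lra. }
  intros h Hl.
  pose proof (Rmin_l d2 (Rmin d3 d4)). pose proof (Rmin_r d2 (Rmin d3 d4)).
  pose proof (Rmin_l d3 d4). pose proof (Rmin_r d3 d4).
  specialize (K2 h ltac:(lra)). specialize (K3 h ltac:(lra)). specialize (K4 h ltac:(lra)).
  specialize (K1 _ K4).
  replace (f z + (f (z + h) - f z))%C with (f (z + h)%C) in K1 by ring.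
  replace (g (f (z + h)) - g (f z) - e * d * h)%C with
    ((g (f (z + h)%C) - g (f z) - e * (f (z + h) - f z)) + e * (f (z + h) - f z - d * h))%C by ring.
  eapply Rle_trans; [apply Cmod_triangle|]. rewrite Cmod_mult.
  pose proof (Cmod_ge_0 h).
  assert (E1 : eps = t1 * (2 * (Cmod d + 1))) by (unfold t1; field; lra).
  assert (E2 : eps = t2 * (2 * (Cmod e + 1))) by (unfold t2; field; lra).
  assert (t1 * Cmod (f (z + h) - f z)%C <= t1 * ((Cmod d + 1) * Cmod h)) by nra.
  assert (Cmod e * Cmod (f (z + h) - f z - d * h)%C <= (Cmod e + 1) * (t2 * Cmod h)).
  { apply Rmult_le_compat; try apply Cmod_ge_0; lra. }
  replace (eps * Cmod h) with (eps / 2 * Cmod h + eps / 2 * Cmod h) by field.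
  rewrite E1 at 1. rewrite E2 at 1. lra.
Qed.

Lemma cderiv_inv (z : C) : z <> 0%C -> cderiv Cinv z (- / (z * z))%C.
Proof.
  intros Hz eps He.
  assert (Hm : 0 < Cmod z) by now apply Cmod_gt_0.
  (* The first bound keeps [Cmod (z + h)] above [Cmod z / 2]; the second then makes the remainder
     [h^2 / (z^2 (z + h))] at most [eps * Cmod h]. *)
  exists (Rmin (Cmod z / 2) (eps * Cmod z ^ 3 / 2)). split.
  { apply Rmin_pos; [lra|]. apply Rdiv_lt_0_compat; [|lra].
    apply Rmult_lt_0_compat; [lra|]. now apply pow_lt. }
  intros h Hl.
  pose proof (Rmin_l (Cmod z / 2) (eps * Cmod z ^ 3 / 2)).
  pose proof (Rmin_r (Cmod z / 2) (eps * Cmod z ^ 3 / 2)).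
  assert (Hzh : Cmod z / 2 <= Cmod (z + h)%C).
  { pose proof (Cmod_le_sub z (- h)%C) as T. rewrite Cmod_opp in T.
    replace (z - - h)%C with (z + h)%C in T by ring. lra. }
  assert (Hn : (z + h)%C <> 0%C) by (apply Cmod_gt_0; lra).
  replace (/ (z + h) - / z - - / (z * z) * h)%C with
    (h * h / (z * z * (z + h)))%C by (field; auto).
  rewrite Cmod_div by (repeat apply Cmult_neq_0; auto).
  rewrite !Cmod_mult.
  pose proof (Cmod_ge_0 h).
  apply (Rmult_le_reg_r (Cmod z * Cmod z * Cmod (z + h)%C)).
  { repeat apply Rmult_lt_0_compat; lra. }
  unfold Rdiv at 1. rewrite Rmult_assoc, Rinv_l by
    (apply Rgt_not_eq; repeat apply Rmult_lt_0_compat; lra).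
  rewrite Rmult_1_r.
  assert (Cmod h <= eps * (Cmod z * Cmod z * Cmod (z + h)%C)).
  { apply Rle_trans with (eps * (Cmod z * Cmod z * (Cmod z / 2))); [simpl in *; nra|].
    apply Rmult_le_compat_l; [lra|]. apply Rmult_le_compat_l; nra. }
  nra.
Qed.

Lemma cderiv_div (f g : C -> C) (z d e : C) :
  g z <> 0%C -> cderiv f z d -> cderiv g z e ->
  cderiv (fun w => f w / g w)%C z ((d * g z - f z * e) / (g z * g z))%C.
Proof.
  intros Hz Hf Hg.
  replace ((d * g z - f z * e) / (g z * g z))%C with
    (d * / g z + f z * (- / (g z * g z) * e))%C by (field; auto).
  apply (cderiv_mult f (fun w => / g w)%C); [exact Hf|].
  apply (cderiv_comp g Cinv); [exact Hg|]. now apply cderiv_inv.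
Qed.

(** Conjugating both argument and value restores complex differentiability; this is how
    antiholomorphic symmetries act on discs. *)
Lemma cderiv_conj (f : C -> C) (z d : C) :
  cderiv f (Cconj z) d -> cderiv (fun w => Cconj (f (Cconj w))) z (Cconj d).
Proof.
  intros H eps He. destruct (H eps He) as [dl [Hd Hh]].
  exists dl; split; [exact Hd|]. intros h Hl.
  specialize (Hh (Cconj h)). rewrite Cmod_conj in Hh. specialize (Hh Hl).
  rewrite <- Cmod_conj in Hh. rewrite Cplus_conj.
  replace (Cconj (f (Cconj z + Cconj h)) - Cconj (f (Cconj z)) - Cconj d * h)%C with
   (Cconj (f (Cconj z + Cconj h) - f (Cconj z) - d * Cconj h)%C); [exact Hh|].
  rewrite !Cminus_conj, Cmult_conj, Cconj_conj. reflexivity.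
Qed.

(** * Discs in two variables *)

Definition hderiv (phi : C -> C * C) (z : C) (v : C * C) : Prop :=
  cderiv (fun w => fst (phi w)) z (fst v) /\ cderiv (fun w => snd (phi w)) z (snd v).

Definition l1norm (z : C * C) : R := Cmod (fst z) + Cmod (snd z).

(** The norm of the product space is Euclidean, whereas the domain is the unit ball of [l1norm]; the
    factor 2 is the price of the change. *)
Lemma C2_norm_l1 (u : C * C) :
  @norm C_AbsRing C2 u <= l1norm u <= 2 * @norm C_AbsRing C2 u.
Proof.
  change (@norm C_AbsRing C2 u) with (sqrt (Cmod (fst u) ^ 2 + Cmod (snd u) ^ 2)).
  unfold l1norm. pose proof (Cmod_ge_0 (fst u)). pose proof (Cmod_ge_0 (snd u)).
  set (a := Cmod (fst u)) in *. set (b := Cmod (snd u)) in *.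
  split.
  - rewrite <- (sqrt_pow2 (a + b)) by lra. apply sqrt_le_1_alt. nra.
  - assert (a <= sqrt (a ^ 2 + b ^ 2)).
    { rewrite <- (sqrt_pow2 a) at 1 by lra. apply sqrt_le_1_alt. nra. }
    assert (b <= sqrt (a ^ 2 + b ^ 2)).
    { rewrite <- (sqrt_pow2 b) at 1 by lra. apply sqrt_le_1_alt. nra. }
    lra.
Qed.

(** Bridge from the derivative used in the statement to two scalar epsilon-delta derivatives, on
    which all later computations rest. *)
Lemma is_derive_hderiv (phi : C -> C * C) (z : C) (v : C * C) :
  @is_derive C_AbsRing C2 phi z v <-> hderiv phi z v.
Proof.
  split.
  - intros [_ H].
    assert (K : forall eps, 0 < eps -> exists delta, 0 < delta /\ forall h, Cmod h < delta ->
      l1norm (fst (phi (z + h)%C) - fst (phi z) - fst v * h,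
              snd (phi (z + h)%C) - snd (phi z) - snd v * h)%C <= eps * Cmod h).
    { intros eps He. assert (He2 : 0 < eps / 2) by lra.
      destruct (H z (fun P HP => HP) (mkposreal _ He2)) as [dl Hd].
      exists dl. split; [apply cond_pos|]. intros h Hh.
      specialize (Hd (z + h)%C).
      assert (B : @ball (AbsRing_UniformSpace C_AbsRing) z dl (z + h)%C).
      { change (Cmod ((z + h) - z)%C < dl). replace (z + h - z)%C with h by ring. exact Hh. }
      specialize (Hd B). simpl in Hd.
      match type of Hd with ?L <= _ * ?N =>
        change N with (Cmod ((z + h) - z)%C) in Hd end.
      replace (z + h - z)%C with h in Hd by ring.
      match type of Hd with norm ?u <= _ =>
         pose proof (C2_norm_l1 u) as T; set (U := u) in * end.
      assert (EU : U = (fst (phi (z + h)%C) - fst (phi z) - fst v * h,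
              snd (phi (z + h)%C) - snd (phi z) - snd v * h)%C).
      { unfold U.
        change ((fst (phi (z + h)%C) - fst (phi z) - ((z + h) - z) * fst v,
              snd (phi (z + h)%C) - snd (phi z) - ((z + h) - z) * snd v)%C =
              (fst (phi (z + h)%C) - fst (phi z) - fst v * h,
              snd (phi (z + h)%C) - snd (phi z) - snd v * h)%C).
        f_equal; match goal with |- @eq _ ?a ?b => change (@eq C a b) end; ring. }
      rewrite <- EU. change (@norm C_AbsRing C2 U <= eps / 2 * Cmod h) in Hd. lra. }
    unfold l1norm in K; simpl in K.
    split; intros eps He; destruct (K eps He) as [dl [Hd Hk]]; exists dl; split; auto;
      intros h Hh; specialize (Hk h Hh).
    + pose proof (Cmod_ge_0 (snd (phi (z + h)%C) - snd (phi z) - snd v * h)%C). simpl. lra.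
    + pose proof (Cmod_ge_0 (fst (phi (z + h)%C) - fst (phi z) - fst v * h)%C). simpl. lra.
  - intros [H1 H2]. split.
    { apply is_linear_scal_l. }
    intros x Hx. apply (is_filter_lim_locally_unique (K := C_AbsRing) (V := AbsRing_NormedModule C_AbsRing)) in Hx. subst x.
    intros eps. pose proof (cond_pos eps) as He.
    destruct (H1 (eps / 2) ltac:(lra)) as [d1 [Hd1 K1]].
    destruct (H2 (eps / 2) ltac:(lra)) as [d2 [Hd2 K2]].
    exists (mkposreal _ (Rmin_pos d1 d2 Hd1 Hd2)). intros y By.
    change (Cmod (y - z)%C < Rmin d1 d2) in By.
    pose proof (Rmin_l d1 d2). pose proof (Rmin_r d1 d2).
    specialize (K1 (y - z)%C ltac:(lra)). specialize (K2 (y - z)%C ltac:(lra)).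
    assert (Ey : (z + (y - z))%C = y) by (change C in (type of y); ring).
    rewrite Ey in K1, K2.
    simpl.
    match goal with |- norm ?u <= _ * ?N => change N with (Cmod (y - z)%C);
         pose proof (C2_norm_l1 u) as T; set (U := u) in * end.
    assert (EU : U = (fst (phi y) - fst (phi z) - fst v * (y - z),
              snd (phi y) - snd (phi z) - snd v * (y - z))%C).
    { unfold U.
      change ((fst (phi y) - fst (phi z) - (y - z) * fst v,
              snd (phi y) - snd (phi z) - (y - z) * snd v)%C =
              (fst (phi y) - fst (phi z) - fst v * (y - z),
              snd (phi y) - snd (phi z) - snd v * (y - z))%C).
      f_equal; match goal with |- @eq _ ?a ?b => change (@eq C a b) end; ring. }
    change (@norm C_AbsRing C2 U <= eps * Cmod (y - z)%C).
    rewrite EU in *. unfold l1norm in T. simpl in T, K1, K2. lra.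
Qed.

Definition hdisc (phi : C -> C * C) : Prop :=
  forall l, Cmod l < 1 -> (exists v, hderiv phi l v) /\ l1norm (phi l) < 1.

Lemma holomorphic_disc_hdisc (phi : C -> C * C) :
  @holomorphic_disc C2 l1_ball phi <-> hdisc phi.
Proof.
  split; intros H l Hl; destruct (H l Hl) as [[v Hv] Hb]; split; try exact Hb;
    exists v; now apply is_derive_hderiv.
Qed.

(** * Goursat's theorem on rectangles *)

Definition CInt (g : R -> C) (a b : R) : C :=
  (RInt (fun t => fst (g t)) a b, RInt (fun t => snd (g t)) a b).

Definition ccont_on (g : R -> C) (a b : R) : Prop :=
  forall t, a <= t <= b -> forall eps, 0 < eps -> exists delta, 0 < delta /\
    forall s, Rabs (s - t) < delta -> Cmod (g s - g t)%C < eps.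

Lemma fst_le_Cmod (z : C) : Rabs (fst z) <= Cmod z.
Proof. apply Rle_trans with (2 := Rmax_Cmod z). apply Rmax_l. Qed.

Lemma snd_le_Cmod (z : C) : Rabs (snd z) <= Cmod z.
Proof. apply Rle_trans with (2 := Rmax_Cmod z). apply Rmax_r. Qed.

Lemma Cmod_le_parts (z : C) : Cmod z <= Rabs (fst z) + Rabs (snd z).
Proof.
  destruct z as [x y]. unfold Cmod. simpl fst; simpl snd.
  pose proof (Rabs_pos x). pose proof (Rabs_pos y).
  rewrite <- (sqrt_pow2 (Rabs x + Rabs y)) by lra. apply sqrt_le_1_alt.
  rewrite <- (pow2_abs x), <- (pow2_abs y). nra.
Qed.

Lemma ccont_ex_RInt (g : R -> C) (a b : R) : a <= b -> ccont_on g a b ->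
  ex_RInt (fun t => fst (g t)) a b /\ ex_RInt (fun t => snd (g t)) a b.
Proof.
  intros Hab H. split; apply (ex_RInt_continuous (V := R_CompleteNormedModule));
    rewrite Rmin_left, Rmax_right by lra; intros t Ht;
    apply (proj2 (filterlim_locally (U := R_UniformSpace) _ _)); intros eps;
    destruct (H t Ht eps (cond_pos eps)) as [dl [Hd K]];
    exists (mkposreal dl Hd); intros s Hs; specialize (K s Hs).
  - change (Rabs (fst (g s) - fst (g t)) < eps).
    apply Rle_lt_trans with (2 := K). apply (fst_le_Cmod (g s - g t)%C).
  - change (Rabs (snd (g s) - snd (g t)) < eps).
    apply Rle_lt_trans with (2 := K). apply (snd_le_Cmod (g s - g t)%C).
Qed.

Lemma ccont_sub (g : R -> C) (a b c d : R) :
  a <= c -> d <= b -> ccont_on g a b -> ccont_on g c d.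
Proof. intros H1 H2 H t Ht. apply H. lra. Qed.

Lemma ccont_minus (f g : R -> C) (a b : R) :
  ccont_on f a b -> ccont_on g a b -> ccont_on (fun t => f t - g t)%C a b.
Proof.
  intros Hf Hg t Ht eps He.
  destruct (Hf t Ht (eps / 2) ltac:(lra)) as [d1 [H1 K1]].
  destruct (Hg t Ht (eps / 2) ltac:(lra)) as [d2 [H2 K2]].
  exists (Rmin d1 d2). split; [now apply Rmin_pos|]. intros s Hs.
  pose proof (Rmin_l d1 d2). pose proof (Rmin_r d1 d2).
  specialize (K1 s ltac:(lra)). specialize (K2 s ltac:(lra)).
  replace (f s - g s - (f t - g t))%C with ((f s - f t) + - (g s - g t))%C by ring.
  eapply Rle_lt_trans; [apply Cmod_triangle|]. rewrite Cmod_opp. lra.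
Qed.

Lemma CInt_Chasles (g : R -> C) (a b c : R) : a <= b -> b <= c -> ccont_on g a c ->
  (CInt g a b + CInt g b c)%C = CInt g a c.
Proof.
  intros Hab Hbc H.
  destruct (ccont_ex_RInt g a b Hab (ccont_sub g a c a b ltac:(lra) ltac:(lra) H)) as [E1 E2].
  destruct (ccont_ex_RInt g b c Hbc (ccont_sub g a c b c ltac:(lra) ltac:(lra) H)) as [E3 E4].
  unfold CInt, Cplus; simpl. f_equal.
  - exact (RInt_Chasles (V := R_CompleteNormedModule) _ a b c E1 E3).
  - exact (RInt_Chasles (V := R_CompleteNormedModule) _ a b c E2 E4).
Qed.

Lemma CInt_plus (f g : R -> C) (a b : R) : a <= b -> ccont_on f a b -> ccont_on g a b ->
  CInt (fun t => f t + g t)%C a b = (CInt f a b + CInt g a b)%C.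
Proof.
  intros Hab Hf Hg.
  destruct (ccont_ex_RInt f a b Hab Hf) as [E1 E2].
  destruct (ccont_ex_RInt g a b Hab Hg) as [E3 E4].
  unfold CInt, Cplus; simpl. f_equal.
  - exact (RInt_plus (V := R_CompleteNormedModule) _ _ a b E1 E3).
  - exact (RInt_plus (V := R_CompleteNormedModule) _ _ a b E2 E4).
Qed.

Lemma CInt_ext (f g : R -> C) (a b : R) : (forall t, f t = g t) -> CInt f a b = CInt g a b.
Proof. intros H. unfold CInt. f_equal; apply RInt_ext; intros; now rewrite H. Qed.

(** The factor 2 comes from estimating real and imaginary parts separately. *)
Lemma CInt_near_const (g : R -> C) (a b : R) (k : C) (M : R) : a <= b -> ccont_on g a b ->
  (forall t, a <= t <= b -> Cmod (g t - k)%C <= M) ->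
  Cmod (CInt g a b - k * (b - a)%R)%C <= 2 * M * (b - a).
Proof.
  intros Hab H HM. destruct (ccont_ex_RInt g a b Hab H) as [E1 E2].
  assert (Aux : forall (u : R -> R) (p : R), ex_RInt u a b ->
    (forall t, a <= t <= b -> Rabs (u t - p) <= M) -> Rabs (RInt u a b - p * (b - a)) <= M * (b - a)).
  { intros u p Eu Hu.
    assert (Hc : ex_RInt (fun _ : R => p) a b) by apply (ex_RInt_const (V := R_NormedModule)).
    replace (RInt u a b - p * (b - a)) with (RInt (fun t => u t - p) a b).
    2:{ apply (is_RInt_unique (V := R_CompleteNormedModule)).
        replace (RInt u a b - p * (b - a)) with
          (minus (RInt u a b) (@scal R_AbsRing R_NormedModule (b - a) p))
          by (unfold minus, plus, opp, scal, mult; simpl; unfold mult; simpl; ring).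
        apply (is_RInt_minus (V := R_NormedModule) u (fun _ => p)).
        - exact (RInt_correct (V := R_CompleteNormedModule) u a b Eu).
        - exact (is_RInt_const (V := R_NormedModule) a b p). }
    rewrite Rmult_comm.
    apply (norm_RInt_le_const (V := R_NormedModule) (fun t => u t - p) a b _ M Hab).
    - intros t Ht. apply (Hu t Ht).
    - apply (RInt_correct (V := R_CompleteNormedModule)).
      apply (ex_RInt_minus (V := R_NormedModule) u (fun _ => p) a b Eu Hc). }
  eapply Rle_trans; [apply Cmod_le_parts|].
  replace (fst (CInt g a b - k * (b - a)%R)%C) with (RInt (fun t => fst (g t)) a b - fst k * (b - a))
    by (unfold CInt; simpl; ring).
  replace (snd (CInt g a b - k * (b - a)%R)%C) with (RInt (fun t => snd (g t)) a b - snd k * (b - a))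
    by (unfold CInt; simpl; ring).
  assert (Rabs (RInt (fun t => fst (g t)) a b - fst k * (b - a)) <= M * (b - a)).
  { apply Aux; [exact E1|]. intros t Ht. apply Rle_trans with (2 := HM t Ht).
    apply (fst_le_Cmod (g t - k)%C). }
  assert (Rabs (RInt (fun t => snd (g t)) a b - snd k * (b - a)) <= M * (b - a)).
  { apply Aux; [exact E2|]. intros t Ht. apply Rle_trans with (2 := HM t Ht).
    apply (snd_le_Cmod (g t - k)%C). }
  lra.
Qed.

(* [l] is the horizontal side, [m] the vertical one, [a + ic] the lower left corner. *)
Definition rect_int (h : C -> C) (a c l m : R) : C :=
  (CInt (fun s => h (s, c) - h (s, c + m)%R) a (a + l)
   + Ci * CInt (fun t => h ((a + l)%R, t) - h (a, t)) c (c + m))%C.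

Definition in_rect (a c l m : R) (w : C) : Prop :=
  a <= fst w <= a + l /\ c <= snd w <= c + m.

Definition cdiff_on (h : C -> C) (P : C -> Prop) : Prop :=
  forall w, P w -> exists d, cderiv h w d.

Lemma cdiff_ccont_hor (h : C -> C) (a b y : R) :
  (forall x, a <= x <= b -> exists d, cderiv h (x, y) d) ->
  ccont_on (fun s => h (s, y)) a b.
Proof.
  intros H t Ht eps He. destruct (H t Ht) as [d Hd].
  destruct (cderiv_continuous _ _ _ Hd eps He) as [dl [Hdl K]].
  exists dl; split; [exact Hdl|]. intros s Hs.
  specialize (K (RtoC (s - t))). rewrite Cmod_R in K. specialize (K Hs).
  replace (s, y) with ((t, y) + RtoC (s - t))%C; [exact K|].
  unfold Cplus, RtoC; simpl. f_equal; ring.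
Qed.

Lemma Cmod_imag (y : R) : Cmod (0, y) = Rabs y.
Proof.
  unfold Cmod; simpl. replace (0 * (0 * 1) + y * (y * 1)) with (y ^ 2) by ring.
  rewrite <- pow2_abs. apply sqrt_pow2, Rabs_pos.
Qed.

Lemma cdiff_ccont_ver (h : C -> C) (a b x : R) :
  (forall y, a <= y <= b -> exists d, cderiv h (x, y) d) ->
  ccont_on (fun s => h (x, s)) a b.
Proof.
  intros H t Ht eps He. destruct (H t Ht) as [d Hd].
  destruct (cderiv_continuous _ _ _ Hd eps He) as [dl [Hdl K]].
  exists dl; split; [exact Hdl|]. intros s Hs.
  specialize (K (0, s - t)). rewrite Cmod_imag in K. specialize (K Hs).
  replace (x, s) with ((x, t) + (0, s - t)%R)%C; [exact K|].
  unfold Cplus; simpl. f_equal; ring.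
Qed.

(** An affine function has zero boundary integral, so only the remainder [h z - h w - d * (z - w)]
    counts; it is at most [eps * (l + m)] on a boundary of length [2 * (l + m)]. *)
Lemma rect_int_near (h : C -> C) (a c l m eps : R) (w d : C) :
  0 <= l -> 0 <= m -> 0 <= eps -> cdiff_on h (in_rect a c l m) -> in_rect a c l m w ->
  (forall z, in_rect a c l m z -> Cmod (h z - h w - d * (z - w))%C <= eps * Cmod (z - w)%C) ->
  Cmod (rect_int h a c l m) <= 4 * eps * (l + m) ^ 2.
Proof.
  intros Hl Hm He Hh Hw K.
  assert (K' : forall z, in_rect a c l m z -> Cmod (h z - h w - d * (z - w))%C <= eps * (l + m)).
  { intros z Hz. apply Rle_trans with (1 := K z Hz). apply Rmult_le_compat_l; [exact He|].
    eapply Rle_trans; [apply Cmod_le_parts|]. destruct z as [zx zy], w as [wx wy].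
    destruct Hz, Hw; simpl in *.
    assert (Rabs (zx + - wx) <= l) by (apply Rabs_le; lra).
    assert (Rabs (zy + - wy) <= m) by (apply Rabs_le; lra). lra. }
  assert (Two : forall z1 z2 k, in_rect a c l m z1 -> in_rect a c l m z2 -> (d * (z1 - z2))%C = k ->
     Cmod (h z1 - h z2 - k)%C <= 2 * (eps * (l + m))).
  { intros z1 z2 k H1 H2 <-.
    replace (h z1 - h z2 - d * (z1 - z2))%C with
      ((h z1 - h w - d * (z1 - w)) + - (h z2 - h w - d * (z2 - w)))%C by ring.
    eapply Rle_trans; [apply Cmod_triangle|]. rewrite Cmod_opp.
    pose proof (K' z1 H1). pose proof (K' z2 H2). lra. }
  unfold rect_int.
  set (I1 := CInt _ a (a + l)). set (I2 := CInt _ c (c + m)).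
  (* Differences of the affine part between opposite sides; they cancel because
     [k1 * l + Ci * k2 * m = 0]. *)
  set (k1 := (d * (0, - m)%R)%C). set (k2 := (d * RtoC l)%C).
  assert (B1 : Cmod (I1 - k1 * (a + l - a)%R)%C <= 2 * (2 * (eps * (l + m))) * (a + l - a)).
  { apply CInt_near_const; [lra| |].
    - apply ccont_minus; apply cdiff_ccont_hor; intros x Hx; apply Hh; split; simpl; lra.
    - intros t Ht. apply Two; try (split; simpl; lra).
      unfold k1. f_equal. unfold Cminus, Cplus, Copp; simpl; f_equal; ring. }
  assert (B2 : Cmod (I2 - k2 * (c + m - c)%R)%C <= 2 * (2 * (eps * (l + m))) * (c + m - c)).
  { apply CInt_near_const; [lra| |].
    - apply ccont_minus; apply cdiff_ccont_ver; intros x Hx; apply Hh; split; simpl; lra.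
    - intros t Ht. apply Two; try (split; simpl; lra).
      unfold k2. f_equal. unfold Cminus, Cplus, Copp; simpl; unfold RtoC; f_equal; ring. }
  replace (I1 + Ci * I2)%C with
    ((I1 - k1 * (a + l - a)%R) + Ci * (I2 - k2 * (c + m - c)%R))%C.
  2:{ replace (a + l - a) with l by ring. replace (c + m - c) with m by ring.
      unfold k1, k2. replace ((0, - m)%R : C) with (- (Ci * RtoC m))%C.
      2:{ unfold Ci, RtoC, Copp, Cmult; simpl; f_equal; ring. }
      ring. }
  eapply Rle_trans; [apply Cmod_triangle|]. rewrite Cmod_mult, Cmod_Ci.
  replace (a + l - a) with l in * by ring. replace (c + m - c) with m in * by ring. nra.
Qed.

Lemma rect_int_split_h (h : C -> C) (a c l1 l2 m : R) :
  0 <= l1 -> 0 <= l2 -> 0 <= m -> cdiff_on h (in_rect a c (l1 + l2) m) ->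
  rect_int h a c (l1 + l2) m = (rect_int h a c l1 m + rect_int h (a + l1) c l2 m)%C.
Proof.
  intros H1 H2 Hm Hh. unfold rect_int. rewrite <- Rplus_assoc.
  rewrite <- (CInt_Chasles _ a (a + l1) (a + l1 + l2)); try lra.
  2:{ apply ccont_minus; apply cdiff_ccont_hor; intros x Hx; apply Hh; split; simpl; lra. }
  rewrite (CInt_ext (fun t => h ((a + l1 + l2)%R, t) - h (a, t))%C
    (fun t => (h ((a + l1)%R, t) - h (a, t)) + (h ((a + l1 + l2)%R, t) - h ((a + l1)%R, t)))%C)
    by (intros; ring).
  rewrite CInt_plus; [ring|lra| |];
    apply ccont_minus; apply cdiff_ccont_ver; intros x Hx; apply Hh; split; simpl; lra.
Qed.

Lemma rect_int_split_v (h : C -> C) (a c l m1 m2 : R) :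
  0 <= l -> 0 <= m1 -> 0 <= m2 -> cdiff_on h (in_rect a c l (m1 + m2)) ->
  rect_int h a c l (m1 + m2) = (rect_int h a c l m1 + rect_int h a (c + m1) l m2)%C.
Proof.
  intros Hl H1 H2 Hh. unfold rect_int. rewrite <- Rplus_assoc.
  rewrite <- (CInt_Chasles _ c (c + m1) (c + m1 + m2)); try lra.
  2:{ apply ccont_minus; apply cdiff_ccont_ver; intros x Hx; apply Hh; split; simpl; lra. }
  rewrite (CInt_ext (fun s => h (s, c) - h (s, c + m1 + m2)%R)%C
    (fun s => (h (s, c) - h (s, c + m1)%R) + (h (s, c + m1)%R - h (s, c + m1 + m2)%R))%C)
    by (intros; ring).
  rewrite CInt_plus; [ring|lra| |];
    apply ccont_minus; apply cdiff_ccont_hor; intros x Hx; apply Hh; split; simpl; lra.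
Qed.

Lemma rect_int_quarter (h : C -> C) (a c l m K : R) :
  0 <= l -> 0 <= m -> cdiff_on h (in_rect a c l m) -> K <= Cmod (rect_int h a c l m) ->
  exists a' c', (a' = a \/ a' = a + l / 2) /\ (c' = c \/ c' = c + m / 2) /\
    K / 4 <= Cmod (rect_int h a' c' (l / 2) (m / 2)).
Proof.
  intros Hl Hm Hh HK.
  replace l with (l / 2 + l / 2) in HK, Hh by field.
  rewrite rect_int_split_h in HK; try lra; [|exact Hh].
  replace m with (m / 2 + m / 2) in HK, Hh by field.
  rewrite !rect_int_split_v in HK; try lra;
    try (intros w Hw; apply Hh; destruct Hw; split; simpl in *; lra).
  destruct (Rle_lt_dec (K / 4) (Cmod (rect_int h a c (l / 2) (m / 2)))) as [T|T1].
  { exists a, c. auto. }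
  destruct (Rle_lt_dec (K / 4) (Cmod (rect_int h a (c + m / 2) (l / 2) (m / 2)))) as [T|T2].
  { exists a, (c + m / 2). auto. }
  destruct (Rle_lt_dec (K / 4) (Cmod (rect_int h (a + l / 2) c (l / 2) (m / 2)))) as [T|T3].
  { exists (a + l / 2), c. auto. }
  destruct (Rle_lt_dec (K / 4) (Cmod (rect_int h (a + l / 2) (c + m / 2) (l / 2) (m / 2)))) as [T|T4].
  { exists (a + l / 2), (c + m / 2). auto. }
  exfalso. match type of HK with _ <= Cmod ((?p + ?q) + (?r + ?s))%C =>
    pose proof (Cmod_triangle (p + q) (r + s));
    pose proof (Cmod_triangle p q); pose proof (Cmod_triangle r s) end. lra.
Qed.

Lemma nested_point (u : nat -> R) (l : R) : 0 <= l ->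
  (forall n, u n <= u (S n) /\ u (S n) + l / 2 ^ S n <= u n + l / 2 ^ n) ->
  exists x, forall n, u n <= x <= u n + l / 2 ^ n.
Proof.
  intros Hl H.
  assert (P : forall n, 0 <= l / 2 ^ n).
  { intros n. apply Rdiv_le_0_compat; [lra|]. apply pow_lt; lra. }
  assert (M : forall n k, u n <= u (n + k)%nat /\ u (n + k)%nat + l / 2 ^ (n + k) <= u n + l / 2 ^ n).
  { intros n k. induction k as [|k IH]; [rewrite Nat.add_0_r; lra|].
    rewrite Nat.add_succ_r. pose proof (H (n + k)%nat). lra. }
  assert (B : forall n k, u n <= u k + l / 2 ^ k).
  { intros n k. destruct (Nat.le_ge_cases n k) as [E|E].
    - pose proof (M n (k - n)%nat) as T. replace (n + (k - n))%nat with k in T by lia.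
      pose proof (P k). lra.
    - pose proof (M k (n - k)%nat) as T. replace (k + (n - k))%nat with n in T by lia.
      pose proof (P n). lra. }
  destruct (completeness (fun y => exists n, y = u n)) as [x [Hx1 Hx2]].
  - exists (u 0%nat + l / 2 ^ 0). intros y [n ->]. apply B.
  - exists (u 0%nat). now exists 0%nat.
  - exists x. intros n. split; [apply Hx1; now exists n|].
    apply Hx2. intros y [k ->]. apply B.
Qed.

(** Some quarter always keeps a quarter of the modulus, whereas differentiability at the common
    point of the nested rectangles bounds their integrals by a smaller multiple of [/ 4 ^ n]. *)
Lemma goursat_rectangle (h : C -> C) (a c l m : R) :
  0 <= l -> 0 <= m -> cdiff_on h (in_rect a c l m) -> rect_int h a c l m = 0%C.
Proof.
  intros Hl Hm Hh. set (K := Cmod (rect_int h a c l m)).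
  destruct (Rle_lt_dec K 0) as [HK|HK].
  { apply Cmod_eq_0. apply Rle_antisym; [exact HK|apply Cmod_ge_0]. }
  exfalso.
  assert (P2 : forall n, 0 < 2 ^ n) by (intros; apply pow_lt; lra).
  pose (good := fun (n : nat) (p : R * R) =>
    a <= fst p /\ fst p + l / 2 ^ n <= a + l /\ c <= snd p /\ snd p + m / 2 ^ n <= c + m /\
    K / 4 ^ n <= Cmod (rect_int h (fst p) (snd p) (l / 2 ^ n) (m / 2 ^ n))).
  pose (next := fun (n : nat) (p q : R * R) =>
    good (S n) q /\ fst p <= fst q /\ fst q + l / 2 ^ S n <= fst p + l / 2 ^ n /\
    snd p <= snd q /\ snd q + m / 2 ^ S n <= snd p + m / 2 ^ n).
  assert (Nonneg : forall x n, 0 <= x -> 0 <= x / 2 ^ n).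
  { intros x n Hx. apply Rdiv_le_0_compat; auto. }
  assert (Half : forall x n, x / 2 ^ n / 2 = x / 2 ^ S n).
  { intros x n. simpl. field. apply Rgt_not_eq, P2. }
  assert (Step : forall n p, good n p -> exists q, next n p q).
  { intros n [x y] (G1 & G2 & G3 & G4 & G5); cbn [fst snd] in G1, G2, G3, G4, G5.
    destruct (rect_int_quarter h x y (l / 2 ^ n) (m / 2 ^ n) (K / 4 ^ n)) as (x' & y' & Hx & Hy & Hq); auto.
    { intros w [W1 W2]. apply Hh. split; lra. }
    rewrite !Half in Hq. pose proof (Half l n) as Hln. pose proof (Half m n) as Hmn.
    pose proof (Nonneg l n Hl). pose proof (Nonneg m n Hm).
    exists (x', y'). unfold next, good; simpl fst; simpl snd.
    replace (K / 4 ^ S n) with (K / 4 ^ n / 4) by (simpl; field; apply pow_nonzero; lra).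
    set (l1 := l / 2 ^ S n) in *. set (m1 := m / 2 ^ S n) in *.
    set (l0 := l / 2 ^ n) in *. set (m0 := m / 2 ^ n) in *. clearbody l0 l1 m0 m1.
    repeat split; try exact Hq; destruct Hx, Hy; subst; lra. }
  pose (step := fun n p => epsilon (inhabits (0, 0)) (next n p)).
  pose (seq := fix seq (n : nat) : R * R := match n with O => (a, c) | S k => step k (seq k) end).
  assert (Good : forall n, good n (seq n)).
  { induction n as [|n IH].
    - unfold good; simpl. unfold Rdiv. rewrite Rinv_1, !Rmult_1_r. fold K. lra.
    - destruct (epsilon_spec (inhabits (0, 0)) (next n (seq n)) (Step n _ IH)) as [G _]. exact G. }
  assert (Next : forall n, next n (seq n) (seq (S n))).
  { intros n. apply (epsilon_spec (inhabits (0, 0)) (next n (seq n))). apply Step, Good. }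
  destruct (nested_point (fun n => fst (seq n)) l Hl) as [x Hx].
  { intros n. destruct (Next n) as (_ & N1 & N2 & _). split; assumption. }
  destruct (nested_point (fun n => snd (seq n)) m Hm) as [y Hy].
  { intros n. destruct (Next n) as (_ & _ & _ & N3 & N4). split; assumption. }
  assert (Hin : in_rect a c l m (x, y)).
  { pose proof (Hx 0%nat) as X. pose proof (Hy 0%nat) as Y. simpl in X, Y.
    unfold Rdiv in X, Y. rewrite Rinv_1, Rmult_1_r in X, Y. split; simpl; lra. }
  destruct (Hh _ Hin) as [d Hd].
  set (P := l + m).
  (* This gives [4 * eps * P ^ 2 < K]; the [+ 1] keeps the denominator positive when the rectangle
     degenerates to a point. *)
  set (eps := K / (8 * (P ^ 2 + 1))).
  assert (Heps : 0 < eps) by (apply Rdiv_lt_0_compat; [lra|]; pose proof (pow2_ge_0 P); lra).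
  destruct (Hd eps Heps) as [dl [Hdl D]].
  assert (Small : exists n, P / 2 ^ n < dl).
  { destruct (pow_lt_1_zero (/ 2)) with (y := dl / (P + 1)) as [n Hn].
    - rewrite Rabs_pos_eq; lra.
    - apply Rdiv_lt_0_compat; [lra|unfold P; lra].
    - exists n. specialize (Hn n (le_n n)). rewrite Rabs_pos_eq in Hn by (apply pow_le; lra).
      rewrite pow_inv in Hn. unfold Rdiv.
      assert (HP : 0 <= P) by (unfold P; lra).
      assert (0 < / 2 ^ n) by (apply Rinv_0_lt_compat, P2).
      apply Rle_lt_trans with ((P + 1) * / 2 ^ n); [nra|].
      replace dl with ((P + 1) * (dl / (P + 1))) by (field; lra).
      apply Rmult_lt_compat_l; lra. }
  destruct Small as [n Hn].
  pose proof (Good n) as (G1 & G2 & G3 & G4 & G5).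
  assert (B : Cmod (rect_int h (fst (seq n)) (snd (seq n)) (l / 2 ^ n) (m / 2 ^ n))
    <= 4 * eps * (l / 2 ^ n + m / 2 ^ n) ^ 2).
  { apply (rect_int_near h _ _ _ _ eps (x, y) d); auto; try lra.
    - intros w [W1 W2]. apply Hh. split; lra.
    - split; simpl; [apply Hx|apply Hy].
    - intros z [Z1 Z2]. specialize (D (z - (x, y))%C).
      replace ((x, y) + (z - (x, y)))%C with z in D by ring. apply D.
      eapply Rle_lt_trans; [apply Cmod_le_parts|]. destruct z as [zx zy]; simpl in *.
      specialize (Hx n). specialize (Hy n).
      assert (Rabs (zx + - x) <= l / 2 ^ n) by (apply Rabs_le; lra).
      assert (Rabs (zy + - y) <= m / 2 ^ n) by (apply Rabs_le; lra).
      unfold P in Hn. replace ((l + m) / 2 ^ n) with (l / 2 ^ n + m / 2 ^ n) in Hn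
        by (field; apply Rgt_not_eq, P2). lra. }
  replace ((l / 2 ^ n + m / 2 ^ n) ^ 2) with (P ^ 2 / 4 ^ n) in B.
  2:{ unfold P. replace 4 with (2 * 2) by ring. rewrite Rpow_mult_distr. field.
      apply Rgt_not_eq, P2. }
  assert (0 < / 4 ^ n) by (apply Rinv_0_lt_compat, pow_lt; lra).
  assert (K / 4 ^ n <= 4 * eps * (P ^ 2 / 4 ^ n)) by lra.
  assert (K <= 4 * eps * P ^ 2) by (unfold Rdiv in *; nra).
  assert (E : eps * (8 * (P ^ 2 + 1)) = K) by (unfold eps; field; pose proof (pow2_ge_0 P); lra).
  nra.
Qed.

(** * The Schwarz lemma *)

Definition cexp (w : C) : C := (exp (fst w) * cos (snd w), exp (fst w) * sin (snd w)).

Lemma cexp_plus (a b : C) : cexp (a + b)%C = (cexp a * cexp b)%C.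
Proof.
  unfold cexp, Cmult, Cplus; simpl. rewrite exp_plus, cos_plus, sin_plus. f_equal; ring.
Qed.

Lemma Cmod_cexp (w : C) : Cmod (cexp w) = exp (fst w).
Proof.
  unfold Cmod, cexp; simpl.
  replace (_ + _) with ((exp (fst w)) ^ 2 * (Rsqr (sin (snd w)) + Rsqr (cos (snd w))))
    by (unfold Rsqr; ring).
  rewrite sin2_cos2, Rmult_1_r. apply sqrt_pow2. left; apply exp_pos.
Qed.

Lemma cexp_0 : cexp 0%C = 1%C.
Proof. unfold cexp; simpl. rewrite exp_0, cos_0, sin_0. unfold RtoC. f_equal; ring. Qed.

Lemma derivable_pt_lim_le (f : R -> R) (x l : R) : derivable_pt_lim f x l ->
  forall eps, 0 < eps -> exists delta, 0 < delta /\
    forall h, Rabs h < delta -> Rabs (f (x + h) - f x - l * h) <= eps * Rabs h.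
Proof.
  intros H eps He. destruct (H eps He) as [dl Hd]. exists dl. split; [apply cond_pos|].
  intros h Hh. destruct (Req_dec h 0) as [->|Hn].
  { rewrite Rplus_0_r. replace (f x - f x - l * 0) with 0 by ring. rewrite Rabs_R0. lra. }
  specialize (Hd h Hn Hh).
  replace (f (x + h) - f x - l * h) with (((f (x + h) - f x) / h - l) * h) by (field; exact Hn).
  rewrite Rabs_mult. apply Rmult_le_compat_r; [apply Rabs_pos|lra].
Qed.

(** First-order expansions of [exp], [cos] and [sin] at 0 are multiplied out; at other points the
    functional equation takes over. *)
Lemma cderiv_cexp_0 : cderiv cexp 0%C 1%C.
Proof.
  intros eps He. set (e := Rmin 1 (eps / 10)).
  assert (He' : 0 < e) by (apply Rmin_pos; lra).
  assert (E1 : e <= 1) by apply Rmin_l. assert (E2 : e <= eps / 10) by apply Rmin_r.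
  destruct (derivable_pt_lim_le exp 0 _ (derivable_pt_lim_exp 0) e He') as [d1 [D1 K1]].
  destruct (derivable_pt_lim_le cos 0 _ (derivable_pt_lim_cos 0) e He') as [d2 [D2 K2]].
  destruct (derivable_pt_lim_le sin 0 _ (derivable_pt_lim_sin 0) e He') as [d3 [D3 K3]].
  exists (Rmin (Rmin d1 d2) (Rmin d3 (e / 3))).
  split; [repeat apply Rmin_pos; lra|]. intros h Hh.
  pose proof (Rmin_l (Rmin d1 d2) (Rmin d3 (e / 3))). pose proof (Rmin_r (Rmin d1 d2) (Rmin d3 (e / 3))).
  pose proof (Rmin_l d1 d2). pose proof (Rmin_r d1 d2).
  pose proof (Rmin_l d3 (e / 3)). pose proof (Rmin_r d3 (e / 3)).
  replace (0 + h)%C with h by ring. rewrite cexp_0.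
  eapply Rle_trans; [apply Cmod_le_parts|].
  pose proof (fst_le_Cmod h) as F1. pose proof (snd_le_Cmod h) as F2.
  destruct h as [s t]. simpl in F1, F2. set (m := Cmod (s, t)) in *.
  specialize (K1 s ltac:(lra)). specialize (K2 t ltac:(lra)). specialize (K3 t ltac:(lra)).
  rewrite !Rplus_0_l, exp_0 in K1. rewrite !Rplus_0_l, cos_0, sin_0 in K2.
  rewrite !Rplus_0_l, sin_0, cos_0 in K3.
  set (r1 := exp s - 1 - 1 * s) in *. set (r2 := cos t - 1 - -0 * t) in *.
  set (r3 := sin t - 0 - 1 * t) in *.
  unfold cexp; simpl.
  replace (exp s * cos t + - (1) + - (1 * s - 0 * t)) with (r1 + (r1 + 1 + s) * r2)
    by (unfold r1, r2; ring).
  replace (exp s * sin t + - 0 + - (1 * t + 0 * s)) with (r1 * t + s * t + (r1 + 1 + s) * r3)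
    by (unfold r1, r3; ring).
  assert (M : 0 <= m) by apply Cmod_ge_0.
  assert (R1 : Rabs r1 <= e * m) by nra. assert (R2 : Rabs r2 <= e * m) by nra.
  assert (R3 : Rabs r3 <= e * m) by nra.
  assert (B : Rabs (r1 + 1 + s) <= 3).
  { eapply Rle_trans; [apply Rabs_triang|].
    eapply Rle_trans; [apply Rplus_le_compat_r, Rabs_triang|]. rewrite Rabs_R1. nra. }
  assert (T1 : Rabs (r1 + (r1 + 1 + s) * r2) <= e * m + 3 * (e * m)).
  { eapply Rle_trans; [apply Rabs_triang|]. rewrite Rabs_mult.
    apply Rplus_le_compat; [exact R1|]. apply Rmult_le_compat; auto using Rabs_pos. }
  assert (T2 : Rabs (r1 * t + s * t + (r1 + 1 + s) * r3) <= e * m + e * m + 3 * (e * m)).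
  { eapply Rle_trans; [apply Rabs_triang|]. apply Rplus_le_compat.
    - eapply Rle_trans; [apply Rabs_triang|]. rewrite !Rabs_mult.
      pose proof (Rabs_pos r1). pose proof (Rabs_pos s). pose proof (Rabs_pos t).
      apply Rplus_le_compat.
      + apply Rle_trans with (e * m * 1); [|lra]. apply Rmult_le_compat; lra.
      + rewrite (Rmult_comm (Rabs s)), (Rmult_comm e). apply Rmult_le_compat; lra.
    - rewrite Rabs_mult. apply Rmult_le_compat; auto using Rabs_pos. }
  nra.
Qed.

Lemma cderiv_cexp (w : C) : cderiv cexp w (cexp w).
Proof.
  intros eps He.
  destruct (cderiv_cexp_0 (eps / exp (fst w))) as [dl [Hd K]].
  { apply Rdiv_lt_0_compat; [exact He|apply exp_pos]. }
  exists dl; split; [exact Hd|]. intros h Hh. specialize (K h Hh).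
  replace (0 + h)%C with h in K by ring. rewrite cexp_0 in K.
  rewrite cexp_plus. replace (cexp w * cexp h - cexp w - cexp w * h)%C with
    (cexp w * (cexp h - 1 - 1 * h))%C by ring.
  rewrite Cmod_mult, Cmod_cexp.
  apply (Rmult_le_compat_l (exp (fst w))) in K; [|left; apply exp_pos].
  replace (exp (fst w) * (eps / exp (fst w) * Cmod h)) with (eps * Cmod h) in K; [exact K|].
  field. apply Rgt_not_eq, exp_pos.
Qed.

Lemma CInt_zero (g : R -> C) (a b : R) : (forall t, g t = 0%C) -> CInt g a b = 0%C.
Proof.
  intros H. unfold CInt. rewrite (RInt_ext _ (fun _ => 0)), (RInt_ext (fun t => snd (g t)) (fun _ => 0));
    try (intros; now rewrite H).
  rewrite !(RInt_const (V := R_CompleteNormedModule)).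
  unfold scal; simpl. unfold mult; simpl. unfold RtoC. f_equal; ring.
Qed.

Definition hol_disc_map (f : C -> C) : Prop :=
  forall z, Cmod z < 1 -> (exists d, cderiv f z d) /\ Cmod (f z) < 1.

(* [f (cexp w) * cexp (- w)] is [2 i pi]-periodic, so by Goursat its integral over a period does
   not depend on the real part of [w]; it is at most [exp (- Re w)] and tends to
   [2 pi d] as the real part goes to minus infinity. *)
Lemma schwarz_derivative_0 (f : C -> C) (d : C) :
  hol_disc_map f -> f 0%C = 0%C -> cderiv f 0%C d -> Cmod d <= 1.
Proof.
  intros Hf H0 Hd. apply Rnot_lt_le. intros Hgt.
  (* A rotation that makes [u * d] the positive number [Cmod d], so that real parts suffice
     below. *)
  set (u := (Cconj d / Cmod d)%C).
  assert (Hd0 : d <> 0%C) by (apply Cmod_gt_0; lra).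
  assert (Hu : (u * d)%C = RtoC (Cmod d)).
  { unfold u. replace (Cconj d / Cmod d * d)%C with (d * Cconj d / Cmod d)%C
      by (field; intros E; injection E; lra).
    rewrite <- Cmod2_conj. simpl. rewrite Rmult_1_r, RtoC_mult. field.
    intros E; injection E; lra. }
  assert (Hum : Cmod u = 1).
  { apply (Rmult_eq_reg_r (Cmod d)); [|lra]. rewrite <- Cmod_mult, Hu, Cmod_R, Rabs_pos_eq; lra. }
  (* On the right edge the real part of [h] will be at most [1 + e], on the left edge at least
     [Cmod d - e = 1 + 3 e]. *)
  set (e := (Cmod d - 1) / 4).
  destruct (Hd e ltac:(unfold e; lra)) as [dl [Hdl K]].
  set (h := fun w => (u * f (cexp w) * cexp (- w))%C).
  assert (Hh : forall w, fst w < 0 -> exists d, cderiv h w d).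
  { intros w Hw. destruct (Hf (cexp w)) as [[d' Hd'] _].
    { rewrite Cmod_cexp, <- exp_0. now apply exp_increasing. }
    eexists. apply (cderiv_mult (fun w => u * f (cexp w))%C (fun w => cexp (- w))).
    - apply cderiv_cmult. apply (cderiv_comp cexp f); [apply cderiv_cexp|exact Hd'].
    - apply (cderiv_comp Copp cexp); [|apply cderiv_cexp].
      apply (cderiv_ext (fun w => (-1) * w)%C); [intros; ring|].
      apply cderiv_cmult, cderiv_id. }
  (* [exp (- s1) = 1 + e] bounds the factor [cexp (- w)] on the right edge; [exp s0 < dl] places the
     left edge where the derivative at 0 controls [f]. *)
  set (s1 := - ln (1 + e)). set (s0 := Rmin (s1 - 1) (ln (dl / 2))).
  assert (He : 0 < e) by (unfold e; lra).
  assert (Hs1 : s1 < 0).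
  { unfold s1. rewrite <- Ropp_0. apply Ropp_lt_contravar. rewrite <- ln_1. apply ln_increasing; lra. }
  assert (Hs0 : s0 <= s1 - 1) by apply Rmin_l.
  assert (Hs0' : exp s0 < dl).
  { apply Rle_lt_trans with (exp (ln (dl / 2))).
    - destruct (Rmin_r (s1 - 1) (ln (dl / 2))) as [L|L]; fold s0 in L.
      + left. now apply exp_increasing.
      + right. now rewrite L.
    - rewrite exp_ln; lra. }
  pose proof PI_RGT_0 as HPI.
  assert (G : rect_int h s0 0 (s1 - s0) (2 * PI) = 0%C).
  { apply goursat_rectangle; try lra. intros w [W1 W2]. apply Hh. lra. }
  (* By periodicity the two horizontal sides cancel. *)
  unfold rect_int in G. rewrite (CInt_zero (fun s => h (s, 0) - h (s, 0 + 2 * PI)%R)%C) in G.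
  2:{ intros s. unfold h. replace (cexp (s, 0 + 2 * PI)%R) with (cexp (s, 0)).
      2:{ unfold cexp; simpl. now rewrite Rplus_0_l, cos_2PI, sin_2PI, cos_0, sin_0. }
      replace (cexp (- (s, 0 + 2 * PI)%R)%C) with (cexp (- (s, 0))%C); [ring|].
      unfold cexp; simpl. rewrite Rplus_0_l, Ropp_0, cos_neg, sin_neg, cos_2PI, sin_2PI, cos_0, sin_0.
      now rewrite Ropp_0. }
  set (g := fun t => (h ((s0 + (s1 - s0))%R, t) - h (s0, t))%C) in G.
  assert (G' : CInt g 0 (0 + 2 * PI) = 0%C).
  { replace (CInt g 0 (0 + 2 * PI)) with (- Ci * (0 + Ci * CInt g 0 (0 + 2 * PI)))%C; [rewrite G; ring|].
    transitivity (- (Ci * Ci) * CInt g 0 (0 + 2 * PI))%C; [ring|].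
    replace (Ci * Ci)%C with (RtoC (-1)) by (unfold Ci, Cmult, RtoC; simpl; f_equal; ring). ring. }
  assert (Eg : ex_RInt (fun t => fst (g t)) 0 (0 + 2 * PI)).
  { apply (ccont_ex_RInt g); [lra|]. apply ccont_minus; apply cdiff_ccont_ver; intros y _; apply Hh; simpl; lra. }
  assert (Bound : forall t, fst (g t) <= - e).
  { intros t. unfold g. replace (s0 + (s1 - s0)) with s1 by ring.
    change (fst (h (s1, t)) + - fst (h (s0, t)) <= - e).
    assert (B1 : fst (h (s1, t)) <= 1 + e).
    { apply Rle_trans with (1 := Rle_abs _). apply Rle_trans with (1 := fst_le_Cmod _).
      unfold h. rewrite !Cmod_mult, Hum, Cmod_cexp. simpl.
      replace (- s1) with (ln (1 + e)) by (unfold s1; ring). rewrite exp_ln by lra.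
      destruct (Hf (cexp (s1, t))) as [_ Hb].
      { rewrite Cmod_cexp, <- exp_0. now apply exp_increasing. }
      pose proof (Cmod_ge_0 (f (cexp (s1, t)))). nra. }
    assert (B0 : Cmod (h (s0, t) - Cmod d)%C <= e).
    { unfold h. assert (Kw := K (cexp (s0, t))). rewrite Cmod_cexp in Kw. simpl in Kw.
      specialize (Kw Hs0'). replace (0 + cexp (s0, t))%C with (cexp (s0, t)) in Kw by ring.
      rewrite H0 in Kw.
      assert (Inv : (cexp (s0, t) * cexp (- (s0, t)))%C = 1%C).
      { rewrite <- cexp_plus. replace ((s0, t) + - (s0, t))%C with (RtoC 0) by ring. apply cexp_0. }
      replace (u * f (cexp (s0, t)) * cexp (- (s0, t)) - Cmod d)%C with
        (u * (f (cexp (s0, t)) - 0 - d * cexp (s0, t)) * cexp (- (s0, t)))%C.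
      2:{ rewrite <- Hu. transitivity (u * f (cexp (s0, t)) * cexp (- (s0, t))
              - u * d * (cexp (s0, t) * cexp (- (s0, t))))%C; [ring|]. rewrite Inv. ring. }
      rewrite !Cmod_mult, Hum, Cmod_cexp. simpl.
      apply Rle_trans with (1 * (e * exp s0) * exp (- s0)).
      - apply Rmult_le_compat_r; [left; apply exp_pos|]. lra.
      - rewrite exp_Ropp. right. field. apply Rgt_not_eq, exp_pos. }
    assert (F' : Rabs (fst (h (s0, t)) + - Cmod d) <= e)
      by (apply Rle_trans with (2 := B0); apply (fst_le_Cmod (h (s0, t) - Cmod d)%C)).
    apply Rabs_le_between in F'. unfold e in *. lra. }
  assert (I : RInt (fun t => fst (g t)) 0 (0 + 2 * PI) <= RInt (fun _ => - e) 0 (0 + 2 * PI)).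
  { apply RInt_le; [lra|exact Eg|apply (ex_RInt_const (V := R_NormedModule))|]. intros; apply Bound. }
  rewrite (RInt_const (V := R_CompleteNormedModule)) in I.
  unfold scal in I; simpl in I. unfold mult in I; simpl in I.
  unfold CInt in G'. injection G' as G1 G2. rewrite G1 in I.
  pose proof (Rmult_lt_0_compat _ _ HPI He). lra.
Qed.

(** * The Schwarz--Pick lemma *)

(** Induction on the real line: at the supremum of the times where the bound holds, the local
    hypothesis carries it over from the left and then further to the right. *)
Lemma locally_decreasing_le (H : R -> R) (a b : R) : a <= b ->
  (forall t, a <= t <= b -> exists delta, 0 < delta /\ forall s, a <= s <= b -> Rabs (s - t) < delta ->
     (t <= s -> H s <= H t) /\ (s <= t -> H t <= H s)) -> H b <= H a.
Proof.
  intros Hab L.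
  set (A := fun t => a <= t <= b /\ H t <= H a).
  destruct (completeness A) as [T [T1 T2]].
  { exists b. intros t [Ht _]. lra. }
  { exists a. split; lra. }
  assert (HT : a <= T <= b).
  { split; [apply T1; split; lra|]. apply T2. intros t [Ht _]; lra. }
  destruct (L T HT) as [dl [Hd K]].
  assert (S : exists s, A s /\ T - dl < s <= T).
  { destruct (classic (exists s, A s /\ T - dl < s)) as [[s [As Hs]]|N].
    - exists s. repeat split; try apply As; try exact Hs. now apply T1.
    - exfalso. assert (T <= T - dl); [|lra]. apply T2. intros s As.
      apply Rnot_lt_le. intros Hs. apply N. now exists s. }
  destruct S as [s [[Hs As] Hs']].
  assert (KT : H T <= H a).
  { destruct (K s Hs) as [_ K2]; [rewrite Rabs_left1; lra|]. specialize (K2 ltac:(lra)). lra. }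
  destruct (Req_dec T b) as [<-|Hn]; [exact KT|].
  exfalso. set (s' := Rmin b (T + dl / 2)).
  assert (s' <= b) by apply Rmin_l. assert (s' <= T + dl / 2) by apply Rmin_r.
  assert (T < s') by (apply Rmin_glb_lt; lra).
  destruct (K s') as [K1 _]; [lra|rewrite Rabs_pos_eq; lra|].
  assert (s' <= T); [|lra]. apply T1. split; [lra|]. specialize (K1 ltac:(lra)). lra.
Qed.

(** A mean value inequality that asks only for a pointwise Lipschitz constant [rho t], not for a
    derivative of [g]. It turns the infinitesimal estimates of the proof into estimates of
    distances. *)
Lemma dini_bound (g G rho : R -> R) (a b : R) : a <= b ->
  (forall t, a <= t <= b -> forall eps, 0 < eps -> exists delta, 0 < delta /\
     forall s, a <= s <= b -> Rabs (s - t) < delta -> Rabs (g s - g t) <= (rho t + eps) * Rabs (s - t)) ->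
  (forall t, a <= t <= b -> derivable_pt_lim G t (rho t)) ->
  Rabs (g b - g a) <= G b - G a.
Proof.
  intros Hab Hg HG.
  assert (One : forall f : R -> R,
    (forall t, a <= t <= b -> forall eps, 0 < eps -> exists delta, 0 < delta /\
     forall s, a <= s <= b -> Rabs (s - t) < delta -> Rabs (f s - f t) <= (rho t + eps) * Rabs (s - t)) ->
    f b - f a <= G b - G a).
  { intros f Hf. apply Rnot_lt_le. intros Hlt.
    destruct (Req_dec a b) as [->|Hne]; [lra|].
    (* [f - G] has slopes at most [2 e], so it grows by at most [2 e (b - a)], while this [e] makes
       the supposed excess equal to [4 e (b - a)]. *)
    set (e := ((f b - f a) - (G b - G a)) / (4 * (b - a))).
    assert (He : 0 < e) by (apply Rdiv_lt_0_compat; lra).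
    assert (Ee : 4 * e * (b - a) = (f b - f a) - (G b - G a)) by (unfold e; field; lra).
    assert (M : f b - G b - 2 * e * b <= f a - G a - 2 * e * a).
    { apply (locally_decreasing_le (fun t => f t - G t - 2 * e * t) a b Hab).
      intros t Ht. destruct (Hf t Ht e He) as [d1 [D1 K1]].
      destruct (derivable_pt_lim_le G t _ (HG t Ht) e He) as [d2 [D2 K2]].
      exists (Rmin d1 d2). split; [now apply Rmin_pos|]. intros s Hs Hst.
      pose proof (Rmin_l d1 d2). pose proof (Rmin_r d1 d2).
      specialize (K1 s Hs ltac:(lra)). specialize (K2 (s - t) ltac:(lra)).
      replace (t + (s - t)) with s in K2 by ring.
      apply Rabs_le_between in K1. apply Rabs_le_between in K2.
      split; intros Hc; [rewrite Rabs_pos_eq in K1, K2 by lra|rewrite Rabs_left1 in K1, K2 by lra]; nra. }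
    nra. }
  apply Rabs_le. split.
  - assert (T := One (fun t => - g t)). cbv beta in T.
    assert (- g b - - g a <= G b - G a); [|lra]. apply T.
    intros t Ht eps He. destruct (Hg t Ht eps He) as [d [D K]].
    exists d; split; [exact D|]. intros s Hs Hst. replace (- g s - - g t) with (- (g s - g t)) by ring.
    rewrite Rabs_Ropp. now apply K.
  - now apply One.
Qed.

(** * The function [artanh] *)

Lemma artanh_0 : artanh 0 = 0.
Proof. unfold artanh. replace ((1 + 0) / (1 - 0)) with 1 by field. rewrite ln_1. ring. Qed.

Lemma artanh_derive (x : R) : -1 < x < 1 -> derivable_pt_lim artanh x (/ (1 - x ^ 2)).
Proof.
  intros Hx. apply is_derive_Reals. unfold artanh. auto_derive.
  - repeat split; try lra; apply Rdiv_lt_0_compat; lra.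
  - field; repeat split; nra.
Qed.

Lemma artanh_incr (x y : R) : 0 <= x -> x < y -> y < 1 -> artanh x < artanh y.
Proof.
  intros H1 H2 H3. unfold artanh. apply Rmult_lt_compat_l; [lra|]. apply ln_increasing.
  { apply Rdiv_lt_0_compat; lra. }
  apply (Rmult_lt_reg_r ((1 - x) * (1 - y))); [nra|].
  replace ((1 + x) / (1 - x) * ((1 - x) * (1 - y))) with ((1 + x) * (1 - y)) by (field; lra).
  replace ((1 + y) / (1 - y) * ((1 - x) * (1 - y))) with ((1 + y) * (1 - x)) by (field; lra). nra.
Qed.

Lemma artanh_le (x y : R) : 0 <= x -> x <= y -> y < 1 -> artanh x <= artanh y.
Proof. intros H1 [H2| ->] H3; [left; now apply artanh_incr|lra]. Qed.

Lemma artanh_le_inv (x y : R) : 0 <= x < 1 -> 0 <= y -> artanh x <= artanh y -> x <= y.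
Proof. intros H1 H2 H. apply Rnot_lt_le. intros L. pose proof (artanh_incr y x ltac:(lra) L ltac:(lra)). lra. Qed.

Lemma artanh_pos (x : R) : 0 <= x < 1 -> 0 <= artanh x.
Proof. intros H. rewrite <- artanh_0. apply artanh_le; lra. Qed.

Lemma ln_le_sub (y : R) : 0 < y -> ln y <= y - 1.
Proof.
  intros Hy. rewrite <- (exp_ln y Hy) at 2. pose proof (exp_ineq1_le (ln y)). lra.
Qed.

Lemma artanh_upper (x : R) : 0 <= x < 1 -> artanh x <= x / (1 - x).
Proof.
  intros H. unfold artanh. pose proof (ln_le_sub ((1 + x) / (1 - x)) ltac:(apply Rdiv_lt_0_compat; lra)).
  replace (x / (1 - x)) with (/ 2 * ((1 + x) / (1 - x) - 1)) by (field; lra). lra.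
Qed.

(** Additivity of the Poincare distance along a radius; it converts differences of [artanh] into
    Moebius quotients. *)
Lemma artanh_add (x y : R) : 0 <= x < 1 -> 0 <= y < 1 ->
  artanh ((x + y) / (1 + x * y)) = artanh x + artanh y.
Proof.
  intros Hx Hy. unfold artanh. rewrite <- Rmult_plus_distr_l. f_equal.
  rewrite <- ln_mult by (apply Rdiv_lt_0_compat; lra). f_equal. field. repeat split; nra.
Qed.

Lemma artanh_bounded (M : R) : 0 <= M -> exists rho, 0 <= rho < 1 /\
  forall x, 0 <= x < 1 -> artanh x <= M -> x <= rho.
Proof.
  intros HM. set (e := exp (2 * M)).
  assert (He : 1 <= e). { unfold e. pose proof (exp_ineq1_le (2 * M)). lra. }
  exists ((e - 1) / (e + 1)). split.
  - split; [apply Rdiv_le_0_compat; lra|]. apply (Rmult_lt_reg_r (e + 1)); [lra|].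
    unfold Rdiv. rewrite Rmult_assoc, Rinv_l; lra.
  - intros x Hx H. unfold artanh in H.
    assert (L : ln ((1 + x) / (1 - x)) <= 2 * M) by lra.
    assert (E : (1 + x) / (1 - x) <= e).
    { rewrite <- (exp_ln ((1 + x) / (1 - x))) by (apply Rdiv_lt_0_compat; lra).
      unfold e. destruct L as [L|L]; [left; now apply exp_increasing|rewrite L; lra]. }
    apply (Rmult_le_compat_r (1 - x)) in E; [|lra].
    unfold Rdiv in E. rewrite Rmult_assoc, Rinv_l, Rmult_1_r in E by lra.
    apply (Rmult_le_reg_r (e + 1)); [lra|]. unfold Rdiv. rewrite Rmult_assoc, Rinv_l; lra.
Qed.

(** * Moebius transformations of the disc *)

Definition mob (a z : C) : C := ((z - a) / (1 - Cconj a * z))%C.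

Lemma Cmod_lt_1_neq (z : C) : Cmod z < 1 -> (1 - z)%C <> 0%C.
Proof.
  intros H E. assert (z = 1%C) as -> by (replace z with (1 - (1 - z))%C by ring; rewrite E; ring).
  rewrite Cmod_1 in H. lra.
Qed.

Lemma mob_den (a z : C) : Cmod a < 1 -> Cmod z < 1 -> (1 - Cconj a * z)%C <> 0%C.
Proof.
  intros Ha Hz. apply Cmod_lt_1_neq. rewrite Cmod_mult, Cmod_conj.
  pose proof (Cmod_ge_0 a). pose proof (Cmod_ge_0 z). nra.
Qed.

(** The identity behind the invariance of the Poincare distance: it computes
    [1 - Cmod (mob a z) ^ 2] without dividing. *)
Lemma mob_identity (a z : C) :
  Cmod (1 - Cconj a * z)%C ^ 2 - Cmod (z - a)%C ^ 2 = (1 - Cmod a ^ 2) * (1 - Cmod z ^ 2).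
Proof. rewrite !Cmod2_alt. destruct a as [p q], z as [x y]. unfold Re, Im; simpl. ring. Qed.

Lemma mob_lt_1 (a z : C) : Cmod a < 1 -> Cmod z < 1 -> Cmod (mob a z) < 1.
Proof.
  intros Ha Hz. pose proof (mob_den a z Ha Hz) as Hn. unfold mob. rewrite Cmod_div by exact Hn.
  assert (Hp : 0 < Cmod (1 - Cconj a * z)%C) by now apply Cmod_gt_0.
  pose proof (mob_identity a z) as E.
  pose proof (Cmod_ge_0 a). pose proof (Cmod_ge_0 z). pose proof (Cmod_ge_0 (z - a)%C).
  apply (Rmult_lt_reg_r (Cmod (1 - Cconj a * z)%C)); [exact Hp|].
  unfold Rdiv. rewrite Rmult_assoc, Rinv_l, Rmult_1_r, Rmult_1_l by lra.
  apply Rnot_le_lt. intros L.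
  assert (0 < (1 - Cmod a ^ 2) * (1 - Cmod z ^ 2)) by (apply Rmult_lt_0_compat; nra). nra.
Qed.

Lemma mob_derive (a z : C) : Cmod a < 1 -> Cmod z < 1 ->
  cderiv (mob a) z ((1 - a * Cconj a) / ((1 - Cconj a * z) * (1 - Cconj a * z)))%C.
Proof.
  intros Ha Hz. pose proof (mob_den a z Ha Hz) as Hn.
  replace ((1 - a * Cconj a) / ((1 - Cconj a * z) * (1 - Cconj a * z)))%C with
    (((1 - 0) * (1 - Cconj a * z) - (z - a) * (0 - Cconj a * 1)) / ((1 - Cconj a * z) * (1 - Cconj a * z)))%C
    by (field; exact Hn).
  apply (cderiv_div (fun z => z - a)%C (fun z => 1 - Cconj a * z)%C); [exact Hn| |].
  - apply cderiv_minus; [apply cderiv_id|apply cderiv_const].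
  - apply cderiv_minus; [apply cderiv_const|apply cderiv_cmult, cderiv_id].
Qed.

Lemma mob_neg_0 (a : C) : mob (- a)%C 0%C = a.
Proof. unfold mob. rewrite Copp_conj. field. Qed.

Lemma mob_self (a : C) : mob a a = 0%C.
Proof. unfold mob. replace (a - a)%C with (RtoC 0) by ring. unfold Cdiv. ring. Qed.

Lemma mob_cancel (a z : C) : Cmod a < 1 -> Cmod z < 1 -> mob (- a)%C (mob a z) = z.
Proof.
  intros Ha Hz. pose proof (mob_den a z Ha Hz) as H1.
  assert (H2 : (1 - Cconj a * a)%C <> 0%C) by now apply mob_den.
  unfold mob. rewrite Copp_conj. field. split; [exact H1|].
  intros E. apply H2. rewrite <- E. ring.
Qed.

Lemma hol_disc_map_comp (f g : C -> C) : hol_disc_map f -> hol_disc_map g -> hol_disc_map (fun z => g (f z)).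
Proof.
  intros Hf Hg z Hz. destruct (Hf z Hz) as [[d Hd] Hfz]. destruct (Hg (f z) Hfz) as [[e He] Hgz].
  split; [|exact Hgz]. exists (e * d)%C. now apply cderiv_comp.
Qed.

Lemma hol_disc_map_mob (a : C) : Cmod a < 1 -> hol_disc_map (mob a).
Proof.
  intros Ha z Hz. split; [|now apply mob_lt_1]. eexists. now apply mob_derive.
Qed.

Lemma one_sub_Cmod2_conj (a : C) : (1 - a * Cconj a)%C = RtoC (1 - Cmod a ^ 2).
Proof. rewrite RtoC_minus. rewrite <- Cmod2_conj. reflexivity. Qed.

Lemma schwarz_pick (f : C -> C) (z d : C) : hol_disc_map f -> Cmod z < 1 -> cderiv f z d ->
  Cmod d * (1 - Cmod z ^ 2) <= 1 - Cmod (f z) ^ 2.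
Proof.
  intros Hf Hz Hd. destruct (Hf z Hz) as [_ Hfz].
  assert (Hz' : Cmod (- z)%C < 1) by now rewrite Cmod_opp.
  set (g := fun w => mob (f z) (f (mob (- z)%C w))).
  assert (E0 : mob (- z)%C 0%C = z) by apply mob_neg_0.
  assert (Z0 : Cmod 0%C < 1) by (rewrite Cmod_0; lra).
  pose proof (Cmod_ge_0 z). pose proof (Cmod_ge_0 (f z)).
  assert (P : 0 < 1 - Cmod (f z) ^ 2) by nra.
  assert (D : cderiv g 0%C (RtoC (/ (1 - Cmod (f z) ^ 2)) * (d * RtoC (1 - Cmod z ^ 2)))%C).
  { apply (cderiv_comp (fun w => f (mob (- z)%C w)) (mob (f z))).
    - apply (cderiv_comp (mob (- z)%C) f); [|now rewrite E0].
      pose proof (mob_derive (- z)%C 0%C Hz' Z0) as M.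
      rewrite one_sub_Cmod2_conj, Cmod_opp in M.
      replace (RtoC (1 - Cmod z ^ 2)) with
        (RtoC (1 - Cmod z ^ 2) / ((1 - Cconj (- z) * 0) * (1 - Cconj (- z) * 0)))%C; [exact M|].
      rewrite !Cmult_0_r. field.
    - rewrite E0. pose proof (mob_derive (f z) (f z) Hfz Hfz) as M.
      rewrite (Cmult_comm (Cconj (f z))), one_sub_Cmod2_conj in M.
      replace (RtoC (/ (1 - Cmod (f z) ^ 2))) with
        (RtoC (1 - Cmod (f z) ^ 2) / (RtoC (1 - Cmod (f z) ^ 2) * RtoC (1 - Cmod (f z) ^ 2)))%C; [exact M|].
      rewrite RtoC_inv by lra. field. intros E; injection E; lra. }
  assert (Hg : hol_disc_map g).
  { apply (hol_disc_map_comp (fun w => f (mob (- z)%C w))); [|now apply hol_disc_map_mob].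
    apply (hol_disc_map_comp (mob (- z)%C) f); [|exact Hf]. now apply hol_disc_map_mob. }
  pose proof (schwarz_derivative_0 g _ Hg ltac:(unfold g; rewrite E0; apply mob_self) D) as S.
  rewrite !Cmod_mult, !Cmod_R in S. rewrite (Rabs_pos_eq (1 - Cmod z ^ 2)) in S by nra.
  rewrite Rabs_pos_eq in S by (left; now apply Rinv_0_lt_compat).
  apply (Rmult_le_compat_l (1 - Cmod (f z) ^ 2)) in S; [|lra].
  rewrite <- Rmult_assoc, Rinv_r, Rmult_1_l in S by lra. lra.
Qed.

(** The infinitesimal Schwarz-Pick inequality is integrated along a radius. At zeros of [f] the
    modulus is merely Lipschitz, which the mean value inequality tolerates. *)
Lemma artanh_Cmod_hol (f : C -> C) (r : R) : hol_disc_map f -> 0 <= r < 1 ->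
  Rabs (artanh (Cmod (f (RtoC r))) - artanh (Cmod (f (RtoC 0)))) <= artanh r.
Proof.
  intros Hf Hr.
  pose proof (dini_bound (fun t => artanh (Cmod (f (RtoC t)))) artanh (fun t => / (1 - t ^ 2)) 0 r ltac:(lra)) as D.
  rewrite artanh_0, (Rminus_0_r (artanh r)) in D. apply D; clear D.
  2:{ intros t Ht. apply artanh_derive. lra. }
  intros t Ht eps He.
  assert (Hm : Cmod (RtoC t) = t) by (rewrite Cmod_R; apply Rabs_pos_eq; lra).
  destruct (Hf (RtoC t)) as [[d Hd] Hft]; [lra|].
  pose proof (schwarz_pick f (RtoC t) d Hf ltac:(lra) Hd) as SP. rewrite Hm in SP.
  set (y := Cmod (f (RtoC t))) in *. assert (Hy : 0 <= y) by apply Cmod_ge_0.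
  assert (Py : 0 < 1 - y ^ 2) by nra. assert (Pt : 0 < 1 - t ^ 2) by nra.
  set (A := / (1 - y ^ 2)). assert (HA : 0 < A) by now apply Rinv_0_lt_compat.
  assert (Hd0 : 0 <= Cmod d) by apply Cmod_ge_0.
  (* Schwarz-Pick read as a chain rule: the slope of [artanh] at [y], times the modulus of the
     derivative of [f], is at most the slope of [artanh] at [t]. *)
  assert (Ad : A * Cmod d <= / (1 - t ^ 2)).
  { apply (Rmult_le_reg_l ((1 - y ^ 2) * (1 - t ^ 2))); [now apply Rmult_lt_0_compat|].
    unfold A. replace ((1 - y ^ 2) * (1 - t ^ 2) * (/ (1 - y ^ 2) * Cmod d)) with (Cmod d * (1 - t ^ 2)) by (field; lra).
    replace ((1 - y ^ 2) * (1 - t ^ 2) * / (1 - t ^ 2)) with (1 - y ^ 2) by (field; lra). exact SP. }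
  set (e1 := eps / (3 * (Cmod d + 1))). set (e2 := Rmin 1 (eps / (3 * A))).
  assert (He1 : 0 < e1) by (apply Rdiv_lt_0_compat; lra).
  assert (He2 : 0 < e2) by (apply Rmin_pos; [lra|apply Rdiv_lt_0_compat; lra]).
  destruct (derivable_pt_lim_le artanh y _ (artanh_derive y ltac:(lra)) e1 He1) as [d1 [D1 K1]].
  destruct (Hd e2 He2) as [d2 [D2 K2]].
  destruct (cderiv_continuous _ _ _ Hd d1 D1) as [d3 [D3 K3]].
  exists (Rmin d2 d3). split; [now apply Rmin_pos|]. intros s Hs Hst.
  pose proof (Rmin_l d2 d3). pose proof (Rmin_r d2 d3).
  specialize (K2 (RtoC (s - t))). specialize (K3 (RtoC (s - t))). rewrite Cmod_R in K2, K3.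
  specialize (K2 ltac:(lra)). specialize (K3 ltac:(lra)).
  rewrite <- RtoC_plus in K2, K3. replace (t + (s - t)) with s in K2, K3 by ring.
  set (y' := Cmod (f (RtoC s))) in *.
  assert (Yd : Rabs (y' - y) <= Cmod (f (RtoC s) - f (RtoC t))%C) by apply Cmod_abs_sub.
  specialize (K1 (y' - y) ltac:(lra)). replace (y + (y' - y)) with y' in K1 by ring. fold A in K1.
  assert (Yl : Rabs (y' - y) <= (Cmod d + e2) * Rabs (s - t)).
  { apply Rle_trans with (1 := Yd).
    eapply Rle_trans; [apply (Cmod_le_sub _ (d * RtoC (s - t))%C)|].
    rewrite Cmod_mult, Cmod_R. lra. }
  assert (F : Rabs (artanh y' - artanh y) <= (A + e1) * Rabs (y' - y)).
  { replace (artanh y' - artanh y) with ((artanh y' - artanh y - A * (y' - y)) + A * (y' - y)) by ring.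
    eapply Rle_trans; [apply Rabs_triang|]. rewrite Rabs_mult, (Rabs_pos_eq A) by lra. lra. }
  apply Rle_trans with (1 := F).
  apply Rle_trans with ((A + e1) * ((Cmod d + e2) * Rabs (s - t))); [apply Rmult_le_compat_l; lra|].
  rewrite <- Rmult_assoc. apply Rmult_le_compat_r; [apply Rabs_pos|].
  assert (E1 : e1 * (Cmod d + e2) <= eps / 3).
  { assert (e2 <= 1) by apply Rmin_l. apply Rle_trans with (e1 * (Cmod d + 1)); [nra|].
    right. unfold e1. field. lra. }
  assert (E2 : A * e2 <= eps / 3).
  { assert (e2 <= eps / (3 * A)) by apply Rmin_r. apply Rle_trans with (A * (eps / (3 * A))); [nra|].
    right. field. lra. }
  nra.
Qed.

(** * Kobayashi distance and metric of the ball *)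

Definition vadd (z w : C * C) : C * C := ((fst z + fst w)%C, (snd z + snd w)%C).
Definition vsub (z w : C * C) : C * C := ((fst z - fst w)%C, (snd z - snd w)%C).
Definition vscal (a : C) (z : C * C) : C * C := ((a * fst z)%C, (a * snd z)%C).
Definition rscal (t : R) (z : C * C) : C * C := vscal (RtoC t) z.
Definition vzero : C * C := (RtoC 0, RtoC 0).

Ltac vring := unfold rscal, vscal, vadd, vsub, vzero; simpl; try apply injective_projections; simpl; try ring.

Lemma l1norm_pos (z : C * C) : 0 <= l1norm z.
Proof. unfold l1norm. pose proof (Cmod_ge_0 (fst z)). pose proof (Cmod_ge_0 (snd z)). lra. Qed.

Lemma l1norm_vadd (z w : C * C) : l1norm (vadd z w) <= l1norm z + l1norm w.
Proof.
  unfold l1norm, vadd; simpl. pose proof (Cmod_triangle (fst z) (fst w)).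
  pose proof (Cmod_triangle (snd z) (snd w)). lra.
Qed.

Lemma l1norm_vscal (a : C) (z : C * C) : l1norm (vscal a z) = Cmod a * l1norm z.
Proof. unfold l1norm, vscal; simpl. rewrite !Cmod_mult. ring. Qed.

Lemma l1norm_rscal (t : R) (z : C * C) : l1norm (rscal t z) = Rabs t * l1norm z.
Proof. unfold rscal. now rewrite l1norm_vscal, Cmod_R. Qed.

Lemma l1norm_vsub_sym (z w : C * C) : l1norm (vsub z w) = l1norm (vsub w z).
Proof. unfold l1norm, vsub; simpl. rewrite Cmod_sub_sym, (Cmod_sub_sym (snd z)). reflexivity. Qed.

Lemma l1norm_vsub_triangle (a b c : C * C) :
  l1norm (vsub a c) <= l1norm (vsub a b) + l1norm (vsub b c).
Proof.
  replace (vsub a c) with (vadd (vsub a b) (vsub b c)) by vring. apply l1norm_vadd.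
Qed.

Lemma l1norm_le_vsub (a b : C * C) : l1norm a <= l1norm (vsub a b) + l1norm b.
Proof. replace a with (vadd (vsub a b) b) at 1 by vring. apply l1norm_vadd. Qed.

Lemma l1norm_vzero : l1norm vzero = 0.
Proof. unfold l1norm, vzero; simpl. rewrite Cmod_0. ring. Qed.

Lemma l1norm_eq_0 (z : C * C) : l1norm z = 0 -> z = vzero.
Proof.
  unfold l1norm. intros H. pose proof (Cmod_ge_0 (fst z)). pose proof (Cmod_ge_0 (snd z)).
  destruct z as [a b]; simpl in *. unfold vzero. f_equal; apply Cmod_eq_0; lra.
Qed.

Lemma hderiv_comp (phi : C -> C * C) (f : C -> C) (z d : C) (v : C * C) :
  cderiv f z d -> hderiv phi (f z) v -> hderiv (fun w => phi (f w)) z (vscal d v).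
Proof.
  intros Hf [H1 H2]. split; simpl; rewrite (Cmult_comm d).
  - exact (cderiv_comp f (fun w => fst (phi w)) z d _ Hf H1).
  - exact (cderiv_comp f (fun w => snd (phi w)) z d _ Hf H2).
Qed.

Lemma hdisc_comp (phi : C -> C * C) (f : C -> C) :
  hdisc phi -> hol_disc_map f -> hdisc (fun w => phi (f w)).
Proof.
  intros Hp Hf z Hz. destruct (Hf z Hz) as [[d Hd] Hfz]. destruct (Hp (f z) Hfz) as [[v Hv] Hb].
  split; [|exact Hb]. exists (vscal d v). now apply hderiv_comp.
Qed.

Lemma cderiv_affine (a b z : C) : cderiv (fun l => a + l * b)%C z b.
Proof.
  eapply cderiv_eq.
  - apply cderiv_plus; [apply cderiv_const|].
    apply (cderiv_mult (fun l => l) (fun _ => b)); [apply cderiv_id|apply cderiv_const].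
  - ring.
Qed.

Lemma hderiv_affine (a v : C * C) (z : C) : hderiv (fun l => vadd a (vscal l v)) z v.
Proof. split; simpl; apply cderiv_affine. Qed.

Lemma hdisc_affine (a v : C * C) :
  l1norm a + l1norm v <= 1 -> l1norm a < 1 -> hdisc (fun l => vadd a (vscal l v)).
Proof.
  intros H Ha l Hl. split; [exists v; apply hderiv_affine|].
  eapply Rle_lt_trans; [apply l1norm_vadd|]. rewrite l1norm_vscal.
  pose proof (l1norm_pos v). pose proof (Cmod_ge_0 l).
  destruct (Req_dec (l1norm v) 0) as [E|E]; [rewrite E; lra|nra].
Qed.

(** One link of a chain in normal form: a Moebius map and a rotation bring the two parameters to 0
    and to a real [r]. Real parameters are fixed by conjugation, so antiholomorphic symmetries can
    act on links. *)
Definition segment (z w : C * C) (r : R) : Prop :=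
  0 <= r < 1 /\ exists psi, hdisc psi /\ psi (RtoC 0) = z /\ psi (RtoC r) = w.

Lemma hol_disc_map_rot (u : C) : Cmod u = 1 -> hol_disc_map (fun z => (u * z)%C).
Proof.
  intros Hu z Hz. split; [|rewrite Cmod_mult, Hu; lra].
  exists (u * 1)%C. apply cderiv_cmult, cderiv_id.
Qed.

Lemma phase_exists (q : C) : exists u, Cmod u = 1 /\ (u * RtoC (Cmod q))%C = q.
Proof.
  destruct (Req_dec (Cmod q) 0) as [E|E].
  - exists 1%C. rewrite Cmod_1. split; [reflexivity|]. rewrite E. apply Cmod_eq_0 in E. rewrite E. ring.
  - assert (En : RtoC (Cmod q) <> 0%C) by (intros H; injection H; lra).
    exists (q / RtoC (Cmod q))%C. split.
    + rewrite Cmod_div, Cmod_R by exact En. rewrite Rabs_pos_eq by apply Cmod_ge_0. field; exact E.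
    + field; exact En.
Qed.

Lemma segment_of_disc (phi : C -> C * C) (l m : C) : hdisc phi -> Cmod l < 1 -> Cmod m < 1 ->
  segment (phi l) (phi m) (Cmod ((l - m) / (1 - Cconj m * l))%C).
Proof.
  intros Hp Hl Hm.
  assert (E : Cmod ((l - m) / (1 - Cconj m * l))%C = Cmod (mob l m)).
  { unfold mob. rewrite !Cmod_div by now apply mob_den. rewrite Cmod_sub_sym. f_equal.
    rewrite <- Cmod_conj. f_equal. rewrite Cminus_conj, Cmult_conj, !Cconj_conj.
    replace (Cconj 1) with (RtoC 1); [ring|]. unfold Cconj, RtoC; simpl; f_equal; ring. }
  rewrite E. pose proof (mob_lt_1 l m Hl Hm) as Hq.
  split; [split; [apply Cmod_ge_0|exact Hq]|].
  destruct (phase_exists (mob l m)) as [u [Hu Eu]].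
  assert (Hl' : Cmod (- l)%C < 1) by now rewrite Cmod_opp.
  exists (fun w => phi (mob (- l)%C (u * w)%C)). split; [|split].
  - apply (hdisc_comp phi). exact Hp.
    apply (hol_disc_map_comp (fun w => u * w)%C (mob (- l)%C)).
    + now apply hol_disc_map_rot. + now apply hol_disc_map_mob.
  - f_equal. rewrite Cmult_0_r. apply mob_neg_0.
  - f_equal. rewrite Eu. now apply mob_cancel.
Qed.

Lemma segment_sym (z w : C * C) (r : R) : segment z w r -> segment w z r.
Proof.
  intros [Hr [psi [Hp [H0 H1]]]]. split; [exact Hr|].
  assert (Hm : Cmod (RtoC r) < 1) by (rewrite Cmod_R, Rabs_pos_eq; lra).
  exists (fun l => psi ((-1) * mob (RtoC r) l)%C). split; [|split].
  - apply (hdisc_comp psi); [exact Hp|].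
    apply (hol_disc_map_comp (mob (RtoC r)) (fun w => (-1) * w)%C); [now apply hol_disc_map_mob|].
    apply hol_disc_map_rot. rewrite Cmod_R, Rabs_left; lra.
  - rewrite <- H1. f_equal. replace (mob r 0) with (- r)%C; [ring|].
    symmetry. transitivity (mob (- - r)%C 0%C); [f_equal; ring|apply mob_neg_0].
  - rewrite <- H0. f_equal. rewrite mob_self. ring.
Qed.

Inductive chain : C * C -> C * C -> R -> Prop :=
| chain_one z w r : segment z w r -> chain z w (artanh r)
| chain_cons z u w r s : segment z u r -> chain u w s -> chain z w (artanh r + s).

Lemma chain_app (z u w : C * C) (r s : R) : chain z u r -> chain u w s -> chain z w (r + s).
Proof.
  intros H. revert s. induction H as [z u r H|z v u r t H _ IH]; intros s K.
  - now apply (chain_cons z u).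
  - rewrite Rplus_assoc. apply (chain_cons z v); auto.
Qed.

Lemma chain_sym (z w : C * C) (r : R) : chain z w r -> chain w z r.
Proof.
  induction 1 as [z w r H|z u w r s H _ IH].
  - now apply chain_one, segment_sym.
  - rewrite Rplus_comm. apply (chain_app w u z); [exact IH|]. now apply chain_one, segment_sym.
Qed.

Lemma chain_pos (z w : C * C) (r : R) : chain z w r -> 0 <= r.
Proof.
  induction 1 as [z w r [H _]|z u w r s [H _] _ IH]; pose proof (artanh_pos r H); lra.
Qed.

Definition chain_of_discs (z w : C * C) (r : R) : Prop :=
  exists (N : nat) (phi : nat -> C -> C * C) (l m : nat -> C),
    (forall j : nat, (j <= N)%nat -> @holomorphic_disc C2 l1_ball (phi j) /\ Defs.disc (l j) /\ Defs.disc (m j)) /\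
    phi 0%nat (l 0%nat) = z /\
    (forall j : nat, (j < N)%nat -> phi j (m j) = phi (S j) (l (S j))) /\
    phi N (m N) = w /\
    r = sum_n (fun j => poincare (l j) (m j)) N.

Lemma sum_n_shift (a : nat -> R) (n : nat) : sum_n a (S n) = a 0%nat + sum_n (fun j => a (S j)) n.
Proof.
  induction n as [|n IH].
  - rewrite sum_Sn, !sum_O. reflexivity.
  - rewrite sum_Sn, IH, sum_Sn. unfold plus; simpl. ring.
Qed.

(** One direction peels off the first disc, hence the shift of indices; the other realises every
    link between the parameters 0 and [r]. *)
Lemma chain_of_discs_iff (z w : C * C) (r : R) : chain_of_discs z w r <-> chain z w r.
Proof.
  split.
  - intros (N & phi & l & m & H). revert phi l m z r H.
    induction N as [|N IH]; intros phi l m z r (Hd & Hz & Hc & Hw & ->).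
    + rewrite sum_O. destruct (Hd 0%nat (le_n 0)) as (D & L & M).
      apply holomorphic_disc_hdisc in D. rewrite <- Hz, <- Hw. apply chain_one. now apply segment_of_disc.
    + rewrite sum_n_shift. destruct (Hd 0%nat ltac:(lia)) as (D & L & M).
      apply holomorphic_disc_hdisc in D. rewrite <- Hz.
      apply (chain_cons _ (phi 0%nat (m 0%nat))).
      * now apply segment_of_disc.
      * apply (IH (fun j => phi (S j)) (fun j => l (S j)) (fun j => m (S j))).
        split; [|split; [|split; [|split; [exact Hw|reflexivity]]]].
        -- intros j Hj. apply Hd; lia.
        -- rewrite Hc by lia. reflexivity.
        -- intros j Hj. apply Hc. lia.
  - assert (P : forall r, 0 <= r < 1 -> poincare 0 (RtoC r) = artanh r).
    { intros s Hs. unfold poincare. f_equal. rewrite Cmult_0_r.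
      replace ((0 - s) / (1 - 0))%C with (- s)%C by field. rewrite Cmod_opp, Cmod_R. apply Rabs_pos_eq; lra. }
    assert (D0 : Defs.disc 0) by (unfold Defs.disc; rewrite Cmod_0; lra).
    induction 1 as [z w r [Hr (psi & Hp & H0 & H1)]|z u w r s [Hr (psi & Hp & H0 & H1)] _ IH].
    + exists 0%nat, (fun _ => psi), (fun _ => RtoC 0), (fun _ => RtoC r).
      split; [|split; [exact H0|split; [|split; [exact H1|]]]].
      * intros j _. split; [now apply holomorphic_disc_hdisc|]. split; [exact D0|].
        unfold Defs.disc. rewrite Cmod_R, Rabs_pos_eq; lra.
      * intros j Hj; lia.
      * rewrite sum_O. now rewrite P.
    + destruct IH as (N & phi & l & m & Hd & Hz & Hc & Hw & ->).
      exists (S N), (fun j => match j with O => psi | S j => phi j end),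
        (fun j => match j with O => RtoC 0 | S j => l j end), (fun j => match j with O => RtoC r | S j => m j end).
      split; [|split; [exact H0|split; [|split; [exact Hw|]]]].
      * intros [|j] Hj; [|apply Hd; lia].
        split; [now apply holomorphic_disc_hdisc|]. split; [exact D0|].
        unfold Defs.disc. rewrite Cmod_R, Rabs_pos_eq; lra.
      * intros [|j] Hj; [now rewrite Hz, H1|apply Hc; lia].
      * rewrite sum_n_shift. now rewrite P.
Qed.

Definition kobd (z w : C * C) : R := real (@kobayashi_dist C2 l1_ball z w).

Lemma Glb_Rbar_ext (P Q : R -> Prop) : (forall r, P r <-> Q r) -> Glb_Rbar P = Glb_Rbar Q.
Proof. intros H. apply Glb_Rbar_eqset. exact H. Qed.

Lemma segment_radial (z : C * C) : l1norm z < 1 -> segment vzero z (l1norm z).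
Proof.
  intros Hz. pose proof (l1norm_pos z).
  destruct (Req_dec (l1norm z) 0) as [E|E].
  { apply l1norm_eq_0 in E. subst z. rewrite l1norm_vzero. split; [lra|].
    exists (fun l => vadd vzero (vscal l vzero)). split; [|split; vring].
    apply hdisc_affine; rewrite ?l1norm_vzero; lra. }
  split; [lra|]. exists (fun l => vadd vzero (vscal l (rscal (/ l1norm z) z))).
  split; [|split].
  - apply hdisc_affine; rewrite ?l1norm_vzero, ?l1norm_rscal; try lra.
    rewrite Rabs_pos_eq by (left; apply Rinv_0_lt_compat; lra). rewrite Rinv_l; lra.
  - vring.
  - assert (En : RtoC (l1norm z) <> 0%C) by (intros F; injection F; lra).
    vring; rewrite RtoC_inv by exact E; field; exact En.
Qed.

Lemma chain_exists (z w : C * C) : l1norm z < 1 -> l1norm w < 1 -> exists s, chain z w s.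
Proof.
  intros Hz Hw. eexists. apply (chain_cons z vzero).
  - now apply segment_sym, segment_radial.
  - now apply chain_one, segment_radial.
Qed.

Lemma kobd_spec (z w : C * C) : l1norm z < 1 -> l1norm w < 1 ->
  @kobayashi_dist C2 l1_ball z w = Finite (kobd z w) /\
  (forall s, chain z w s -> kobd z w <= s) /\
  (forall eps, 0 < eps -> exists s, chain z w s /\ s < kobd z w + eps).
Proof.
  intros Hz Hw.
  assert (E : @kobayashi_dist C2 l1_ball z w = Glb_Rbar (chain z w)).
  { apply Glb_Rbar_ext. intros r. apply (chain_of_discs_iff z w r). }
  unfold kobd. rewrite E. destruct (Glb_Rbar_correct (chain z w)) as [L G].
  destruct (chain_exists z w Hz Hw) as [s0 Hs0].
  set (g := Glb_Rbar (chain z w)) in *.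
  (* The lower bound 0 and one chain through the origin exclude both infinite values. *)
  assert (L0 : Rbar_le 0 g) by (apply G; intros s Hs; simpl; eapply chain_pos; eassumption).
  pose proof (L s0 Hs0) as U. destruct g as [g| |]; try contradiction.
  split; [reflexivity|]. simpl. split; [exact L|].
  intros eps He. apply Classical_Prop.NNPP. intros N.
  assert (T : Rbar_le (g + eps) g); [|simpl in T; lra].
  apply G. intros s Hs. simpl. apply Rnot_lt_le. intros Hlt. apply N. now exists s.
Qed.

Lemma kobd_pos (z w : C * C) : l1norm z < 1 -> l1norm w < 1 -> 0 <= kobd z w.
Proof.
  intros Hz Hw. destruct (kobd_spec z w Hz Hw) as (_ & _ & A). apply Rnot_lt_le. intros N.
  destruct (A (- kobd z w) ltac:(lra)) as [s [Hs Hlt]]. pose proof (chain_pos _ _ _ Hs). lra.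
Qed.

Lemma kobd_sym (z w : C * C) : l1norm z < 1 -> l1norm w < 1 -> kobd z w = kobd w z.
Proof.
  assert (H : forall z w, l1norm z < 1 -> l1norm w < 1 -> kobd z w <= kobd w z).
  { clear z w. intros z w Hz Hw. apply le_epsilon. intros eps He.
    destruct (kobd_spec w z Hw Hz) as (_ & _ & A). destruct (A eps He) as [s [Hs Hlt]].
    destruct (kobd_spec z w Hz Hw) as (_ & B & _). pose proof (B s (chain_sym _ _ _ Hs)). lra. }
  intros Hz Hw. apply Rle_antisym; auto.
Qed.

Lemma kobd_triangle (z u w : C * C) : l1norm z < 1 -> l1norm u < 1 -> l1norm w < 1 ->
  kobd z w <= kobd z u + kobd u w.
Proof.
  intros Hz Hu Hw. apply le_epsilon. intros eps He.
  destruct (kobd_spec z u Hz Hu) as (_ & _ & A). destruct (A (eps / 2) ltac:(lra)) as [s [Hs Hlt]].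
  destruct (kobd_spec u w Hu Hw) as (_ & _ & A'). destruct (A' (eps / 2) ltac:(lra)) as [s' [Hs' Hlt']].
  destruct (kobd_spec z w Hz Hw) as (_ & B & _). pose proof (B _ (chain_app _ _ _ _ _ Hs Hs')). lra.
Qed.

Lemma kobd_le_segment (z w : C * C) (r : R) : l1norm z < 1 -> l1norm w < 1 ->
  segment z w r -> kobd z w <= artanh r.
Proof. intros Hz Hw H. apply (kobd_spec z w Hz Hw). now apply chain_one. Qed.

Lemma segment_in_ball (z w : C * C) (r : R) : segment z w r -> l1norm z < 1 /\ l1norm w < 1.
Proof.
  intros [Hr (psi & Hp & <- & <-)]. split; apply Hp; rewrite Cmod_R, Rabs_pos_eq; lra.
Qed.

(** Lipschitz bounds along single discs add up over a chain. The lower bounds for the distance all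
    go through this. *)
Lemma kobd_lipschitz (f : C * C -> R) (K : R) : 0 <= K ->
  (forall z w r, segment z w r -> f w - f z <= K * artanh r) ->
  forall z w, l1norm z < 1 -> l1norm w < 1 -> f w - f z <= K * kobd z w.
Proof.
  intros HK H z w Hz Hw.
  assert (C : forall s, chain z w s -> f w - f z <= K * s).
  { intros s. induction 1 as [z w r S|z u w r s S c IH].
    - now apply H.
    - pose proof (segment_in_ball z u r S) as [_ Hu].
      pose proof (H z u r S). specialize (IH Hu Hw). lra. }
  apply le_epsilon. intros eps He.
  destruct (kobd_spec z w Hz Hw) as (_ & _ & A).
  destruct (A (eps / (K + 1))) as [s [Hs Hlt]]; [apply Rdiv_lt_0_compat; lra|].
  specialize (C s Hs). apply Rle_trans with (1 := C).
  apply Rle_trans with (K * (kobd z w + eps / (K + 1))); [apply Rmult_le_compat_l; lra|].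
  assert (K * (eps / (K + 1)) <= eps); [|lra].
  apply (Rmult_le_reg_r (K + 1)); [lra|]. replace (K * (eps / (K + 1)) * (K + 1)) with (K * eps) by (field; lra). nra.
Qed.

Lemma kobd_refl (z : C * C) : l1norm z < 1 -> kobd z z = 0.
Proof.
  intros Hz. apply Rle_antisym; [|now apply kobd_pos].
  rewrite <- artanh_0. apply kobd_le_segment; auto.
  split; [lra|]. exists (fun l => vadd z (vscal l vzero)). split; [|split; vring].
  apply hdisc_affine; rewrite ?l1norm_vzero; lra.
Qed.

(** The complex factor in the metric is replaced by a nonnegative one, its phase being absorbed into
    a rotation of the disc. *)
Definition metric_disc (z X : C * C) (r : R) : Prop :=
  0 <= r /\ exists psi v, hdisc psi /\ psi (RtoC 0) = z /\ hderiv psi (RtoC 0) v /\ rscal r v = X.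

Definition kobm (z X : C * C) : R := real (@kobayashi_metric C2 l1_ball z X).

Lemma metric_disc_exists (z X : C * C) : l1norm z < 1 -> metric_disc z X (l1norm X / (1 - l1norm z)).
Proof.
  intros Hz. pose proof (l1norm_pos X). pose proof (l1norm_pos z).
  assert (0 < / (1 - l1norm z)) by (apply Rinv_0_lt_compat; lra).
  split; [apply Rmult_le_pos; lra|].
  destruct (Req_dec (l1norm X) 0) as [E|E].
  - exists (fun l => vadd z (vscal l vzero)), vzero. split; [|split; [|split]].
    + apply hdisc_affine; rewrite ?l1norm_vzero; lra. + vring. + apply hderiv_affine.
    + apply l1norm_eq_0 in E. rewrite E. vring.
  - set (v := rscal ((1 - l1norm z) / l1norm X) X).
    exists (fun l => vadd z (vscal l v)), v. split; [|split; [|split]].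
    + assert (l1norm v = 1 - l1norm z).
      { unfold v. rewrite l1norm_rscal, Rabs_pos_eq; [field; lra|].
        apply Rdiv_le_0_compat; lra. }
      apply hdisc_affine; lra.
    + vring. + apply hderiv_affine.
    + unfold v. transitivity (rscal (l1norm X / (1 - l1norm z) * ((1 - l1norm z) / l1norm X)) X).
      { vring; rewrite RtoC_mult; ring. }
      replace (l1norm X / (1 - l1norm z) * ((1 - l1norm z) / l1norm X)) with 1 by (field; lra). vring.
Qed.

Lemma kobm_spec (z X : C * C) : l1norm z < 1 ->
  @kobayashi_metric C2 l1_ball z X = Finite (kobm z X) /\
  (forall r, metric_disc z X r -> kobm z X <= r) /\
  (forall eps, 0 < eps -> exists r, metric_disc z X r /\ r < kobm z X + eps).
Proof.
  intros Hz.
  assert (E : @kobayashi_metric C2 l1_ball z X = Glb_Rbar (metric_disc z X)).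
  { apply Glb_Rbar_ext. intros r. split.
    - intros (al & phi & v & Hp & H0 & Hv & HX & ->). split; [apply Cmod_ge_0|].
      apply holomorphic_disc_hdisc in Hp. apply is_derive_hderiv in Hv.
      destruct (phase_exists al) as [u [Hu Eu]].
      exists (fun w => phi (u * w)%C), (vscal u v). split; [|split; [|split]].
      + apply (hdisc_comp phi); [exact Hp|]. now apply hol_disc_map_rot.
      + now rewrite Cmult_0_r.
      + apply (hderiv_comp phi (fun w => u * w)%C).
        * eapply cderiv_eq; [apply cderiv_cmult, cderiv_id|ring].
        * now rewrite Cmult_0_r.
      + rewrite <- HX. change (@scal C_AbsRing C2 al v) with (vscal al v).
        transitivity (vscal (u * RtoC (Cmod al))%C v); [vring|now rewrite Eu].
    - intros [Hr (psi & v & Hp & H0 & Hv & HX)]. exists (RtoC r), psi, v.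
      split; [now apply holomorphic_disc_hdisc|]. split; [exact H0|].
      split; [now apply is_derive_hderiv|]. split; [exact HX|].
      rewrite Cmod_R, Rabs_pos_eq; lra. }
  unfold kobm. rewrite E. destruct (Glb_Rbar_correct (metric_disc z X)) as [L G].
  pose proof (metric_disc_exists z X Hz) as Hs0.
  set (g := Glb_Rbar (metric_disc z X)) in *.
  assert (L0 : Rbar_le 0 g) by (apply G; intros s Hs; simpl; apply Hs).
  pose proof (L _ Hs0) as U. destruct g as [g| |]; try contradiction.
  split; [reflexivity|]. simpl. split; [exact L|].
  intros eps He. apply Classical_Prop.NNPP. intros N.
  assert (T : Rbar_le (g + eps) g); [|simpl in T; lra].
  apply G. intros s Hs. simpl. apply Rnot_lt_le. intros Hlt. apply N. now exists s.
Qed.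

(** * Bounds for the distance and the metric *)

(** Holomorphy of [g] on the ball is tested through composition with curves: [dg z v] is the
    derivative along any of them through [z] with velocity [v]. This avoids calculus in two complex
    variables. *)
Definition hol_fun (g : C * C -> C) (dg : C * C -> C * C -> C) : Prop :=
  forall z, l1norm z < 1 -> Cmod (g z) < 1 /\
    forall phi t v, hderiv phi t v -> phi t = z -> cderiv (fun w => g (phi w)) t (dg z v).

Lemma hol_fun_disc (g : C * C -> C) (dg : C * C -> C * C -> C) (psi : C -> C * C) :
  hol_fun g dg -> hdisc psi -> hol_disc_map (fun w => g (psi w)).
Proof.
  intros Hg Hp z Hz. destruct (Hp z Hz) as [[v Hv] Hb]. destruct (Hg _ Hb) as [H1 H2].
  split; [|exact H1]. exists (dg (psi z) v). now apply H2.
Qed.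

Lemma hol_fun_mob (g : C * C -> C) (dg : C * C -> C * C -> C) (a : C) : Cmod a < 1 -> hol_fun g dg ->
  hol_fun (fun z => mob a (g z))
   (fun z v => ((1 - a * Cconj a) / ((1 - Cconj a * g z) * (1 - Cconj a * g z)) * dg z v)%C).
Proof.
  intros Ha Hg z Hz. destruct (Hg z Hz) as [H1 H2]. split; [now apply mob_lt_1|].
  intros phi t v Hv Ht. apply (cderiv_comp (fun w => g (phi w)) (mob a)); [now apply H2|].
  rewrite Ht. now apply mob_derive.
Qed.

Lemma kobd_ge_artanh (g : C * C -> C) (dg : C * C -> C * C -> C) (z w : C * C) :
  hol_fun g dg -> l1norm z < 1 -> l1norm w < 1 ->
  artanh (Cmod (g w)) - artanh (Cmod (g z)) <= kobd z w.
Proof.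
  intros Hg Hz Hw. rewrite <- (Rmult_1_l (kobd z w)).
  apply (kobd_lipschitz (fun z => artanh (Cmod (g z)))); auto; [lra|].
  clear z w Hz Hw. intros z w r [Hr (psi & Hp & <- & <-)]. rewrite Rmult_1_l.
  pose proof (artanh_Cmod_hol _ r (hol_fun_disc g dg psi Hg Hp) Hr) as H.
  apply Rabs_le_between in H. lra.
Qed.

Lemma kobd_ge_mob (g : C * C -> C) (dg : C * C -> C * C -> C) (z w : C * C) :
  hol_fun g dg -> l1norm z < 1 -> l1norm w < 1 ->
  artanh (Cmod (mob (g z) (g w))) <= kobd z w.
Proof.
  intros Hg Hz Hw.
  pose proof (kobd_ge_artanh _ _ z w (hol_fun_mob g dg (g z) (proj1 (Hg z Hz)) Hg) Hz Hw) as H.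
  cbv beta in H. rewrite mob_self, Cmod_0, artanh_0 in H. lra.
Qed.

(** Schwarz-Pick at the centre of an almost optimal disc; the homogeneity of [dg] passes from the
    velocity [v] to [X = rscal r v]. *)
Lemma kobm_ge (g : C * C -> C) (dg : C * C -> C * C -> C) (z X : C * C) :
  hol_fun g dg -> (forall t v, dg z (rscal t v) = (RtoC t * dg z v)%C) -> l1norm z < 1 ->
  Cmod (dg z X) <= kobm z X * (1 - Cmod (g z) ^ 2).
Proof.
  intros Hg Hlin Hz. destruct (Hg z Hz) as [H1 H2].
  pose proof (Cmod_ge_0 (g z)).
  assert (P : 0 < 1 - Cmod (g z) ^ 2) by nra.
  apply le_epsilon. intros eps He.
  destruct (kobm_spec z X Hz) as (_ & _ & A). destruct (A eps He) as [r [[Hr (psi & v & Hp & H0 & Hv & HX)] Hlt]].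
  assert (S : Cmod (dg z v) * (1 - Cmod 0 ^ 2) <= 1 - Cmod (g (psi 0)) ^ 2).
  { apply (schwarz_pick (fun w => g (psi w)) 0%C).
    - now apply (hol_fun_disc g dg). - rewrite Cmod_0; lra. - now apply H2. }
  rewrite Cmod_0, H0 in S. rewrite <- HX, Hlin, Cmod_mult, Cmod_R, Rabs_pos_eq by exact Hr.
  rewrite HX.
  assert (Cmod (dg z v) <= 1 - Cmod (g z) ^ 2) by lra.
  apply Rle_trans with (r * (1 - Cmod (g z) ^ 2)); [now apply Rmult_le_compat_l|].
  assert (P1 : 1 - Cmod (g z) ^ 2 <= 1) by (pose proof (pow2_ge_0 (Cmod (g z))); lra).
  set (Q := 1 - Cmod (g z) ^ 2) in *. clearbody Q.
  pose proof (Rmult_le_compat_r Q r (kobm z X + eps) ltac:(lra) ltac:(lra)).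
  pose proof (Rmult_le_compat_l eps Q 1 ltac:(lra) P1). lra.
Qed.

Definition lin (u1 u2 : C) (z : C * C) : C := (u1 * fst z + u2 * snd z)%C.

Lemma lin_le (u1 u2 : C) (z : C * C) : Cmod u1 <= 1 -> Cmod u2 <= 1 -> Cmod (lin u1 u2 z) <= l1norm z.
Proof.
  intros H1 H2. unfold lin, l1norm. eapply Rle_trans; [apply Cmod_triangle|]. rewrite !Cmod_mult.
  pose proof (Cmod_ge_0 (fst z)). pose proof (Cmod_ge_0 (snd z)). nra.
Qed.

Lemma hol_fun_lin (u1 u2 : C) : Cmod u1 <= 1 -> Cmod u2 <= 1 -> hol_fun (lin u1 u2) (fun _ v => lin u1 u2 v).
Proof.
  intros H1 H2 z Hz. split; [apply Rle_lt_trans with (2 := Hz); now apply lin_le|].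
  intros phi t v [V1 V2] _. unfold lin. apply cderiv_plus; now apply cderiv_cmult.
Qed.

(** For [Cmod th = 1] it maps the ball to the unit disc and the first axis to 0. Where [th * fst z]
    is the modulus of [fst z], it is the second coordinate divided by the radius of the slice
    through [z], so it measures distances to the axis. *)
Definition slice_fun (th : C) (z : C * C) : C := (snd z / (1 - th * fst z))%C.

Definition slice_fun_d (th : C) (z v : C * C) : C :=
  ((snd v * (1 - th * fst z) + th * snd z * fst v) / ((1 - th * fst z) * (1 - th * fst z)))%C.

Definition swap (z : C * C) : C * C := (snd z, fst z).

Lemma l1norm_swap (z : C * C) : l1norm (swap z) = l1norm z.
Proof. unfold l1norm, swap; simpl. ring. Qed.

Lemma slice_den (th : C) (z : C * C) : Cmod th <= 1 -> l1norm z < 1 ->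
  Cmod (snd z) < Cmod (1 - th * fst z)%C /\ (1 - th * fst z)%C <> 0%C.
Proof.
  intros Ht Hz. unfold l1norm in Hz.
  pose proof (Cmod_ge_0 (fst z)). pose proof (Cmod_ge_0 (snd z)).
  pose proof (Cmod_le_sub 1 (th * fst z)) as T. rewrite Cmod_1, Cmod_mult in T.
  assert (Cmod th * Cmod (fst z) <= Cmod (fst z)) by nra.
  assert (Cmod (snd z) < Cmod (1 - th * fst z)%C) by lra. split; [assumption|].
  apply Cmod_gt_0. lra.
Qed.

Lemma hol_fun_slice (th : C) : Cmod th <= 1 -> hol_fun (slice_fun th) (slice_fun_d th).
Proof.
  intros Ht z Hz. destruct (slice_den th z Ht Hz) as [H1 H2]. split.
  - unfold slice_fun. rewrite Cmod_div by exact H2. pose proof (Cmod_ge_0 (snd z)).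
    apply (Rmult_lt_reg_r (Cmod (1 - th * fst z)%C)); [lra|].
    unfold Rdiv. rewrite Rmult_assoc, Rinv_l; lra.
  - intros phi t v [V1 V2] <-. eapply cderiv_eq.
    + apply (cderiv_div (fun w => snd (phi w)) (fun w => 1 - th * fst (phi w))%C); [exact H2|exact V2|].
      apply cderiv_minus; [apply cderiv_const|apply cderiv_cmult; exact V1].
    + unfold slice_fun_d. field. exact H2.
Qed.

Lemma hol_fun_swap (g : C * C -> C) (dg : C * C -> C * C -> C) : hol_fun g dg ->
  hol_fun (fun z => g (swap z)) (fun z v => dg (swap z) (swap v)).
Proof.
  intros Hg z Hz. destruct (Hg (swap z)) as [H1 H2]; [now rewrite l1norm_swap|].
  split; [exact H1|]. intros phi t v [V1 V2] Hp. apply (H2 (fun w => swap (phi w))); [|now rewrite Hp].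
  split; assumption.
Qed.

(** A supporting functional of the sphere at [z]; it is what makes radial discs extremal. *)
Lemma lin_calibrating (z : C * C) : exists u1 u2, Cmod u1 = 1 /\ Cmod u2 = 1 /\ lin u1 u2 z = RtoC (l1norm z).
Proof.
  assert (H : forall q, exists u, Cmod u = 1 /\ (u * q)%C = RtoC (Cmod q)).
  { intros q. destruct (phase_exists q) as [u [Hu Eu]]. exists (Cconj u).
    rewrite Cmod_conj. split; [exact Hu|]. rewrite <- Eu at 1.
    replace (Cconj u * (u * Cmod q))%C with (u * Cconj u * Cmod q)%C by ring.
    rewrite <- Cmod2_conj, Hu. simpl. rewrite !Rmult_1_r. ring. }
  destruct (H (fst z)) as [u1 [U1 E1]]. destruct (H (snd z)) as [u2 [U2 E2]].
  exists u1, u2. repeat split; auto. unfold lin, l1norm. now rewrite E1, E2, RtoC_plus.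
Qed.

(** The functional is chosen to support the direction [X] rather than the point, which gives a bound
    independent of [z] and hence nondegeneracy of the metric. *)
Lemma kobm_ge_l1norm (z X : C * C) : l1norm z < 1 -> l1norm X <= kobm z X.
Proof.
  intros Hz. destruct (lin_calibrating X) as (u1 & u2 & U1 & U2 & E).
  pose proof (kobm_ge _ _ z X (hol_fun_lin u1 u2 ltac:(lra) ltac:(lra))) as H. cbv beta in H.
  rewrite E, Cmod_R, Rabs_pos_eq in H by apply l1norm_pos.
  specialize (H ltac:(intros; unfold lin, rscal, vscal; simpl; ring) Hz).
  pose proof (l1norm_pos X). pose proof (Cmod_ge_0 (lin u1 u2 z)).
  pose proof (lin_le u1 u2 z ltac:(lra) ltac:(lra)).
  assert (0 < 1 - Cmod (lin u1 u2 z) ^ 2 <= 1) by nra.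
  assert (0 <= kobm z X) by nra. nra.
Qed.

Lemma kobm_pos (z X : C * C) : l1norm z < 1 -> 0 <= kobm z X.
Proof. intros Hz. pose proof (kobm_ge_l1norm z X Hz). pose proof (l1norm_pos X). lra. Qed.

Lemma kobm_upper (z X : C * C) : l1norm z < 1 -> kobm z X <= l1norm X / (1 - l1norm z).
Proof. intros Hz. apply (kobm_spec z X Hz). now apply metric_disc_exists. Qed.

(** Recentring the disc at [t] multiplies its velocity by [1 - Cmod t ^ 2]. *)
Lemma kobm_le_deriv (psi : C -> C * C) (t : C) (v : C * C) : hdisc psi -> Cmod t < 1 -> hderiv psi t v ->
  kobm (psi t) v <= / (1 - Cmod t ^ 2).
Proof.
  intros Hp Ht Hv. destruct (Hp t Ht) as [_ Hb]. apply (kobm_spec _ v Hb).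
  pose proof (Cmod_ge_0 t). assert (P : 0 < 1 - Cmod t ^ 2) by nra.
  split; [left; now apply Rinv_0_lt_compat|].
  assert (Ht' : Cmod (- t)%C < 1) by now rewrite Cmod_opp.
  assert (Z0 : Cmod 0%C < 1) by (rewrite Cmod_0; lra).
  exists (fun w => psi (mob (- t)%C w)), (vscal (RtoC (1 - Cmod t ^ 2)) v).
  split; [apply (hdisc_comp psi); [exact Hp|now apply hol_disc_map_mob]|].
  split; [now rewrite mob_neg_0|]. split.
  - apply (hderiv_comp psi); [|now rewrite mob_neg_0].
    eapply cderiv_eq; [exact (mob_derive (- t)%C 0%C Ht' Z0)|].
    rewrite one_sub_Cmod2_conj, Cmod_opp, !Cmult_0_r. field.
  - assert (E : (RtoC (/ (1 - Cmod t ^ 2)) * RtoC (1 - Cmod t ^ 2))%C = 1%C).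
    { rewrite <- RtoC_mult. now rewrite Rinv_l by lra. }
    unfold rscal. transitivity (vscal (RtoC (/ (1 - Cmod t ^ 2)) * RtoC (1 - Cmod t ^ 2))%C v); [vring|].
    rewrite E. vring.
Qed.

Lemma kobm_rscal_le (z X : C * C) (t : R) : l1norm z < 1 -> kobm z (rscal t X) <= Rabs t * kobm z X.
Proof.
  intros Hz. apply le_epsilon. intros eps He.
  destruct (kobm_spec z X Hz) as (_ & _ & A).
  destruct (A (eps / (Rabs t + 1))) as [r [[Hr (psi & v & Hp & H0 & Hv & HX)] Hlt]].
  { pose proof (Rabs_pos t). apply Rdiv_lt_0_compat; lra. }
  destruct (phase_exists (RtoC t)) as [u [Hu Eu]]. rewrite Cmod_R in Eu.
  assert (B : kobm z (rscal t X) <= Rabs t * r).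
  { apply (kobm_spec _ _ Hz). split; [apply Rmult_le_pos; [apply Rabs_pos|exact Hr]|].
    exists (fun w => psi (u * w)%C), (vscal u v). split; [|split; [|split]].
    - apply (hdisc_comp psi); [exact Hp|now apply hol_disc_map_rot].
    - now rewrite Cmult_0_r.
    - apply (hderiv_comp psi (fun w => u * w)%C); [|now rewrite Cmult_0_r].
      eapply cderiv_eq; [apply cderiv_cmult, cderiv_id|ring].
    - rewrite <- HX. unfold rscal. rewrite <- Eu. rewrite RtoC_mult. vring. }
  apply Rle_trans with (1 := B). pose proof (Rabs_pos t).
  apply Rle_trans with (Rabs t * (kobm z X + eps / (Rabs t + 1))); [apply Rmult_le_compat_l; lra|].
  rewrite Rmult_plus_distr_l. apply Rplus_le_compat_l.
  apply (Rmult_le_reg_r (Rabs t + 1)); [lra|].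
  replace (Rabs t * (eps / (Rabs t + 1)) * (Rabs t + 1)) with (Rabs t * eps) by (field; lra). nra.
Qed.

Lemma rscal_mul (s t : R) (z : C * C) : rscal s (rscal t z) = rscal (s * t) z.
Proof. unfold rscal. rewrite RtoC_mult. vring. Qed.

Lemma rscal_1 (z : C * C) : rscal 1 z = z.
Proof. vring. Qed.

Lemma rscal_0 (z : C * C) : rscal 0 z = vzero.
Proof. vring. Qed.

Lemma kobm_vzero (z : C * C) : l1norm z < 1 -> kobm z vzero = 0.
Proof.
  intros Hz. apply Rle_antisym; [|now apply kobm_pos].
  pose proof (kobm_upper z vzero Hz) as H. rewrite l1norm_vzero in H. unfold Rdiv in H. lra.
Qed.

Lemma kobm_rscal (z X : C * C) (t : R) : l1norm z < 1 -> kobm z (rscal t X) = Rabs t * kobm z X.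
Proof.
  intros Hz. apply Rle_antisym; [now apply kobm_rscal_le|].
  destruct (Req_dec t 0) as [->|Ht].
  { rewrite rscal_0, kobm_vzero, Rabs_R0 by exact Hz. lra. }
  pose proof (kobm_rscal_le z (rscal t X) (/ t) Hz) as H.
  rewrite rscal_mul, Rinv_l, rscal_1, Rabs_inv in H by exact Ht.
  pose proof (Rabs_pos_lt t Ht). apply (Rmult_le_compat_l (Rabs t)) in H; [|lra].
  rewrite <- Rmult_assoc, Rinv_r, Rmult_1_l in H by lra. exact H.
Qed.

Lemma hderiv_lincomb (psi chi : C -> C * C) (p q : R) (l : C) (v w : C * C) :
  hderiv psi l v -> hderiv chi l w ->
  hderiv (fun l => vadd (rscal p (psi l)) (rscal q (chi l))) l (vadd (rscal p v) (rscal q w)).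
Proof. intros [D1 D2] [D3 D4]. split; simpl; apply cderiv_plus; now apply cderiv_cmult. Qed.

Lemma hdisc_convex (psi chi : C -> C * C) (p q : R) : 0 <= p -> 0 <= q -> p + q = 1 ->
  hdisc psi -> hdisc chi -> hdisc (fun l => vadd (rscal p (psi l)) (rscal q (chi l))).
Proof.
  intros Hp0 Hq0 Hpq Hp Hc l Hl.
  destruct (Hp l Hl) as [[a Ha] B1]. destruct (Hc l Hl) as [[b Hb] B2].
  split; [exact (ex_intro _ _ (hderiv_lincomb _ _ p q l a b Ha Hb))|].
  eapply Rle_lt_trans; [apply l1norm_vadd|]. rewrite !l1norm_rscal, !Rabs_pos_eq by assumption.
  destruct (Req_dec p 0) as [Ep|Ep]; [rewrite Ep in *; assert (q = 1) as -> by lra; lra|nra].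
Qed.

(** Comes from convexity of the ball: almost optimal discs for [X] and [Y] are averaged with weights
    proportional to their factors. *)
Lemma kobm_vadd (z X Y : C * C) : l1norm z < 1 -> kobm z (vadd X Y) <= kobm z X + kobm z Y.
Proof.
  intros Hz. apply le_epsilon. intros eps He.
  destruct (kobm_spec z X Hz) as (_ & _ & A1).
  destruct (A1 (eps / 4) ltac:(lra)) as [r [[Hr (psi & v & Hp & H0 & Hv & HX)] Hlt]].
  destruct (kobm_spec z Y Hz) as (_ & _ & A2).
  destruct (A2 (eps / 4) ltac:(lra)) as [s [[Hs (chi & w & Hc & K0 & Hw & HY)] Hlt']].
  destruct (Req_dec (r + s) 0) as [E|E].
  { assert (r = 0) by lra. assert (s = 0) by lra. subst r s. rewrite rscal_0 in HX, HY. subst X Y.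
    replace (vadd vzero vzero) with vzero by vring. rewrite kobm_vzero by exact Hz. lra. }
  set (p := r / (r + s)). set (q := s / (r + s)).
  assert (Hp0 : 0 <= p) by (apply Rdiv_le_0_compat; lra).
  assert (Hq0 : 0 <= q) by (apply Rdiv_le_0_compat; lra).
  assert (Hpq : p + q = 1) by (unfold p, q; field; lra).
  assert (B : kobm z (vadd X Y) <= r + s); [|lra].
  apply (kobm_spec _ _ Hz). split; [lra|].
  exists (fun l => vadd (rscal p (psi l)) (rscal q (chi l))), (vadd (rscal p v) (rscal q w)).
  split; [|split; [|split]].
  - now apply hdisc_convex.
  - rewrite H0, K0. transitivity (rscal (p + q) z); [|now rewrite Hpq, rscal_1].
    unfold rscal. rewrite RtoC_plus. vring.
  - now apply hderiv_lincomb.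
  - rewrite <- HX, <- HY. transitivity (vadd (rscal ((r + s) * p) v) (rscal ((r + s) * q) w)).
    + rewrite <- !rscal_mul. vring.
    + f_equal; f_equal; unfold p, q; field; lra.
Qed.

(** An affine disc inside the l1 ball of radius [1 - l1norm a] around [a]. *)
Lemma kobd_local (a b : C * C) : l1norm a < 1 -> l1norm (vsub b a) < 1 - l1norm a ->
  l1norm b < 1 /\ kobd a b <= artanh (l1norm (vsub b a) / (1 - l1norm a)).
Proof.
  intros Ha Hb. pose proof (l1norm_pos (vsub b a)) as P.
  assert (Hb' : l1norm b < 1) by (pose proof (l1norm_le_vsub b a); lra).
  split; [exact Hb'|]. apply kobd_le_segment; auto.
  set (d := l1norm (vsub b a)) in *. set (m := 1 - l1norm a) in *.
  assert (Hr : 0 <= d / m < 1).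
  { split; [apply Rdiv_le_0_compat; lra|]. apply (Rmult_lt_reg_r m); [lra|].
    unfold Rdiv. rewrite Rmult_assoc, Rinv_l; lra. }
  split; [exact Hr|].
  destruct (Req_dec d 0) as [E|E].
  - exists (fun l => vadd a (vscal l vzero)). split; [|split; [vring|]].
    + apply hdisc_affine; rewrite ?l1norm_vzero; lra.
    + apply l1norm_eq_0 in E. transitivity (vadd a (vsub b a)); [rewrite E|]; vring.
  - exists (fun l => vadd a (vscal l (rscal (m / d) (vsub b a)))). split; [|split; [vring|]].
    + apply hdisc_affine; [|lra]. rewrite l1norm_rscal, Rabs_pos_eq by (apply Rdiv_le_0_compat; lra).
      fold d. unfold Rdiv. rewrite Rmult_assoc, Rinv_l by lra. unfold m; lra.
    + change (vscal (RtoC (d / m)) (rscal (m / d) (vsub b a))) with (rscal (d / m) (rscal (m / d) (vsub b a))).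
      rewrite rscal_mul. replace (d / m * (m / d)) with 1 by (field; lra). vring.
Qed.

Lemma kobd_disc_real (psi : C -> C * C) (s t : R) : hdisc psi -> 0 <= s -> s <= t -> t < 1 ->
  kobd (psi (RtoC s)) (psi (RtoC t)) <= artanh t - artanh s.
Proof.
  intros Hp Hs Hst Ht.
  assert (Ms : Cmod (RtoC s) < 1) by (rewrite Cmod_R, Rabs_pos_eq; lra).
  assert (Mt : Cmod (RtoC t) < 1) by (rewrite Cmod_R, Rabs_pos_eq; lra).
  pose proof (segment_of_disc psi _ _ Hp Ms Mt) as S.
  assert (P : 0 < 1 - t * s) by nra.
  assert (E : Cmod ((RtoC s - RtoC t) / (1 - Cconj (RtoC t) * RtoC s))%C = (t - s) / (1 - t * s)).
  { replace (Cconj (RtoC t)) with (RtoC t) by (unfold Cconj, RtoC; simpl; f_equal; ring).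
    rewrite <- RtoC_mult, <- !RtoC_minus, <- RtoC_div by lra.
    rewrite Cmod_R, <- Rabs_Ropp, Rabs_pos_eq.
    - field; lra.
    - replace (- ((s - t) / (1 - t * s))) with ((t - s) / (1 - t * s)) by (field; lra).
      apply Rdiv_le_0_compat; lra. }
  rewrite E in S. assert (R : 0 <= (t - s) / (1 - t * s) < 1) by apply S.
  apply kobd_le_segment in S; try (apply Hp; assumption).
  pose proof (artanh_add ((t - s) / (1 - t * s)) s R ltac:(lra)) as A.
  replace (((t - s) / (1 - t * s) + s) / (1 + (t - s) / (1 - t * s) * s)) with t in A; [lra|].
  field. split; nra.
Qed.

Lemma radial_disc (z : C * C) : l1norm z < 1 -> exists psi, hdisc psi /\
  forall t, psi (RtoC (t * l1norm z)) = rscal t z /\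
    hderiv psi (RtoC (t * l1norm z)) (rscal (/ l1norm z) z).
Proof.
  intros Hz. pose proof (l1norm_pos z).
  exists (fun l => vadd vzero (vscal l (rscal (/ l1norm z) z))). split.
  - apply hdisc_affine; rewrite ?l1norm_vzero, ?l1norm_rscal; try lra.
    destruct (Req_dec (l1norm z) 0) as [E|E]; [rewrite E; lra|].
    rewrite Rabs_pos_eq by (left; apply Rinv_0_lt_compat; lra). rewrite Rinv_l; lra.
  - intros t. split; [|apply hderiv_affine].
    transitivity (rscal (t * l1norm z) (rscal (/ l1norm z) z)); [vring|].
    rewrite rscal_mul. destruct (Req_dec (l1norm z) 0) as [E|E].
    + apply l1norm_eq_0 in E. subst z. vring.
    + f_equal. field. exact E.
Qed.

Lemma kobd_radial (z : C * C) (s t : R) : l1norm z < 1 -> 0 <= s -> s <= t -> t <= 1 ->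
  kobd (rscal s z) (rscal t z) <= artanh (t * l1norm z) - artanh (s * l1norm z).
Proof.
  intros Hz Hs Hst Ht. destruct (radial_disc z Hz) as (psi & Hp & H). pose proof (l1norm_pos z).
  rewrite <- (proj1 (H s)), <- (proj1 (H t)). apply kobd_disc_real; auto; nra.
Qed.

Lemma kobd_ge_l1 (z w : C * C) : l1norm z < 1 -> l1norm w < 1 ->
  artanh (l1norm w) - artanh (l1norm z) <= kobd z w.
Proof.
  intros Hz Hw. destruct (lin_calibrating w) as (u1 & u2 & U1 & U2 & E).
  pose proof (kobd_ge_artanh _ _ z w (hol_fun_lin u1 u2 ltac:(lra) ltac:(lra)) Hz Hw) as H.
  rewrite E, Cmod_R, Rabs_pos_eq in H by apply l1norm_pos.
  assert (artanh (Cmod (lin u1 u2 z)) <= artanh (l1norm z)); [|lra].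
  apply artanh_le; [apply Cmod_ge_0| |exact Hz]. apply lin_le; lra.
Qed.

Lemma kobd_vzero (z : C * C) : l1norm z < 1 -> kobd vzero z = artanh (l1norm z).
Proof.
  intros Hz. apply Rle_antisym.
  - pose proof (kobd_radial z 0 1 Hz ltac:(lra) ltac:(lra) ltac:(lra)) as H.
    rewrite rscal_0, rscal_1, Rmult_0_l, Rmult_1_l, artanh_0 in H. lra.
  - pose proof (kobd_ge_l1 vzero z) as H. rewrite l1norm_vzero, artanh_0 in H.
    specialize (H ltac:(lra) Hz). lra.
Qed.

Lemma kobm_radial (z : C * C) : l1norm z < 1 -> kobm z z <= l1norm z / (1 - l1norm z ^ 2).
Proof.
  intros Hz. destruct (radial_disc z Hz) as (psi & Hp & H). pose proof (l1norm_pos z).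
  destruct (H 1) as [H1 H2]. rewrite Rmult_1_l, rscal_1 in *.
  assert (M : Cmod (RtoC (l1norm z)) = l1norm z) by (rewrite Cmod_R; now apply Rabs_pos_eq).
  pose proof (kobm_le_deriv psi _ _ Hp ltac:(rewrite M; exact Hz) H2) as K.
  rewrite M, H1, kobm_rscal in K by exact Hz.
  destruct (Req_dec (l1norm z) 0) as [E|E].
  { rewrite E. apply l1norm_eq_0 in E. rewrite E, kobm_vzero; [unfold Rdiv; lra|rewrite l1norm_vzero; lra]. }
  rewrite Rabs_pos_eq in K by (left; apply Rinv_0_lt_compat; lra).
  apply (Rmult_le_compat_l (l1norm z)) in K; [|lra].
  rewrite <- Rmult_assoc, Rinv_r, Rmult_1_l in K by exact E. exact K.
Qed.

Lemma hderiv_l1 (phi : C -> C * C) (z : C) (v : C * C) : hderiv phi z v ->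
  forall eps, 0 < eps -> exists delta, 0 < delta /\ forall h, Cmod h < delta ->
    l1norm (vsub (phi (z + h)%C) (vadd (phi z) (vscal h v))) <= eps * Cmod h.
Proof.
  intros [H1 H2] eps He.
  destruct (H1 (eps / 2) ltac:(lra)) as [d1 [D1 K1]].
  destruct (H2 (eps / 2) ltac:(lra)) as [d2 [D2 K2]].
  exists (Rmin d1 d2). split; [now apply Rmin_pos|]. intros h Hh.
  pose proof (Rmin_l d1 d2). pose proof (Rmin_r d1 d2).
  specialize (K1 h ltac:(lra)). specialize (K2 h ltac:(lra)). unfold l1norm; simpl.
  replace (fst (phi (z + h)) - (fst (phi z) + h * fst v))%C with
   (fst (phi (z + h)) - fst (phi z) - fst v * h)%C by ring.
  replace (snd (phi (z + h)) - (snd (phi z) + h * snd v))%C with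
   (snd (phi (z + h)) - snd (phi z) - snd v * h)%C by ring. lra.
Qed.

(** Along a link the velocity at [t] has metric at most [/ (1 - t ^ 2)], so the hypothesis
    integrates to [K * artanh r]. The tolerance on [w] is there because discs are not straight. *)
Lemma kobd_infinitesimal_lipschitz (f : C * C -> R) (K : R) : 0 <= K ->
  (forall z X eps, l1norm z < 1 -> 0 < eps -> exists delta, 0 < delta /\
     forall h w, Rabs h < delta -> l1norm w < 1 -> l1norm (vsub w (vadd z (rscal h X))) <= delta * Rabs h ->
       Rabs (f w - f z) <= (K * kobm z X + eps) * Rabs h) ->
  forall z w, l1norm z < 1 -> l1norm w < 1 -> f w - f z <= K * kobd z w.
Proof.
  intros HK Hf. apply kobd_lipschitz; [exact HK|].
  intros z w r [Hr (psi & Hp & <- & <-)].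
  apply Rle_trans with (1 := Rle_abs _).
  pose proof (dini_bound (fun t => f (psi (RtoC t))) (fun t => K * artanh t) (fun t => K * / (1 - t ^ 2)) 0 r ltac:(lra)) as D.
  cbv beta in D. rewrite artanh_0, Rmult_0_r, Rminus_0_r in D. apply D; clear D.
  2:{ intros t Ht. apply derivable_pt_lim_scal. apply artanh_derive. lra. }
  intros t Ht eps He.
  assert (Mt : Cmod (RtoC t) < 1) by (rewrite Cmod_R, Rabs_pos_eq; lra).
  destruct (Hp _ Mt) as [[v Hv] Hb].
  destruct (Hf (psi (RtoC t)) v eps Hb He) as [d1 [D1 K1]].
  destruct (hderiv_l1 _ _ _ Hv d1 D1) as [d2 [D2 K2]].
  exists (Rmin d1 d2). split; [now apply Rmin_pos|]. intros s Hs Hst.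
  pose proof (Rmin_l d1 d2). pose proof (Rmin_r d1 d2).
  specialize (K2 (RtoC (s - t))). rewrite Cmod_R in K2. specialize (K2 ltac:(lra)).
  rewrite <- RtoC_plus in K2. replace (t + (s - t)) with s in K2 by ring.
  specialize (K1 (s - t) (psi (RtoC s)) ltac:(lra)).
  specialize (K1 ltac:(apply Hp; rewrite Cmod_R, Rabs_pos_eq; lra) K2).
  apply Rle_trans with (1 := K1). apply Rmult_le_compat_r; [apply Rabs_pos|].
  apply Rplus_le_compat_r, Rmult_le_compat_l; [exact HK|].
  pose proof (kobm_le_deriv psi _ v Hp Mt Hv) as KD. rewrite Cmod_R, Rabs_pos_eq in KD by lra. exact KD.
Qed.

Lemma kobd_ge_l1_sub (z w : C * C) : l1norm z < 1 -> l1norm w < 1 -> l1norm (vsub w z) <= kobd z w.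
Proof.
  intros Hz Hw.
  pose proof (kobd_infinitesimal_lipschitz (fun p => l1norm (vsub p z)) 1 ltac:(lra)) as L.
  cbv beta in L. specialize (L) with (z := z) (w := w).
  assert (E : l1norm (vsub z z) = 0) by (rewrite <- l1norm_vzero; f_equal; vring).
  rewrite E, Rminus_0_r, Rmult_1_l in L. apply L; auto. clear L w Hw.
  intros p X eps Hp He. exists eps. split; [exact He|]. intros h w Hh _ Hw.
  apply Rle_trans with (l1norm (vsub w p)).
  { pose proof (l1norm_vsub_triangle w p z). pose proof (l1norm_vsub_triangle p w z).
    rewrite (l1norm_vsub_sym p w) in *. apply Rabs_le; lra. }
  pose proof (l1norm_vsub_triangle w (vadd p (rscal h X)) p) as T.
  replace (vsub (vadd p (rscal h X)) p) with (rscal h X) in T by vring. rewrite l1norm_rscal in T.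
  pose proof (kobm_ge_l1norm p X Hp). pose proof (Rabs_pos h). nra.
Qed.

(** An almost optimal disc reaches a point [p] close to [z + h X] at the cost of about
    [kobm z X * Rabs h]; the gap from [p] to [w] is crossed inside a small ball. *)
Lemma kobd_infinitesimal (z X : C * C) (eps : R) : l1norm z < 1 -> 0 < eps ->
  exists delta, 0 < delta /\ forall h w, Rabs h < delta ->
    l1norm (vsub w (vadd z (rscal h X))) <= delta * Rabs h ->
    l1norm w < 1 /\ kobd z w <= (kobm z X + eps) * Rabs h.
Proof.
  intros Hz He.
  destruct (kobm_spec z X Hz) as (_ & _ & A).
  destruct (A (eps / 4) ltac:(lra)) as [r [[Hr (psi & v & Hp & H0 & Hv & HX)] Hlt]].
  set (a := 1 - l1norm z). pose proof (l1norm_pos X) as PX. pose proof (l1norm_pos z) as Pz.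
  assert (Ha : 0 < a <= 1) by (unfold a; lra).
  set (e := Rmin 1 (eps * a / (32 * (r + 1)))).
  assert (He0 : 0 < e) by (apply Rmin_pos; [lra|apply Rdiv_lt_0_compat; nra]).
  assert (He1 : e <= 1) by apply Rmin_l.
  assert (He2 : e * r <= eps * a / 32).
  { apply Rle_trans with (eps * a / (32 * (r + 1)) * r).
    - apply Rmult_le_compat_r; [exact Hr|apply Rmin_r].
    - apply (Rmult_le_reg_r (32 * (r + 1))); [lra|].
      replace (eps * a / (32 * (r + 1)) * r * (32 * (r + 1))) with (eps * a * r) by (field; lra).
      replace (eps * a / 32 * (32 * (r + 1))) with (eps * a * r + eps * a) by field. nra. }
  destruct (hderiv_l1 _ _ _ Hv e He0) as [d1 [D1 K1]].
  set (M := r + 1 + l1norm X).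
  (* The four bounds keep the parameter in the range of the derivative estimate, keep [p] away from
     the boundary, make the gap to [w] cheap, and absorb the quadratic error of [artanh]. *)
  set (delta := Rmin (Rmin (d1 / M) (a / (16 * M))) (Rmin (eps * a / 32) (eps / (8 * M * M)))).
  assert (HM : 1 <= M) by (unfold M; lra).
  assert (Hd : 0 < delta).
  { repeat apply Rmin_pos; apply Rdiv_lt_0_compat; nra. }
  assert (L1 : delta <= d1 / M).
  { eapply Rle_trans; [apply Rmin_l|apply Rmin_l]. }
  assert (L2 : delta <= a / (16 * M)).
  { eapply Rle_trans; [apply Rmin_l|apply Rmin_r]. }
  assert (L3 : delta <= eps * a / 32).
  { eapply Rle_trans; [apply Rmin_r|apply Rmin_l]. }
  assert (L4 : delta <= eps / (8 * M * M)).
  { eapply Rle_trans; [apply Rmin_r|apply Rmin_r]. }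
  assert (M1 : delta * M <= d1).
  { apply (Rmult_le_compat_r M) in L1; [|lra]. replace (d1 / M * M) with d1 in L1 by (field; lra). exact L1. }
  assert (M2 : delta * M <= a / 16).
  { apply (Rmult_le_compat_r M) in L2; [|lra]. replace (a / (16 * M) * M) with (a / 16) in L2 by (field; lra). exact L2. }
  assert (M4 : delta * (M * M) <= eps / 8).
  { apply (Rmult_le_compat_r (M * M)) in L4; [|nra].
    replace (eps / (8 * M * M) * (M * M)) with (eps / 8) in L4 by (field; lra). exact L4. }
  exists delta. split; [exact Hd|]. intros h w Hh Hw.
  set (k := Rabs h) in *. assert (Hk : 0 <= k) by apply Rabs_pos.
  assert (Kr : k * r <= delta * M) by (unfold M; nra).
  assert (Mt : Cmod (RtoC (h * r)) = k * r).
  { rewrite Cmod_R, Rabs_mult, (Rabs_pos_eq r) by exact Hr. reflexivity. }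
  assert (Kd : k * r < d1).
  { destruct (Req_dec r 0) as [->|Nr]; [lra|]. apply Rlt_le_trans with (delta * M); [|exact M1].
    unfold M. nra. }
  specialize (K1 (RtoC (h * r))). rewrite Mt in K1. specialize (K1 Kd).
  rewrite Cplus_0_l, H0 in K1.
  replace (vscal (RtoC (h * r)) v) with (rscal h X) in K1.
  2:{ rewrite <- HX, rscal_mul. reflexivity. }
  set (p := psi (RtoC (h * r))) in *.
  assert (Mt1 : Cmod (RtoC (h * r)) < 1) by (rewrite Mt; lra).
  assert (Np : l1norm p < 1) by (apply Hp; exact Mt1).
  assert (Dzp : kobd z p <= artanh (k * r)).
  { pose proof (segment_of_disc psi (RtoC 0) (RtoC (h * r)) Hp ltac:(rewrite Cmod_0; lra) Mt1) as S.
    rewrite H0 in S. replace (Cmod _) with (k * r) in S; [now apply kobd_le_segment|].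
    rewrite Cmult_0_r. replace ((0 - RtoC (h * r)) / (1 - 0))%C with (- RtoC (h * r))%C by field.
    now rewrite Cmod_opp, Mt. }
  assert (Dpz : l1norm p <= 1 - a / 2).
  { pose proof (l1norm_le_vsub p (vadd z (rscal h X))). pose proof (l1norm_vadd z (rscal h X)) as T.
    rewrite l1norm_rscal in T. fold k in T. unfold a, M in *. nra. }
  assert (Dwp : l1norm (vsub w p) <= (e * r + delta) * k).
  { pose proof (l1norm_vsub_triangle w (vadd z (rscal h X)) p) as T.
    rewrite (l1norm_vsub_sym (vadd z (rscal h X)) p) in T. lra. }
  assert (Sm : (e * r + delta) * k <= a / 8).
  { assert (e * r + delta <= M * 1 + 1). { unfold M. assert (delta <= 1) by nra. nra. }
    assert (k * 1 <= delta * M) by nra. assert (e * r * k <= a / 16) by nra.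
    assert (delta * k <= a / 16) by nra. lra. }
  destruct (kobd_local p w Np ltac:(lra)) as [Nw Dpw]. split; [exact Nw|].
  pose proof (kobd_triangle z p w Hz Np Nw) as T.
  set (y := l1norm (vsub w p) / (1 - l1norm p)) in *. pose proof (l1norm_pos (vsub w p)) as Pwp.
  assert (Y : 0 <= y <= 2 * ((e * r + delta) * k) / a).
  { split; [apply Rdiv_le_0_compat; lra|].
    apply (Rmult_le_reg_r (a * (1 - l1norm p))); [nra|]. unfold y.
    replace (l1norm (vsub w p) / (1 - l1norm p) * (a * (1 - l1norm p))) with (l1norm (vsub w p) * a) by (field; lra).
    replace (2 * ((e * r + delta) * k) / a * (a * (1 - l1norm p))) with
      ((e * r + delta) * k * (2 * (1 - l1norm p))) by (field; lra).
    apply Rmult_le_compat; lra. }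
  assert (Y2 : y <= 1 / 4).
  { apply Rle_trans with (1 := proj2 Y). apply (Rmult_le_reg_r a); [lra|].
    unfold Rdiv. rewrite Rmult_assoc, Rinv_l; lra. }
  assert (AY : artanh y <= eps / 2 * k).
  { apply Rle_trans with (y / (1 - y)); [apply artanh_upper; lra|].
    apply Rle_trans with (2 * y).
    - apply (Rmult_le_reg_r (1 - y)); [lra|]. unfold Rdiv. rewrite Rmult_assoc, Rinv_l by lra. nra.
    - apply Rle_trans with (4 * ((e * r + delta) / a) * k).
      + replace (4 * ((e * r + delta) / a) * k) with (2 * (2 * ((e * r + delta) * k) / a)) by (field; lra). lra.
      + apply Rmult_le_compat_r; [exact Hk|]. apply (Rmult_le_reg_r a); [lra|].
        replace (4 * ((e * r + delta) / a) * a) with (4 * (e * r + delta)) by (field; lra). lra. }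
  assert (AK : artanh (k * r) <= (r + eps / 4) * k).
  { apply Rle_trans with (k * r / (1 - k * r)); [apply artanh_upper; split; [nra|lra]|].
    apply (Rmult_le_reg_r (1 - k * r)); [lra|].
    replace (k * r / (1 - k * r) * (1 - k * r)) with (k * r) by (field; lra).
    assert (B1 : k * (r * r) <= eps / 8).
    { apply Rle_trans with (2 := M4). assert (r <= M) by (unfold M; lra).
      apply Rmult_le_compat; try nra. }
    assert (B2 : k * r <= 1 / 2) by lra.
    pose proof (Rmult_le_compat_l k _ _ Hk B1).
    pose proof (Rmult_le_compat_l (eps / 4 * k) _ _ ltac:(nra) B2). lra. }
  pose proof (Rmult_le_compat_r k r _ Hk (Rlt_le _ _ Hlt)). lra.
Qed.

(** * Local comparison of distance and metric *)

(** The homothety of ratio [s] centred at [v = c + s / (1 - s) (c - z)] carries [z] to [c] and, by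
    convexity, the ball into itself; discs through [z] become discs through [c]. *)
Lemma kobm_shift (z c X : C * C) (s : R) : l1norm z < 1 -> l1norm c < 1 -> 0 < s < 1 ->
  l1norm (vadd c (rscal (s / (1 - s)) (vsub c z))) < 1 -> s * kobm c X <= kobm z X.
Proof.
  intros Hz Hc Hs Hv. set (v := vadd c (rscal (s / (1 - s)) (vsub c z))) in *.
  apply le_epsilon. intros eps He.
  destruct (kobm_spec z X Hz) as (_ & _ & A).
  destruct (A eps He) as [r [[Hr (psi & w & Hp & H0 & Hw & HX)] Hlt]].
  apply Rle_trans with r; [|lra].
  rewrite <- (Rabs_pos_eq s) by lra. rewrite <- kobm_rscal by exact Hc.
  apply (kobm_spec c _ Hc). split; [exact Hr|].
  exists (fun l => vadd (rscal (1 - s) v) (rscal s (psi l))), (rscal s w).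
  assert (Der : forall l a, hderiv psi l a ->
     hderiv (fun l => vadd (rscal (1 - s) v) (rscal s (psi l))) l (rscal s a)).
  { intros l a [D1 D2]. split; simpl; (eapply cderiv_eq;
      [apply cderiv_plus; [apply cderiv_const|apply cderiv_cmult; eassumption]|simpl; ring]). }
  split; [|split; [|split]].
  - intros l Hl. destruct (Hp l Hl) as [[a Ha] B].
    split; [exact (ex_intro _ _ (Der l a Ha))|].
    eapply Rle_lt_trans; [apply l1norm_vadd|]. rewrite !l1norm_rscal, !Rabs_pos_eq by lra.
    nra.
  - rewrite H0. unfold v.
    transitivity (vadd (vadd (rscal (1 - s) c) (rscal ((1 - s) * (s / (1 - s))) (vsub c z))) (rscal s z)).
    + rewrite <- rscal_mul. vring.
    + replace ((1 - s) * (s / (1 - s))) with s by (field; lra).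
      unfold rscal; rewrite RtoC_minus; vring.
  - now apply Der.
  - rewrite <- HX, !rscal_mul. f_equal. ring.
Qed.

Lemma kobm_near (c : C * C) (s : R) : l1norm c < 1 -> 0 < s < 1 -> exists rho, 0 < rho /\
  forall z, l1norm (vsub z c) < rho -> l1norm z < 1 /\
    forall X, s * kobm c X <= kobm z X /\ s * kobm z X <= kobm c X.
Proof.
  (* With this radius [rho / (1 - s)] is half of [1 - l1norm c], so the homothety centres for both
     directions lie in the ball. *)
  intros Hc Hs. exists ((1 - l1norm c) * (1 - s) / 2). split; [apply Rdiv_lt_0_compat; nra|].
  intros z Hz. set (rho := (1 - l1norm c) * (1 - s) / 2) in *.
  assert (E : rho + s / (1 - s) * rho = (1 - l1norm c) / 2) by (unfold rho; field; lra).
  assert (Pr : 0 < rho) by (unfold rho; nra).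
  assert (Ps : 0 < s / (1 - s)) by (apply Rdiv_lt_0_compat; lra).
  pose proof (l1norm_le_vsub z c) as T.
  assert (Z1 : l1norm z < 1).
  { assert (0 < s / (1 - s) * rho) by now apply Rmult_lt_0_compat. lra. }
  split; [exact Z1|]. intros X.
  pose proof (l1norm_pos (vsub z c)).
  assert (Q : s / (1 - s) * l1norm (vsub z c) <= s / (1 - s) * rho) by (apply Rmult_le_compat_l; lra).
  split; apply kobm_shift; auto; (eapply Rle_lt_trans; [apply l1norm_vadd|]);
    rewrite l1norm_rscal, (Rabs_pos_eq (s / (1 - s))) by lra.
  - rewrite l1norm_vsub_sym. lra.
  - lra.
Qed.

Lemma vsub_diag (z : C * C) : vsub z z = vzero.
Proof. vring. Qed.

Lemma kobm_vsub_sym (c z w : C * C) : l1norm c < 1 -> kobm c (vsub z w) = kobm c (vsub w z).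
Proof.
  intros Hc. replace (vsub z w) with (rscal (-1) (vsub w z)) by vring.
  rewrite kobm_rscal by exact Hc. rewrite Rabs_left by lra. ring.
Qed.

Lemma kobm_vsub_triangle (c a b d : C * C) : l1norm c < 1 ->
  kobm c (vsub a d) <= kobm c (vsub a b) + kobm c (vsub b d).
Proof.
  intros Hc. replace (vsub a d) with (vadd (vsub a b) (vsub b d)) by vring. now apply kobm_vadd.
Qed.

Lemma Rmin_lipschitz (a b m : R) : Rabs (Rmin a m - Rmin b m) <= Rabs (a - b).
Proof. unfold Rmin, Rabs. repeat destruct Rle_dec; repeat destruct Rcase_abs; lra. Qed.

(** Chains may leave the neighbourhood of [c] where the metric is comparable with [kobm c]. The test
    function is therefore truncated, which makes it locally constant outside. *)
Lemma kobd_near_lower (c : C * C) (s : R) : l1norm c < 1 -> 0 < s < 1 -> exists rho, 0 < rho /\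
  forall p q, l1norm (vsub p c) < rho -> l1norm (vsub q c) < rho -> s * kobm c (vsub q p) <= kobd p q.
Proof.
  intros Hc Hs. destruct (kobm_near c s Hc Hs) as [r [Hr K]].
  pose proof (l1norm_pos c) as Pc. set (a := 1 - l1norm c) in *. assert (Ha : 0 < a <= 1) by (unfold a; lra).
  (* A radius for which the truncation is inactive at [q] but active around every point at distance
     [r] or more from [c]. *)
  exists (r * a / 4). split; [nra|]. intros p q Hp Hq.
  assert (Hr4 : r * a / 4 <= r / 4) by nra.
  assert (Np : l1norm p < 1) by (apply K; lra). assert (Nq : l1norm q < 1) by (apply K; lra).
  set (f := fun z => Rmin (kobm c (vsub z p)) (r / 2)).
  assert (L : f q - f p <= / s * kobd p q).
  { apply kobd_infinitesimal_lipschitz; auto.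
    { left; apply Rinv_0_lt_compat; lra. }
    intros z X eps Hz He.
    destruct (Rlt_le_dec (l1norm (vsub z c)) r) as [Near|Far].
    - exists (eps * a). split; [nra|]. intros h w Hh Nw Hw.
      apply Rle_trans with (1 := Rmin_lipschitz _ _ _).
      pose proof (kobm_vsub_triangle c w z p Hc) as T1. pose proof (kobm_vsub_triangle c z w p Hc) as T2.
      rewrite (kobm_vsub_sym c z w Hc) in T2.
      apply Rle_trans with (kobm c (vsub w z)); [apply Rabs_le; lra|].
      pose proof (kobm_vsub_triangle c w (vadd z (rscal h X)) z Hc) as T3.
      replace (vsub (vadd z (rscal h X)) z) with (rscal h X) in T3 by vring.
      rewrite kobm_rscal in T3 by exact Hc.
      pose proof (kobm_upper c (vsub w (vadd z (rscal h X))) Hc) as U. fold a in U.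
      assert (U' : l1norm (vsub w (vadd z (rscal h X))) / a <= eps * Rabs h).
      { apply (Rmult_le_reg_r a); [lra|]. unfold Rdiv. rewrite Rmult_assoc, Rinv_l by lra. lra. }
      destruct (K z Near) as [_ KX]. destruct (KX X) as [KX1 _].
      assert (KX' : kobm c X <= / s * kobm z X).
      { apply (Rmult_le_reg_l s); [lra|]. rewrite <- Rmult_assoc, Rinv_r; lra. }
      pose proof (Rmult_le_compat_r (Rabs h) _ _ (Rabs_pos h) KX'). lra.
    - pose proof (l1norm_pos X).
      exists (Rmin 1 (r / (8 * (l1norm X + 1)))). split.
      { apply Rmin_pos; [lra|]. apply Rdiv_lt_0_compat; nra. }
      intros h w Hh Nw Hw. set (d := Rmin 1 (r / (8 * (l1norm X + 1)))) in *.
      assert (D1 : d <= 1) by apply Rmin_l.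
      assert (D2 : d * (l1norm X + 1) <= r / 8).
      { assert (D : d <= r / (8 * (l1norm X + 1))) by apply Rmin_r.
        apply (Rmult_le_compat_r (l1norm X + 1)) in D; [|lra].
        replace (r / (8 * (l1norm X + 1)) * (l1norm X + 1)) with (r / 8) in D by (field; lra). exact D. }
      pose proof (Rabs_pos h) as Ph.
      assert (Dw : l1norm (vsub w z) <= r / 8).
      { pose proof (l1norm_vsub_triangle w (vadd z (rscal h X)) z) as T3.
        replace (vsub (vadd z (rscal h X)) z) with (rscal h X) in T3 by vring.
        rewrite l1norm_rscal in T3. nra. }
      assert (Far' : forall u, l1norm (vsub u z) <= r / 8 -> f u = r / 2).
      { intros u Hu. unfold f. apply Rmin_right.
        apply Rle_trans with (2 := kobm_ge_l1norm c _ Hc).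
        pose proof (l1norm_vsub_triangle z u c). pose proof (l1norm_vsub_triangle u p c).
        rewrite (l1norm_vsub_sym z u) in *. lra. }
      rewrite (Far' w Dw), (Far' z), Rminus_diag_eq, Rabs_R0.
      + apply Rmult_le_pos; [|exact Ph]. pose proof (kobm_pos z X Hz).
        assert (0 < / s) by (apply Rinv_0_lt_compat; lra). nra.
      + reflexivity.
      + rewrite vsub_diag, l1norm_vzero. lra. }
  assert (Fp : f p = 0).
  { unfold f. rewrite vsub_diag, kobm_vzero by exact Hc. apply Rmin_left. lra. }
  assert (Fq : f q = kobm c (vsub q p)).
  { unfold f. apply Rmin_left. apply Rle_trans with (1 := kobm_upper c _ Hc). fold a.
    pose proof (l1norm_vsub_triangle q c p) as T. rewrite (l1norm_vsub_sym c p) in T.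
    apply (Rmult_le_reg_r a); [lra|]. unfold Rdiv at 1. rewrite Rmult_assoc, Rinv_l; lra. }
  rewrite Fp, Fq, Rminus_0_r in L. apply (Rmult_le_compat_l s) in L; [|lra].
  rewrite <- (Rmult_assoc s (/ s)), Rinv_r, Rmult_1_l in L by lra. exact L.
Qed.

(** The metric is integrated along the straight segment from [p] to [q], where it is at most
    [kobm c Y / s]. *)
Lemma kobd_near_upper (c : C * C) (s : R) : l1norm c < 1 -> 0 < s < 1 -> exists rho, 0 < rho /\
  forall p q, l1norm (vsub p c) < rho -> l1norm (vsub q c) < rho -> s * kobd p q <= kobm c (vsub q p).
Proof.
  intros Hc Hs. destruct (kobm_near c s Hc Hs) as [r [Hr K]].
  exists r. split; [exact Hr|]. intros p q Hp Hq.
  set (Y := vsub q p). set (x := fun t => vadd p (rscal t Y)).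
  assert (Hx : forall t, 0 <= t <= 1 -> l1norm (vsub (x t) c) < r).
  { intros t Ht. replace (vsub (x t) c) with (vadd (rscal (1 - t) (vsub p c)) (rscal t (vsub q c))).
    2:{ unfold x, Y, rscal. rewrite RtoC_minus. vring. }
    eapply Rle_lt_trans; [apply l1norm_vadd|]. rewrite !l1norm_rscal, !Rabs_pos_eq by lra.
    destruct (Req_dec t 0) as [->|Nt]; [lra|]. nra. }
  assert (D : Rabs (kobd p (x 1) - kobd p (x 0)) <= kobm c Y / s * 1 - kobm c Y / s * 0).
  { apply (dini_bound (fun t => kobd p (x t)) (fun t => kobm c Y / s * t) (fun _ => kobm c Y / s) 0 1); [lra| |].
    - intros t Ht eps He. destruct (K _ (Hx t Ht)) as [Nt KX].
      destruct (kobd_infinitesimal (x t) Y eps Nt He) as [dl [Hd I]].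
      exists dl. split; [exact Hd|]. intros u Hu Hut.
      assert (E : vadd (x t) (rscal (u - t) Y) = x u).
      { unfold x, rscal. rewrite RtoC_minus. vring. }
      destruct (I (u - t) (x u) Hut) as [Nu Ku].
      { rewrite E, vsub_diag, l1norm_vzero. apply Rmult_le_pos; [lra|apply Rabs_pos]. }
      assert (Np : l1norm p < 1) by (apply K; exact Hp).
      pose proof (kobd_triangle p (x t) (x u) Np Nt Nu).
      pose proof (kobd_triangle p (x u) (x t) Np Nu Nt).
      rewrite (kobd_sym (x u) (x t)) in * by assumption.
      apply Rle_trans with (kobd (x t) (x u)); [apply Rabs_le; lra|].
      apply Rle_trans with (1 := Ku). apply Rmult_le_compat_r; [apply Rabs_pos|].
      apply Rplus_le_compat_r. destruct (KX Y) as [_ KY].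
      apply (Rmult_le_reg_l s); [lra|]. replace (s * (kobm c Y / s)) with (kobm c Y) by (field; lra). exact KY.
    - intros t Ht. pose proof (derivable_pt_lim_scal id (kobm c Y / s) t 1 (derivable_pt_lim_id t)) as D0.
      rewrite Rmult_1_r in D0. exact D0. }
  replace (x 1) with q in D by (unfold x, Y; vring).
  replace (x 0) with p in D by (unfold x, Y; vring).
  rewrite (kobd_refl p) in D by (apply K; exact Hp).
  apply Rabs_le_between in D. destruct D as [_ D].
  apply (Rmult_le_compat_l s) in D; [|lra].
  replace (s * (kobm c Y / s * 1 - kobm c Y / s * 0)) with (kobm c Y) in D by (field; lra). lra.
Qed.

Lemma kobm_at_vzero (X : C * C) : kobm vzero X = l1norm X.
Proof.
  assert (H : l1norm vzero < 1) by (rewrite l1norm_vzero; lra).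
  apply Rle_antisym; [|now apply kobm_ge_l1norm].
  pose proof (kobm_upper vzero X H) as U. rewrite l1norm_vzero in U. unfold Rdiv in U.
  rewrite Rminus_0_r, Rinv_1 in U. lra.
Qed.

(** * Finite-dimensional real linear analysis *)

Definition rdot (a x : C * C) : R :=
  fst (fst a) * fst (fst x) + snd (fst a) * snd (fst x)
  + fst (snd a) * fst (snd x) + snd (snd a) * snd (snd x).

Definition sublinear (p : C * C -> R) : Prop :=
  (forall x y, p (vadd x y) <= p x + p y) /\ (forall t x, 0 <= t -> p (rscal t x) = t * p x).

Definition vopp (x : C * C) : C * C := rscal (-1) x.

Lemma glb_real_spec (P : R -> Prop) (m x0 : R) : (forall x, P x -> m <= x) -> P x0 ->
  (forall x, P x -> real (Glb_Rbar P) <= x) /\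
  (forall b, (forall x, P x -> b <= x) -> b <= real (Glb_Rbar P)).
Proof.
  intros Hm H0. destruct (Glb_Rbar_correct P) as [L G].
  assert (L0 : Rbar_le m (Glb_Rbar P)) by (apply G; intros x Hx; now apply Hm).
  pose proof (L x0 H0) as U. destruct (Glb_Rbar P) as [g| |]; try contradiction.
  split; [exact L|]. intros b Hb. apply (G b). exact Hb.
Qed.

Lemma sublinear_0 (p : C * C -> R) : sublinear p -> p vzero = 0.
Proof. intros [_ H]. rewrite <- (rscal_0 vzero), H by lra. ring. Qed.

Lemma sublinear_opp (p : C * C -> R) (x : C * C) : sublinear p -> 0 <= p x + p (vopp x).
Proof.
  intros Hp. rewrite <- (sublinear_0 p Hp). replace vzero with (vadd x (vopp x)) by (unfold vopp; vring).
  apply Hp.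
Qed.

(* [p' x = inf over t >= 0 of p (x + t v) - t p v] *)
Lemma sublinear_reduce (p : C * C -> R) (v : C * C) : sublinear p ->
  exists p', sublinear p' /\ (forall x, p' x <= p x) /\ p' (vopp v) <= - p v.
Proof.
  intros Hp. pose proof Hp as [Hadd Hsc].
  pose (E := fun x y => exists t, 0 <= t /\ y = p (vadd x (rscal t v)) - t * p v).
  assert (Low : forall x y, E x y -> - p (vopp x) <= y).
  { intros x y (t & Ht & ->). rewrite <- (Hsc t v Ht).
    pose proof (Hadd (vadd x (rscal t v)) (vopp x)) as T.
    replace (vadd (vadd x (rscal t v)) (vopp x)) with (rscal t v) in T by (unfold vopp; vring). lra. }
  assert (E0 : forall x, E x (p x)).
  { intros x. exists 0. split; [lra|]. rewrite rscal_0. replace (vadd x vzero) with x by vring. ring. }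
  assert (S : forall x, _) by exact (fun x => glb_real_spec (E x) _ _ (Low x) (E0 x)).
  exists (fun x => real (Glb_Rbar (E x))). repeat split.
  - intros x y.
    assert (T : real (Glb_Rbar (E (vadd x y))) - real (Glb_Rbar (E y)) <= real (Glb_Rbar (E x))); [|lra].
    apply S. intros a (t & Ht & ->).
    assert (T : real (Glb_Rbar (E (vadd x y))) - (p (vadd x (rscal t v)) - t * p v) <= real (Glb_Rbar (E y))); [|lra].
    apply S. intros b (u & Hu & ->).
    assert (T : real (Glb_Rbar (E (vadd x y))) <= p (vadd (vadd x y) (rscal (t + u) v)) - (t + u) * p v).
    { apply S. exists (t + u). split; [lra|reflexivity]. }
    pose proof (Hadd (vadd x (rscal t v)) (vadd y (rscal u v))) as T'.
    replace (vadd (vadd x (rscal t v)) (vadd y (rscal u v))) with (vadd (vadd x y) (rscal (t + u) v)) in T'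
      by (unfold rscal; rewrite RtoC_plus; vring). lra.
  - assert (Half : forall t x, 0 < t -> real (Glb_Rbar (E (rscal t x))) <= t * real (Glb_Rbar (E x))).
    { intros t x Ht.
      assert (T : real (Glb_Rbar (E (rscal t x))) / t <= real (Glb_Rbar (E x))).
      { apply S. intros a (u & Hu & ->). apply (Rmult_le_reg_l t); [exact Ht|].
        replace (t * (real (Glb_Rbar (E (rscal t x))) / t)) with (real (Glb_Rbar (E (rscal t x)))) by (field; lra).
        apply S. exists (t * u). split; [nra|].
        replace (vadd (rscal t x) (rscal (t * u) v)) with (rscal t (vadd x (rscal u v))).
        - rewrite Hsc by lra. ring.
        - rewrite <- rscal_mul. vring. }
      apply (Rmult_le_compat_l t) in T; [|lra].
      replace (t * (real (Glb_Rbar (E (rscal t x))) / t)) with (real (Glb_Rbar (E (rscal t x)))) in T by (field; lra).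
      exact T. }
    intros t x [Ht|<-].
    + apply Rle_antisym; [now apply Half|].
      pose proof (Half (/ t) (rscal t x) (Rinv_0_lt_compat t Ht)) as T.
      rewrite rscal_mul, Rinv_l, rscal_1 in T by lra.
      apply (Rmult_le_compat_l t) in T; [|lra]. rewrite <- Rmult_assoc, Rinv_r, Rmult_1_l in T by lra. exact T.
    + rewrite rscal_0, Rmult_0_l. apply Rle_antisym.
      * rewrite <- (sublinear_0 p Hp). apply S, E0.
      * apply S. intros a (u & Hu & ->). replace (vadd vzero (rscal u v)) with (rscal u v) by vring.
        rewrite Hsc by exact Hu. lra.
  - intros x. apply S, E0.
  - apply S. exists 1. split; [lra|]. replace (vadd (vopp v) (rscal 1 v)) with vzero by (unfold vopp; vring).
    rewrite (sublinear_0 p Hp). ring.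
Qed.

Definition basis (i : nat) : C * C :=
  match i with
  | 0 => (RtoC 1, RtoC 0) | 1 => (Ci, RtoC 0) | 2 => (RtoC 0, RtoC 1) | _ => (RtoC 0, Ci)
  end.

Definition coord (i : nat) (x : C * C) : R :=
  match i with
  | 0 => fst (fst x) | 1 => snd (fst x) | 2 => fst (snd x) | _ => snd (snd x)
  end.

Definition combine (f : nat -> R) (v : nat -> C * C) : C * C :=
  vadd (vadd (rscal (f 0%nat) (v 0%nat)) (rscal (f 1%nat) (v 1%nat)))
       (vadd (rscal (f 2%nat) (v 2%nat)) (rscal (f 3%nat) (v 3%nat))).

Lemma basis_combine (x : C * C) : x = combine (fun i => coord i x) basis.
Proof.
  destruct x as [[a b] [c d]]. unfold combine, coord, basis, rscal, vscal, vadd, Ci, RtoC, Cmult, Cplus; simpl.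
  repeat f_equal; ring.
Qed.

Lemma coord_rscal (i : nat) (t : R) (x : C * C) : coord i (rscal t x) = t * coord i x.
Proof. destruct i as [|[|[|i]]]; simpl; ring. Qed.

Lemma coord_vadd (i : nat) (x y : C * C) : coord i (vadd x y) = coord i x + coord i y.
Proof. destruct i as [|[|[|i]]]; reflexivity. Qed.

(** Reduction along a vector makes the function odd on it; after the four basis vectors it is
    linear. The initial reduction along [v] forces the value [p v] there. *)
Lemma hahn_banach (p : C * C -> R) (v : C * C) : sublinear p ->
  exists a, (forall x, rdot a x <= p x) /\ rdot a v = p v.
Proof.
  intros Hp.
  destruct (sublinear_reduce p v Hp) as (p0 & S0 & L0 & B0).
  destruct (sublinear_reduce p0 (basis 0) S0) as (p1 & S1 & L1 & B1).
  destruct (sublinear_reduce p1 (basis 1) S1) as (p2 & S2 & L2 & B2).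
  destruct (sublinear_reduce p2 (basis 2) S2) as (p3 & S3 & L3 & B3).
  destruct (sublinear_reduce p3 (basis 3) S3) as (q & S4 & L4 & B4).
  assert (Lin : forall i, (i < 4)%nat -> q (vopp (basis i)) = - q (basis i)).
  { intros i Hi. pose proof (sublinear_opp q (basis i) S4).
    destruct i as [|[|[|[|i]]]]; [| | | |lia]; apply Rle_antisym; try lra;
    match goal with |- q (vopp ?b) <= _ =>
      pose proof (L1 (vopp b)); pose proof (L2 (vopp b)); pose proof (L3 (vopp b)); pose proof (L4 (vopp b));
      pose proof (L1 b); pose proof (L2 b); pose proof (L3 b); pose proof (L4 b) end; lra. }
  assert (Sc : forall i t, (i < 4)%nat -> q (rscal t (basis i)) = t * q (basis i)).
  { intros i t Hi. destruct (Rle_lt_dec 0 t) as [Ht|Ht]; [now apply S4|].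
    replace (rscal t (basis i)) with (rscal (- t) (vopp (basis i))).
    - rewrite (proj2 S4) by lra. rewrite Lin by exact Hi. ring.
    - unfold vopp. rewrite rscal_mul. f_equal. ring. }
  pose (l := fun x => coord 0 x * q (basis 0) + coord 1 x * q (basis 1) + coord 2 x * q (basis 2) + coord 3 x * q (basis 3)).
  assert (Up : forall x, q x <= l x).
  { intros x. rewrite (basis_combine x) at 1. unfold combine, l.
    rewrite <- !Sc by lia.
    eapply Rle_trans; [apply S4|].
    eapply Rle_trans; [apply Rplus_le_compat; apply S4|]. lra. }
  assert (Eq : forall x, q x = l x).
  { intros x. apply Rle_antisym; [apply Up|].
    pose proof (Up (vopp x)) as U. pose proof (sublinear_opp q x S4).
    assert (l (vopp x) = - l x).
    { destruct x as [[a b] [c d]]. unfold l, coord, vopp, rscal, vscal, RtoC, Cmult; simpl. ring. }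
    lra. }
  exists ((q (basis 0), q (basis 1)), (q (basis 2), q (basis 3))).
  assert (R : forall x, rdot ((q (basis 0), q (basis 1)), (q (basis 2), q (basis 3))) x = q x).
  { intros x. rewrite (Eq x). unfold rdot, l, coord; cbn [fst snd]. ring. }
  assert (Le : forall x, q x <= p0 x).
  { intros x. pose proof (L1 x). pose proof (L2 x). pose proof (L3 x). pose proof (L4 x). lra. }
  split.
  - intros x. rewrite R. pose proof (Le x). pose proof (L0 x). lra.
  - rewrite R. apply Rle_antisym.
    + pose proof (Le v). pose proof (L0 v). lra.
    + pose proof (Le (vopp v)) as T. rewrite Eq in T.
      assert (l (vopp v) = - l v).
      { unfold l, vopp. rewrite !coord_rscal. ring. }
      rewrite Eq. lra.
Qed.

(** * Sequential compactness *)

Definition extraction (s : nat -> nat) : Prop := forall n, (s n < s (S n))%nat.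

Lemma extraction_mono (s : nat -> nat) : extraction s -> forall n m, (n <= m)%nat -> (s n <= s m)%nat.
Proof. intros H n m. induction 1 as [|m _ IH]; [lia|]. pose proof (H m). lia. Qed.

Lemma extraction_ge (s : nat -> nat) : extraction s -> forall n, (n <= s n)%nat.
Proof. intros H n. induction n as [|n IH]; [lia|]. pose proof (H n). lia. Qed.

Lemma extraction_comp (s t : nat -> nat) : extraction s -> extraction t -> extraction (fun n => s (t n)).
Proof.
  intros Hs Ht n. pose proof (Ht n). pose proof (extraction_mono s Hs (S (t n)) (t (S n)) ltac:(lia)).
  pose proof (Hs (t n)). lia.
Qed.

Definition conv_R (u : nat -> R) (l : R) : Prop :=
  forall eps, 0 < eps -> exists n0, forall n, (n0 <= n)%nat -> Rabs (u n - l) < eps.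

Lemma conv_R_extract (u : nat -> R) (l : R) (s : nat -> nat) : extraction s -> conv_R u l -> conv_R (fun n => u (s n)) l.
Proof.
  intros Hs H eps He. destruct (H eps He) as [n0 K]. exists n0. intros n Hn. apply K.
  pose proof (extraction_ge s Hs n). lia.
Qed.

Lemma bolzano_weierstrass_R (u : nat -> R) (M : R) : (forall n, Rabs (u n) <= M) ->
  exists s l, extraction s /\ conv_R (fun n => u (s n)) l.
Proof.
  intros H. destruct (Bolzano_Weierstrass u (fun x => - M <= x <= M) (compact_P3 (- M) M)) as [l Hl].
  { intros n. now apply Rabs_le_between. }
  assert (Pick : forall n k : nat, exists p : nat, (k < p)%nat /\ Rabs (u p - l) < / (INR n + 1)).
  { intros n k. assert (P : 0 < / (INR n + 1)) by (apply Rinv_0_lt_compat; pose proof (pos_INR n); lra).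
    destruct (Hl (disc l (mkposreal _ P)) (S k)) as [p [Hp Dp]].
    - exists (mkposreal _ P). unfold included. auto.
    - exists p. split; [lia|exact Dp]. }
  pose (next := fun n k => epsilon (inhabits 0%nat) (fun p => (k < p)%nat /\ Rabs (u p - l) < / (INR n + 1))).
  assert (Next : forall n k, (k < next n k)%nat /\ Rabs (u (next n k) - l) < / (INR n + 1)).
  { intros n k. apply epsilon_spec, Pick. }
  pose (s := fix s n := match n with O => next 0%nat 0%nat | S m => next (S m) (s m) end).
  exists s, l. split.
  - intros n. simpl. apply Next.
  - intros eps He. destruct (archimed_cor1 eps He) as [N [HN HN0]]. exists N. intros n Hn.
    apply Rlt_trans with (/ (INR n + 1)).
    + destruct n as [|n]; apply Next.
    + apply Rle_lt_trans with (2 := HN). apply Rinv_le_contravar.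
      * now apply lt_0_INR. * apply le_INR in Hn. lra.
Qed.

Definition conv_V (u : nat -> C * C) (l : C * C) : Prop :=
  forall eps, 0 < eps -> exists n0, forall n, (n0 <= n)%nat -> l1norm (vsub (u n) l) < eps.

Lemma conv_V_extract (u : nat -> C * C) (l : C * C) (s : nat -> nat) : extraction s -> conv_V u l -> conv_V (fun n => u (s n)) l.
Proof.
  intros Hs H eps He. destruct (H eps He) as [n0 K]. exists n0. intros n Hn. apply K.
  pose proof (extraction_ge s Hs n). lia.
Qed.

Lemma coord_le (i : nat) (x : C * C) : Rabs (coord i x) <= l1norm x.
Proof.
  unfold l1norm. pose proof (Cmod_ge_0 (fst x)). pose proof (Cmod_ge_0 (snd x)).
  pose proof (fst_le_Cmod (fst x)). pose proof (snd_le_Cmod (fst x)).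
  pose proof (fst_le_Cmod (snd x)). pose proof (snd_le_Cmod (snd x)).
  destruct i as [|[|[|i]]]; simpl; lra.
Qed.

Lemma l1norm_le_coords (x : C * C) :
  l1norm x <= Rabs (coord 0 x) + Rabs (coord 1 x) + Rabs (coord 2 x) + Rabs (coord 3 x).
Proof.
  unfold l1norm, coord. pose proof (Cmod_le_parts (fst x)). pose proof (Cmod_le_parts (snd x)). lra.
Qed.

Lemma bolzano_weierstrass (u : nat -> C * C) (M : R) : (forall n, l1norm (u n) <= M) ->
  exists s l, extraction s /\ conv_V (fun n => u (s n)) l.
Proof.
  intros H.
  assert (B : forall (s : nat -> nat) i n, Rabs (coord i (u (s n))) <= M).
  { intros s i n. eapply Rle_trans; [apply coord_le|apply H]. }
  destruct (bolzano_weierstrass_R (fun n => coord 0 (u n)) M (B (fun n => n) 0%nat)) as (s0 & l0 & E0 & K0).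
  destruct (bolzano_weierstrass_R (fun n => coord 1 (u (s0 n))) M (B s0 1%nat)) as (s1 & l1 & E1 & K1).
  pose proof (extraction_comp _ _ E0 E1) as E01.
  destruct (bolzano_weierstrass_R (fun n => coord 2 (u (s0 (s1 n)))) M (B _ 2%nat)) as (s2 & l2 & E2 & K2).
  pose proof (extraction_comp _ _ E01 E2) as E012.
  destruct (bolzano_weierstrass_R (fun n => coord 3 (u (s0 (s1 (s2 n))))) M (B _ 3%nat)) as (s3 & l3 & E3 & K3).
  exists (fun n => s0 (s1 (s2 (s3 n)))), ((l0, l1), (l2, l3)).
  split; [exact (extraction_comp _ _ E012 E3)|].
  pose proof (conv_R_extract _ _ _ (extraction_comp _ _ E1 (extraction_comp _ _ E2 E3)) K0) as C0.
  pose proof (conv_R_extract _ _ _ (extraction_comp _ _ E2 E3) K1) as C1.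
  pose proof (conv_R_extract _ _ _ E3 K2) as C2'.
  intros eps He.
  destruct (C0 (eps / 4) ltac:(lra)) as [n0 N0]. destruct (C1 (eps / 4) ltac:(lra)) as [n1 N1].
  destruct (C2' (eps / 4) ltac:(lra)) as [n2 N2]. destruct (K3 (eps / 4) ltac:(lra)) as [n3 N3].
  exists (n0 + n1 + n2 + n3)%nat. intros n Hn.
  specialize (N0 n ltac:(lia)). specialize (N1 n ltac:(lia)). specialize (N2 n ltac:(lia)). specialize (N3 n ltac:(lia)).
  eapply Rle_lt_trans; [apply l1norm_le_coords|].
  set (x := u (s0 (s1 (s2 (s3 n))))) in *.
  change (Rabs (coord 0 x - l0) + Rabs (coord 1 x - l1) + Rabs (coord 2 x - l2) + Rabs (coord 3 x - l3) < eps). lra.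
Qed.

(** * Linear systems and real linear maps *)

Ltac real_eq := match goal with |- @eq _ ?u ?v => change (@eq R u v) end.

Lemma sum_n_lincomb (a b : nat -> R) (c : R) (n : nat) :
  sum_n (fun j => a j - c * b j) n = sum_n a n - c * sum_n b n.
Proof.
  induction n as [|n IH]; [rewrite !sum_O; reflexivity|].
  rewrite !sum_Sn, IH. unfold plus; simpl. ring.
Qed.

(** Elimination of the last unknown by a pivot row; without a pivot, the last unknown alone gives a
    solution. *)
Lemma homogeneous_system (n : nat) (M : nat -> nat -> R) : exists x : nat -> R,
  (exists j, (j <= n)%nat /\ x j <> 0) /\ forall i, (i < n)%nat -> sum_n (fun j => M i j * x j) n = 0.
Proof.
  revert M. induction n as [|n IH]; intros M.
  - exists (fun _ => 1). split; [exists 0%nat; split; [lia|lra]|intros; lia].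
  - destruct (classic (exists i0, (i0 < S n)%nat /\ M i0 (S n) <> 0)) as [[i0 [Hi0 Hp]]|N].
    (* The pivot row [i0] leaves the system and row [n] takes its slot, so that [n] equations
       remain. *)
    + pose (tau := fun i => if Nat.eq_dec i i0 then n else i).
      destruct (IH (fun i j => M (tau i) j - M (tau i) (S n) / M i0 (S n) * M i0 j)) as (x & [j [Hj Hx]] & Hs).
      pose (y := fun j => if Nat.eq_dec j (S n) then - sum_n (fun j => M i0 j * x j) n / M i0 (S n) else x j).
      assert (Sum : forall i, sum_n (fun j => M i j * y j) (S n)
         = sum_n (fun j => M i j * x j) n - M i (S n) / M i0 (S n) * sum_n (fun j => M i0 j * x j) n).
      { intros i. rewrite sum_Sn. unfold plus; simpl. unfold y at 2.
        destruct (Nat.eq_dec (S n) (S n)) as [_|C]; [|congruence].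
        rewrite (sum_n_ext_loc (fun j => M i j * y j) (fun j => M i j * x j)).
        - field. exact Hp.
        - intros k Hk. unfold y. destruct (Nat.eq_dec k (S n)) as [C|_]; [lia|reflexivity]. }
      exists y. split.
      * exists j. split; [lia|]. unfold y. destruct (Nat.eq_dec j (S n)) as [C|_]; [lia|exact Hx].
      * assert (Gen : forall i k, (k < n)%nat -> tau k = i -> sum_n (fun j => M i j * y j) (S n) = 0).
        { intros i k Hk <-. rewrite Sum, <- sum_n_lincomb, <- (Hs k Hk).
          apply sum_n_ext. intros q. real_eq. ring. }
        intros i Hi. destruct (Nat.eq_dec i i0) as [->|Ni].
        -- rewrite Sum. real_eq. field. exact Hp.
        -- destruct (Nat.eq_dec i n) as [->|Nn].
           ++ apply (Gen n i0); [lia|]. unfold tau. destruct (Nat.eq_dec i0 i0); [reflexivity|congruence].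
           ++ apply (Gen i i); [lia|]. unfold tau. destruct (Nat.eq_dec i i0); [congruence|reflexivity].
    + exists (fun j => if Nat.eq_dec j (S n) then 1 else 0). split.
      * exists (S n). split; [lia|]. destruct (Nat.eq_dec (S n) (S n)); [lra|congruence].
      * intros i Hi. rewrite sum_Sn. unfold plus; simpl.
        assert (M i (S n) = 0) as ->.
        { apply Classical_Prop.NNPP. intros C. apply N. now exists i. }
        rewrite (sum_n_ext_loc _ (fun _ => 0)).
        -- rewrite sum_n_const. real_eq. ring.
        -- intros k Hk. destruct (Nat.eq_dec k (S n)); [lia|real_eq; ring].
Qed.

Definition rlinear (T : C * C -> C * C) : Prop :=
  (forall x y, T (vadd x y) = vadd (T x) (T y)) /\ (forall t x, T (rscal t x) = rscal t (T x)).

Lemma rlinear_combine (T : C * C -> C * C) (f : nat -> R) (v : nat -> C * C) : rlinear T ->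
  T (combine f v) = combine f (fun i => T (v i)).
Proof. intros [H1 H2]. unfold combine. now rewrite !H1, !H2. Qed.

Lemma rlinear_vzero (T : C * C -> C * C) : rlinear T -> T vzero = vzero.
Proof. intros [_ H]. rewrite <- (rscal_0 vzero) at 1. rewrite H. apply rscal_0. Qed.

Lemma rlinear_surjective (T : C * C -> C * C) : rlinear T -> (forall x, T x = vzero -> x = vzero) ->
  forall y, exists x, T x = y.
Proof.
  intros HT Inj y.
  (* Five vectors in four real dimensions: the images of the basis, and [y] in position 4. *)
  destruct (homogeneous_system 4 (fun i j => coord i (if Nat.eq_dec j 4 then y else T (basis j)))) as (f & [j [Hj Hf]] & Hs).
  assert (Sum : vadd (combine f (fun i => T (basis i))) (rscal (f 4%nat) y) = vzero).
  { pose proof (Hs 0%nat ltac:(lia)) as E0. pose proof (Hs 1%nat ltac:(lia)) as E1.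
    pose proof (Hs 2%nat ltac:(lia)) as E2. pose proof (Hs 3%nat ltac:(lia)) as E3.
    rewrite !sum_Sn, !sum_O in E0, E1, E2, E3. unfold plus in E0, E1, E2, E3.
    cbn -[basis] in E0, E1, E2, E3. clear Hs Inj.
    unfold combine. set (a := T (basis 0)) in *. set (b := T (basis 1)) in *.
    set (c := T (basis 2)) in *. set (d := T (basis 3)) in *. clearbody a b c d.
    destruct a as [[? ?] [? ?]], b as [[? ?] [? ?]], c as [[? ?] [? ?]], d as [[? ?] [? ?]], y as [[? ?] [? ?]].
    unfold vadd, rscal, vscal, vzero, RtoC, Cmult, Cplus in *; simpl in *.
    repeat apply injective_projections; simpl; lra. }
  rewrite <- rlinear_combine in Sum by exact HT.
  destruct (Req_dec (f 4%nat) 0) as [E4|E4].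
  - exfalso. rewrite E4, rscal_0 in Sum.
    replace (vadd (T (combine f basis)) vzero) with (T (combine f basis)) in Sum by vring.
    apply Inj in Sum. unfold combine, basis, vadd, rscal, vscal, vzero, RtoC, Ci, Cmult, Cplus in Sum; simpl in Sum.
    injection Sum as A B C D.
    destruct j as [|[|[|[|[|j]]]]]; try lia; apply Hf; lra.
  - exists (rscal (- / f 4%nat) (combine f basis)). rewrite (proj2 HT).
    set (z := T (combine f basis)) in *.
    transitivity (vadd (rscal (- / f 4%nat) (vadd z (rscal (f 4%nat) y))) (rscal (/ f 4%nat * f 4%nat) y)).
    + rewrite <- rscal_mul. unfold rscal. rewrite RtoC_opp. vring.
    + rewrite Sum, Rinv_l by exact E4. vring.
Qed.

Lemma rlinear_inverse (T : C * C -> C * C) : rlinear T -> (forall x, T x = vzero -> x = vzero) ->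
  exists S, rlinear S /\ (forall x, T (S x) = x) /\ (forall x, S (T x) = x).
Proof.
  intros HT Inj.
  assert (Inj' : forall x y, T x = T y -> x = y).
  { intros x y E. assert (V : vsub x y = vzero).
    { apply Inj. replace (vsub x y) with (vadd x (rscal (-1) y)) by vring.
      rewrite (proj1 HT), (proj2 HT), E. vring. }
    transitivity (vadd (vsub x y) y); [vring|]. rewrite V. vring. }
  pose (S := fun y => epsilon (inhabits vzero) (fun x => T x = y)).
  assert (TS : forall y, T (S y) = y).
  { intros y. apply epsilon_spec. now apply rlinear_surjective. }
  exists S. repeat split.
  - intros x y. apply Inj'. now rewrite (proj1 HT), !TS.
  - intros t x. apply Inj'. now rewrite (proj2 HT), !TS.
  - exact TS.
  - intros x. apply Inj'. apply TS.
Qed.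

(* A right inverse on the basis extends to an injective linear map, hence to an inverse. *)
Lemma rlinear_injective (T : C * C -> C * C) : rlinear T -> (forall y, exists x, T x = y) ->
  forall x, T x = vzero -> x = vzero.
Proof.
  intros HT Sur x Hx.
  pose (v := fun i => epsilon (inhabits vzero) (fun x => T x = basis i)).
  assert (Hv : forall i, T (v i) = basis i) by (intros i; apply epsilon_spec, Sur).
  pose (S := fun y => combine (fun i => coord i y) v).
  assert (TS : forall y, T (S y) = y).
  { intros y. unfold S. rewrite rlinear_combine by exact HT.
    transitivity (combine (fun i => coord i y) basis); [unfold combine; now rewrite !Hv|].
    symmetry; apply basis_combine. }
  assert (HS : rlinear S).
  { split.
    - intros x1 x2. unfold S, combine. rewrite !coord_vadd. unfold rscal. rewrite !RtoC_plus. vring.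
    - intros t x1. unfold S, combine. rewrite !coord_rscal. unfold rscal. rewrite !RtoC_mult. vring. }
  destruct (rlinear_surjective S HS) with (y := x) as [y Hy].
  { intros y Hy. rewrite <- (TS y), Hy. now apply rlinear_vzero. }
  rewrite <- Hy in Hx |- *. rewrite TS in Hx. rewrite Hx. now apply rlinear_vzero.
Qed.

(** * Symmetries and the indicatrices of the metric *)

Definition diag (a b : C) (z : C * C) : C * C := ((a * fst z)%C, (b * snd z)%C).
Definition vconj (z : C * C) : C * C := (Cconj (fst z), Cconj (snd z)).

(** Agreement is asked at real parameters only: for conjugation the image disc is
    [vconj (psi (Cconj l))], which follows [S] only there. Normalized links and centred discs
    involve no other parameters. *)
Definition preserves_discs (S : C * C -> C * C) : Prop :=
  forall psi, hdisc psi -> exists psi', hdisc psi' /\ (forall t : R, psi' (RtoC t) = S (psi (RtoC t))) /\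
    forall v, hderiv psi (RtoC 0) v -> hderiv psi' (RtoC 0) (S v).

Lemma l1norm_diag (a b : C) (z : C * C) : Cmod a = 1 -> Cmod b = 1 -> l1norm (diag a b z) = l1norm z.
Proof. intros Ha Hb. unfold l1norm, diag; simpl. rewrite !Cmod_mult, Ha, Hb. ring. Qed.

Lemma l1norm_vconj (z : C * C) : l1norm (vconj z) = l1norm z.
Proof. unfold l1norm, vconj; simpl. now rewrite !Cmod_conj. Qed.

Lemma preserves_discs_diag (a b : C) : Cmod a = 1 -> Cmod b = 1 -> preserves_discs (diag a b).
Proof.
  intros Ha Hb psi Hp. exists (fun l => diag a b (psi l)).
  assert (D : forall l v, hderiv psi l v -> hderiv (fun l => diag a b (psi l)) l (diag a b v)).
  { intros l v [V1 V2]. split; simpl; now apply cderiv_cmult. }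
  split; [|split; [reflexivity|intros v; apply D]].
  intros l Hl. destruct (Hp l Hl) as [[v Hv] B]. split; [|now rewrite l1norm_diag].
  exact (ex_intro _ _ (D l v Hv)).
Qed.

Lemma preserves_discs_swap : preserves_discs swap.
Proof.
  intros psi Hp. exists (fun l => swap (psi l)).
  assert (D : forall l v, hderiv psi l v -> hderiv (fun l => swap (psi l)) l (swap v)).
  { intros l v [V1 V2]. split; assumption. }
  split; [|split; [reflexivity|intros v; apply D]].
  intros l Hl. destruct (Hp l Hl) as [[v Hv] B]. split; [|now rewrite l1norm_swap].
  exact (ex_intro _ _ (D l v Hv)).
Qed.

Lemma Cconj_RtoC (t : R) : Cconj (RtoC t) = RtoC t.
Proof. unfold Cconj, RtoC; simpl. f_equal. ring. Qed.

Lemma preserves_discs_vconj : preserves_discs vconj.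
Proof.
  intros psi Hp. exists (fun l => vconj (psi (Cconj l))).
  assert (D : forall l v, hderiv psi (Cconj l) v -> hderiv (fun l => vconj (psi (Cconj l))) l (vconj v)).
  { intros l v [V1 V2]. split; simpl.
    - exact (cderiv_conj (fun w => fst (psi w)) l _ V1).
    - exact (cderiv_conj (fun w => snd (psi w)) l _ V2). }
  split; [|split].
  - intros l Hl. destruct (Hp (Cconj l)) as [[v Hv] B]; [now rewrite Cmod_conj|].
    split; [|now rewrite l1norm_vconj]. exact (ex_intro _ _ (D l v Hv)).
  - intros t. now rewrite Cconj_RtoC.
  - intros v Hv. apply D. now rewrite Cconj_RtoC.
Qed.

Lemma preserves_discs_comp (S T : C * C -> C * C) : preserves_discs S -> preserves_discs T ->
  preserves_discs (fun z => T (S z)).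
Proof.
  intros HS HT psi Hp. destruct (HS psi Hp) as (psi1 & H1 & E1 & D1).
  destruct (HT psi1 H1) as (psi2 & H2 & E2 & D2). exists psi2. split; [exact H2|]. split.
  - intros t. now rewrite E2, E1. - intros v Hv. now apply D2, D1.
Qed.

Lemma preserves_discs_ball (S : C * C -> C * C) (z : C * C) : preserves_discs S -> l1norm z < 1 -> l1norm (S z) < 1.
Proof.
  intros HS Hz. destruct (HS (fun l => vadd z (vscal l vzero))) as (psi & Hp & E & _).
  { apply hdisc_affine; rewrite ?l1norm_vzero; lra. }
  specialize (E 0). replace (vadd z (vscal 0 vzero)) with z in E by vring. rewrite <- E.
  apply Hp. rewrite Cmod_0; lra.
Qed.

Lemma preserves_discs_kobd (S : C * C -> C * C) (z w : C * C) : preserves_discs S ->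
  l1norm z < 1 -> l1norm w < 1 -> kobd (S z) (S w) <= kobd z w.
Proof.
  intros HS Hz Hw. destruct (kobd_spec z w Hz Hw) as (_ & _ & A).
  apply le_epsilon. intros eps He. destruct (A eps He) as [s [Hs Hlt]].
  apply Rle_trans with s; [|lra].
  apply (kobd_spec (S z) (S w)); try now apply preserves_discs_ball.
  clear Hlt A Hz Hw.
  assert (G : forall z w r, segment z w r -> segment (S z) (S w) r).
  { intros a b r [Hr (psi & Hp & <- & <-)]. destruct (HS psi Hp) as (psi' & Hp' & E & _).
    split; [exact Hr|]. exists psi'. auto. }
  induction Hs as [z w r H|z u w r s H _ IH].
  - now apply chain_one, G. - apply (chain_cons _ (S u)); auto.
Qed.

Lemma preserves_discs_kobm (S : C * C -> C * C) (z X : C * C) : preserves_discs S -> rlinear S ->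
  l1norm z < 1 -> kobm (S z) (S X) <= kobm z X.
Proof.
  intros HS HL Hz. destruct (kobm_spec z X Hz) as (_ & _ & A).
  apply le_epsilon. intros eps He. destruct (A eps He) as [r [[Hr (psi & v & Hp & H0 & Hv & HX)] Hlt]].
  apply Rle_trans with r; [|lra].
  apply (kobm_spec (S z)); [now apply preserves_discs_ball|]. split; [exact Hr|].
  destruct (HS psi Hp) as (psi' & Hp' & E & D). exists psi', (S v). split; [exact Hp'|].
  split; [now rewrite E, H0|]. split; [now apply D|]. now rewrite <- (proj2 HL), HX.
Qed.

Lemma rlinear_diag (a b : C) : rlinear (diag a b).
Proof. split; intros; unfold diag; vring. Qed.

Lemma rlinear_swap : rlinear swap.
Proof. split; intros; unfold swap; vring. Qed.

Lemma rlinear_vconj : rlinear vconj.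
Proof.
  split; intros; unfold vconj, rscal, vscal, vadd; simpl;
    rewrite ?Cplus_conj, ?Cmult_conj, ?Cconj_RtoC; reflexivity.
Qed.

Lemma rlinear_comp (S T : C * C -> C * C) : rlinear S -> rlinear T -> rlinear (fun z => T (S z)).
Proof. intros [S1 S2] [T1 T2]. split; intros; [now rewrite S1, T1|now rewrite S2, T2]. Qed.

Definition disc_symmetry (S S' : C * C -> C * C) : Prop :=
  preserves_discs S /\ preserves_discs S' /\ rlinear S /\ rlinear S' /\
  (forall z, S (S' z) = z) /\ (forall z, S' (S z) = z).

Lemma disc_symmetry_kobm (S S' : C * C -> C * C) (z X : C * C) : disc_symmetry S S' ->
  l1norm z < 1 -> kobm (S z) (S X) = kobm z X.
Proof.
  intros (P & P' & L & L' & E & E') Hz. apply Rle_antisym; [now apply preserves_discs_kobm|].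
  pose proof (preserves_discs_kobm S' (S z) (S X) P' L' (preserves_discs_ball S z P Hz)) as H.
  rewrite !E' in H. exact H.
Qed.

Lemma disc_symmetry_kobd (S S' : C * C -> C * C) (z w : C * C) : disc_symmetry S S' ->
  l1norm z < 1 -> l1norm w < 1 -> kobd (S z) (S w) = kobd z w.
Proof.
  intros (P & P' & L & L' & E & E') Hz Hw. apply Rle_antisym; [now apply preserves_discs_kobd|].
  pose proof (preserves_discs_kobd S' (S z) (S w) P' (preserves_discs_ball S z P Hz) (preserves_discs_ball S w P Hw)) as H.
  rewrite !E' in H. exact H.
Qed.

Lemma unit_conj_mul (a : C) : Cmod a = 1 -> (Cconj a * a)%C = 1%C.
Proof. intros H. rewrite Cmult_comm, <- Cmod2_conj, H. now rewrite pow1. Qed.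

Lemma disc_symmetry_diag (a b : C) : Cmod a = 1 -> Cmod b = 1 ->
  disc_symmetry (diag a b) (diag (Cconj a) (Cconj b)).
Proof.
  intros Ha Hb. pose proof (unit_conj_mul a Ha) as Ea. pose proof (unit_conj_mul b Hb) as Eb.
  assert (Ea' : (a * Cconj a)%C = 1%C) by now rewrite Cmult_comm.
  assert (Eb' : (b * Cconj b)%C = 1%C) by now rewrite Cmult_comm.
  split; [now apply preserves_discs_diag|].
  split; [apply preserves_discs_diag; now rewrite Cmod_conj|].
  split; [apply rlinear_diag|]. split; [apply rlinear_diag|].
  split; intros [x y]; unfold diag; simpl; rewrite !Cmult_assoc, ?Ea, ?Eb, ?Ea', ?Eb';
    now rewrite !Cmult_1_l.
Qed.

Lemma disc_symmetry_swap : disc_symmetry swap swap.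
Proof.
  repeat split; try apply preserves_discs_swap; try apply rlinear_swap; intros [x y]; reflexivity.
Qed.

Lemma disc_symmetry_vconj : disc_symmetry vconj vconj.
Proof.
  repeat split; try apply preserves_discs_vconj; try apply rlinear_vconj;
    intros [x y]; unfold vconj; simpl; now rewrite !Cconj_conj.
Qed.

Lemma disc_symmetry_comp (S S' T T' : C * C -> C * C) : disc_symmetry S S' -> disc_symmetry T T' ->
  disc_symmetry (fun z => T (S z)) (fun z => S' (T' z)).
Proof.
  intros (P & P' & L & L' & E & E') (Q & Q' & M & M' & G & G').
  split; [now apply preserves_discs_comp|]. split; [now apply preserves_discs_comp|].
  split; [now apply rlinear_comp|]. split; [now apply rlinear_comp|].
  split; intros z; [now rewrite E, G|now rewrite G', E'].
Qed.

(* For [u = 1] this disc, [(l, 0)] and [(0, l)] satisfy [z1 + z2 = l]; so do their convex combinations. *)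
Lemma hdisc_parabolic (u : C) : Cmod u = 1 ->
  hdisc (fun l => ((u / 4 * ((1 + Cconj u * l) * (1 + Cconj u * l)))%C,
                   (- (u / 4) * ((1 - Cconj u * l) * (1 - Cconj u * l)))%C)).
Proof.
  intros Hu l Hl. split.
  - eexists (_, _). split; simpl; apply cderiv_cmult; apply cderiv_mult;
      ((apply cderiv_minus || apply cderiv_plus); [apply cderiv_const|apply cderiv_cmult, cderiv_id]).
  - unfold l1norm; simpl. rewrite !Cmod_mult, Cmod_opp.
    assert (M4 : Cmod (u / 4)%C = / 4).
    { rewrite Cmod_div, Hu, Cmod_R, Rabs_pos_eq; [field|lra|]. intros E; injection E; lra. }
    rewrite M4.
    (* Parallelogram law: the norm of the disc at [l] is [(1 + Cmod l ^ 2) / 2]. *)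
    assert (S : Cmod (1 + Cconj u * l)%C ^ 2 + Cmod (1 - Cconj u * l)%C ^ 2 = 2 + 2 * Cmod (Cconj u * l)%C ^ 2).
    { rewrite !Cmod2_alt. destruct (Cconj u * l)%C as [p q]. unfold Re, Im; simpl. ring. }
    rewrite Cmod_mult, Cmod_conj, Hu in S. pose proof (Cmod_ge_0 l). nra.
Qed.

(** * Indicatrices at points with nonnegative real coordinates *)

Definition rpt (a b : R) : C * C := (RtoC a, RtoC b).

Lemma l1norm_rpt (a b : R) : l1norm (rpt a b) = Rabs a + Rabs b.
Proof. unfold l1norm, rpt; simpl. now rewrite !Cmod_R. Qed.

Section Indicatrix.

Variables c1 c2 : R.
Hypothesis Hc1 : 0 < c1.
Hypothesis Hc2 : 0 <= c2.
Hypothesis Hx1 : c1 + c2 < 1.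
Let x := c1 + c2.
Let m := 1 - x ^ 2.
Let c := rpt c1 c2.

Lemma indicatrix_m_pos : 0 < m.
Proof. unfold m, x. nra. Qed.

Lemma indicatrix_l1norm : l1norm c = x.
Proof. unfold c. rewrite l1norm_rpt, !Rabs_pos_eq; unfold x; lra. Qed.

Lemma indicatrix_in : l1norm c < 1.
Proof. rewrite indicatrix_l1norm. unfold x; lra. Qed.

(** Singles out a face of the indicatrix: vectors with [z1 + z2 = 1] have metric at least [/ m], and
    the radial and the parabolic direction attain this value. *)
Lemma indicatrix_lin_bound (X : C * C) : Cmod (lin 1 1 X) <= kobm c X * m.
Proof.
  assert (E : Cmod (lin 1 1 c) = x).
  { unfold lin, c, rpt; simpl. rewrite !Cmult_1_l, <- RtoC_plus, Cmod_R. apply Rabs_pos_eq. unfold x; lra. }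
  unfold m. rewrite <- E.
  apply (kobm_ge (lin 1 1) (fun _ v => lin 1 1 v)).
  - apply hol_fun_lin; rewrite Cmod_1; lra.
  - intros; unfold lin, rscal, vscal; simpl; ring.
  - apply indicatrix_in.
Qed.

Lemma indicatrix_radial : kobm c (rpt (c1 / x) (c2 / x)) <= / m.
Proof.
  destruct (radial_disc c indicatrix_in) as (psi & Hp & H). destruct (H 1) as [H1 H2].
  rewrite Rmult_1_l, rscal_1, indicatrix_l1norm in *.
  assert (Hx : 0 < x) by (unfold x; lra).
  assert (M : Cmod (RtoC x) = x) by (rewrite Cmod_R, Rabs_pos_eq; lra).
  pose proof (kobm_le_deriv psi _ _ Hp ltac:(rewrite M; exact Hx1) H2) as K.
  rewrite M, H1 in K.
  replace (rpt (c1 / x) (c2 / x)) with (rscal (/ x) c); [exact K|].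
  unfold c, rpt, rscal, vscal; simpl. rewrite <- !RtoC_mult. f_equal; f_equal; field; lra.
Qed.

(** A second disc through [c] on which [z1 + z2 = l], mixing the parabolic disc with [(0, l)]; its
    velocity differs from the radial one. *)
Lemma indicatrix_parabolic : kobm c (rpt (2 * c1 / (1 + x)) (1 - 2 * c1 / (1 + x))) <= / m.
Proof.
  assert (Hx : 0 < x) by (unfold x; lra).
  (* The weight for which the first coordinate at [l = x], namely [a (1 + x)^2 / 4], equals [c1]. *)
  set (a := 4 * c1 / (1 + x) ^ 2).
  assert (Ha : 0 <= a <= 1).
  { unfold a. split; [apply Rdiv_le_0_compat; nra|].
    apply (Rmult_le_reg_r ((1 + x) ^ 2)); [nra|]. unfold Rdiv. rewrite Rmult_assoc, Rinv_l by nra.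
    assert (c1 <= x) by (unfold x; lra). nra. }
  set (chi := fun l : C => vadd vzero (vscal l (rpt 0 1))).
  assert (Hchi : hdisc chi).
  { apply hdisc_affine; rewrite ?l1norm_vzero, ?l1norm_rpt, ?Rabs_R0, ?Rabs_R1; lra. }
  pose proof (hdisc_parabolic 1 Cmod_1) as Hpar.
  set (par := fun l : C => _) in Hpar.
  pose proof (hdisc_convex par chi a (1 - a) ltac:(lra) ltac:(lra) ltac:(lra) Hpar Hchi) as Hp.
  assert (M : Cmod (RtoC x) = x) by (rewrite Cmod_R, Rabs_pos_eq; lra).
  assert (Der : hderiv par (RtoC x) (rpt ((1 + x) / 2) ((1 - x) / 2))).
  { split; unfold par; simpl; (eapply cderiv_eq; [apply cderiv_cmult, cderiv_mult;
      (apply cderiv_minus || apply cderiv_plus); [apply cderiv_const|apply cderiv_cmult, cderiv_id|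
         apply cderiv_const|apply cderiv_cmult, cderiv_id]|]);
      rewrite Cconj_RtoC; rewrite RtoC_div, ?RtoC_plus, ?RtoC_minus by lra; field. }
  pose proof (hderiv_lincomb par chi a (1 - a) (RtoC x) _ _ Der (hderiv_affine _ _ _)) as D.
  pose proof (kobm_le_deriv _ _ _ Hp ltac:(rewrite M; exact Hx1) D) as K.
  rewrite M in K. fold m in K.
  match type of K with kobm ?p ?v <= _ => replace p with c in K; [replace v with (rpt (2 * c1 / (1 + x)) (1 - 2 * c1 / (1 + x))) in K; [exact K|]|] end.
  - unfold rpt, vadd, rscal, vscal; simpl. rewrite <- !RtoC_mult, <- !RtoC_plus.
    f_equal; f_equal; unfold a; field; lra.
  - unfold c, rpt, vadd, rscal, vscal, par, chi, vzero; simpl.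
    rewrite Cconj_RtoC. rewrite <- !RtoC_div by lra.
    unfold Cminus. rewrite <- ?RtoC_opp, <- ?RtoC_mult, <- ?RtoC_plus, <- ?RtoC_opp, <- ?RtoC_plus, <- ?RtoC_mult, <- ?RtoC_plus, <- ?RtoC_mult, <- ?RtoC_plus.
    f_equal; f_equal; unfold a, x; field; lra.
Qed.

(** Obtained from [z2 / (1 - z1)]. On the face it bounds the first coordinate from below; the mirror
    image from [z1 / (1 - z2)] bounds it from above. *)
Lemma indicatrix_slice1 (p q : R) : Rabs (q * (1 - c1) + c2 * p) <= kobm c (rpt p q) * ((1 - c1) ^ 2 - c2 ^ 2).
Proof.
  pose proof (kobm_ge (slice_fun 1) (slice_fun_d 1) c (rpt p q)) as H.
  specialize (H (hol_fun_slice 1 ltac:(rewrite Cmod_1; lra))).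
  assert (P : 0 < 1 - c1) by lra.
  assert (Pn : (1 - 1 * fst c)%C = RtoC (1 - c1)) by (unfold c, rpt; simpl; rewrite Cmult_1_l, <- RtoC_minus; reflexivity).
  assert (E1 : slice_fun 1 c = RtoC (c2 / (1 - c1))).
  { unfold slice_fun. rewrite Pn. unfold c, rpt; simpl. rewrite <- RtoC_div by lra. reflexivity. }
  assert (E2 : slice_fun_d 1 c (rpt p q) = RtoC ((q * (1 - c1) + c2 * p) / ((1 - c1) * (1 - c1)))).
  { unfold slice_fun_d. rewrite Pn. unfold c, rpt; simpl.
    rewrite Cmult_1_l, <- !RtoC_mult, <- RtoC_plus, <- RtoC_div by nra. reflexivity. }
  rewrite E1, E2, !Cmod_R in H.
  specialize (H ltac:(intros; unfold slice_fun_d, rscal, vscal; simpl; unfold Cdiv; ring) indicatrix_in).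
  rewrite pow2_abs in H. unfold Rdiv in H at 1. rewrite Rabs_mult, Rabs_inv, (Rabs_pos_eq ((1 - c1) * (1 - c1))) in H by nra.
  apply (Rmult_le_compat_r ((1 - c1) * (1 - c1))) in H; [|nra].
  rewrite Rmult_assoc, Rinv_l, Rmult_1_r in H by nra.
  apply Rle_trans with (1 := H). right. field. lra.
Qed.

Lemma indicatrix_slice2 (p q : R) : Rabs (p * (1 - c2) + c1 * q) <= kobm c (rpt p q) * ((1 - c2) ^ 2 - c1 ^ 2).
Proof.
  pose proof (kobm_ge _ _ c (rpt p q) (hol_fun_swap _ _ (hol_fun_slice 1 ltac:(rewrite Cmod_1; lra)))) as H.
  cbv beta in H.
  assert (P : 0 < 1 - c2) by lra.
  assert (Pn : (1 - 1 * fst (swap c))%C = RtoC (1 - c2)) by (unfold c, rpt; simpl; rewrite Cmult_1_l, <- RtoC_minus; reflexivity).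
  assert (E1 : slice_fun 1 (swap c) = RtoC (c1 / (1 - c2))).
  { unfold slice_fun. rewrite Pn. unfold c, rpt; simpl. rewrite <- RtoC_div by lra. reflexivity. }
  assert (E2 : slice_fun_d 1 (swap c) (swap (rpt p q)) = RtoC ((p * (1 - c2) + c1 * q) / ((1 - c2) * (1 - c2)))).
  { unfold slice_fun_d. rewrite Pn. unfold c, rpt; simpl.
    rewrite Cmult_1_l, <- !RtoC_mult, <- RtoC_plus, <- RtoC_div by nra. reflexivity. }
  rewrite E1, E2, !Cmod_R in H.
  specialize (H ltac:(intros; unfold slice_fun_d, swap, rscal, vscal; simpl; unfold Cdiv; ring) indicatrix_in).
  rewrite pow2_abs in H. unfold Rdiv in H at 1. rewrite Rabs_mult, Rabs_inv, (Rabs_pos_eq ((1 - c2) * (1 - c2))) in H by nra.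
  apply (Rmult_le_compat_r ((1 - c2) * (1 - c2))) in H; [|nra].
  rewrite Rmult_assoc, Rinv_l, Rmult_1_r in H by nra.
  apply Rle_trans with (1 := H). right. field. lra.
Qed.

(** The vertical affine disc through [c], for which the slice bound is sharp. *)
Lemma indicatrix_e2 : kobm c (rpt 0 1) * ((1 - c1) ^ 2 - c2 ^ 2) <= 1 - c1.
Proof.
  set (psi := fun l : C => vadd (rpt c1 0) (vscal l (rpt 0 (1 - c1)))).
  assert (Hp : hdisc psi).
  { apply hdisc_affine; rewrite !l1norm_rpt, ?Rabs_R0, !Rabs_pos_eq; lra. }
  set (t := c2 / (1 - c1)).
  assert (Ht : 0 <= t < 1).
  { unfold t. split; [apply Rdiv_le_0_compat; lra|]. apply (Rmult_lt_reg_r (1 - c1)); [lra|].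
    unfold Rdiv. rewrite Rmult_assoc, Rinv_l; lra. }
  assert (M : Cmod (RtoC t) = t) by (rewrite Cmod_R, Rabs_pos_eq; lra).
  pose proof (kobm_le_deriv psi (RtoC t) _ Hp ltac:(rewrite M; apply Ht) (hderiv_affine _ _ _)) as K.
  rewrite M in K. replace (psi (RtoC t)) with c in K.
  2:{ unfold psi, c, rpt, vadd, vscal; simpl. rewrite <- !RtoC_mult, <- !RtoC_plus.
      f_equal; f_equal; unfold t; field; lra. }
  replace (rpt 0 (1 - c1)) with (rscal (1 - c1) (rpt 0 1)) in K.
  2:{ unfold rpt, rscal, vscal; simpl. rewrite <- !RtoC_mult. f_equal; f_equal; ring. }
  rewrite kobm_rscal, Rabs_pos_eq in K by (apply indicatrix_in || lra).
  assert (Q : 0 < 1 - t ^ 2) by nra.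
  apply (Rmult_le_compat_r (1 - t ^ 2)) in K; [|lra]. rewrite Rinv_l in K by lra.
  replace ((1 - c1) ^ 2 - c2 ^ 2) with ((1 - c1) ^ 2 * (1 - t ^ 2)) by (unfold t; field; lra).
  nra.
Qed.

(* [al] and [be] are the first coordinates of the two extreme directions, normalized by [z1 + z2 = 1],
   and [k] is the value of the metric at [e2]. *)
Lemma indicatrix_arith (al be k : R) : al <> be ->
  c1 / (1 + x) <= al <= 1 - c2 / (1 + x) -> c1 / (1 + x) <= be <= 1 - c2 / (1 + x) ->
  m * Rabs (al - be) * k = al + be ->
  k * ((1 - c1) ^ 2 - c2 ^ 2) <= 1 - c1 -> False.
Proof.
  assert (G : forall a b : R, b < a -> c1 / (1 + x) <= a <= 1 - c2 / (1 + x) ->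
     c1 / (1 + x) <= b <= 1 - c2 / (1 + x) ->
     m * (a - b) * k = a + b -> k * ((1 - c1) ^ 2 - c2 ^ 2) <= 1 - c1 -> False).
  { intros a b Hab Ha Hb E K. assert (Hx : 0 < 1 + x) by (unfold x; lra).
    assert (Hw : (a - b) * (1 + x) <= 1).
    { assert (D : a - b <= / (1 + x)).
      { apply Rle_trans with ((1 - c2 / (1 + x)) - c1 / (1 + x)); [lra|]. right. unfold x. field. unfold x in Hx. lra. }
      apply (Rmult_le_compat_r (1 + x)) in D; [|lra]. rewrite Rinv_l in D; lra. }
    assert (Hb' : c1 <= b * (1 + x)).
    { destruct Hb as [Hb _]. apply (Rmult_le_compat_r (1 + x)) in Hb; [|lra].
      unfold Rdiv in Hb. rewrite Rmult_assoc, Rinv_l in Hb; lra. }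
    (* [m * k = (a + b) / (a - b) = 1 + 2 b / (a - b)], where [b] is at least [c1 / (1 + x)] and
       [a - b] at most [1 / (1 + x)]. *)
    assert (Hmk : 1 + 2 * c1 <= m * k).
    { apply (Rmult_le_reg_l (a - b)); [lra|]. replace ((a - b) * (m * k)) with (m * (a - b) * k) by ring.
      rewrite E. assert ((a - b) * c1 <= b); [|nra].
      apply (Rmult_le_reg_r (1 + x)); [lra|].
      apply Rle_trans with (c1 * ((a - b) * (1 + x))); [right; ring|]. nra. }
    replace ((1 - c1) ^ 2 - c2 ^ 2) with ((1 - x) * (1 - c1 + c2)) in K by (unfold x; ring).
    replace m with ((1 - x) * (1 + x)) in Hmk by (unfold m; ring).
    assert (P1 : 0 < 1 - c1 + c2) by lra.
    assert ((1 + 2 * c1) * (1 - c1 + c2) <= (1 - c1) * (1 + x)).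
    { apply Rle_trans with ((1 - x) * (1 + x) * k * (1 - c1 + c2)); [apply Rmult_le_compat_r; lra|].
      apply Rle_trans with (k * ((1 - x) * (1 - c1 + c2)) * (1 + x)); [right; ring|].
      apply Rmult_le_compat_r; lra. }
    (* The left side exceeds the right one by [c1 (1 - c1 + 3 c2)], which is positive. *)
    unfold x in *. nra. }
  intros N Ha Hb E K. destruct (Rlt_le_dec be al) as [L|L].
  - rewrite Rabs_pos_eq in E by lra. now apply (G al be).
  - rewrite Rabs_left1 in E by lra. apply (G be al); auto; lra.
Qed.

Lemma Cmult_conj_re (q z : C) : fst q * fst z + snd q * snd z <= Cmod q * Cmod z.
Proof.
  rewrite <- (Cmod_conj q), <- Cmod_mult.
  eapply Rle_trans; [|apply Rle_trans with (2 := fst_le_Cmod _); apply Rle_abs].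
  simpl. right; ring.
Qed.

Lemma aligned_of_equality (q z : C) (mu : R) : 0 < mu -> Cmod q <= mu ->
  fst q * fst z + snd q * snd z = mu * Cmod z -> z = (RtoC (Cmod z / mu) * q)%C.
Proof.
  intros Hm Hq E. pose proof (Cmod_ge_0 z) as Hz. pose proof (Cmod_ge_0 q).
  assert (Eq2 : Cmod q ^ 2 = fst q ^ 2 + snd q ^ 2) by (rewrite Cmod2_alt; reflexivity).
  assert (Ez2 : Cmod z ^ 2 = fst z ^ 2 + snd z ^ 2) by (rewrite Cmod2_alt; reflexivity).
  set (r := Cmod z) in *. destruct z as [a b], q as [p s]; simpl fst in *; simpl snd in *.
  assert (S : (mu * a - r * p) ^ 2 + (mu * b - r * s) ^ 2 <= 0).
  { replace ((mu * a - r * p) ^ 2 + (mu * b - r * s) ^ 2) with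
      (mu ^ 2 * (a ^ 2 + b ^ 2) - 2 * mu * r * (p * a + s * b) + r ^ 2 * (p ^ 2 + s ^ 2)) by ring.
    rewrite <- Ez2, <- Eq2, E. assert (Cmod (p, s) ^ 2 <= mu ^ 2) by (apply pow_incr; lra).
    assert (0 <= r ^ 2) by apply pow2_ge_0. nra. }
  assert (Z1 : mu * a - r * p = 0) by (pose proof (pow2_ge_0 (mu * b - r * s)); nra).
  assert (Z2 : mu * b - r * s = 0) by (pose proof (pow2_ge_0 (mu * a - r * p)); nra).
  unfold Cmult, RtoC; simpl. f_equal; apply (Rmult_eq_reg_l mu); try lra;
    [transitivity (r * p)|transitivity (r * s)]; try lra; field; lra.
Qed.

(** For the l1 norm, a functional that attains its norm at two different points of the sphere in
    question attains it on a segment joining two extreme vectors, one in each coordinate line.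
    Pulled back, these are multiples of [(al, 1 - al)] and [(be, 1 - be)]; since [e2] is a
    combination of them, the supposed isometry prescribes its metric, and the slice bounds forbid
    the prescribed value. *)
Lemma indicatrix_not_l1 (T S : C * C -> C * C) : rlinear T -> rlinear S ->
  (forall X, T (S X) = X) -> (forall X, S (T X) = X) -> (forall Y, kobm c Y = l1norm (T Y)) -> False.
Proof.
  intros HT HS TS ST K. pose proof indicatrix_m_pos as Hm.
  assert (Hx : 0 < x < 1) by (unfold x; lra).
  set (g := fun z => fst (lin 1 1 (S z))).
  assert (Gb : forall z, g z <= m * l1norm z).
  { intros z. unfold g. apply Rle_trans with (1 := Rle_abs _). apply Rle_trans with (1 := fst_le_Cmod _).
    apply Rle_trans with (1 := indicatrix_lin_bound _). rewrite K, TS. lra. }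
  assert (Gadd : forall a b, g (vadd a b) = g a + g b).
  { intros a b. unfold g. rewrite (proj1 HS). unfold lin; simpl. ring. }
  assert (Gsc : forall t a, g (rscal t a) = t * g a).
  { intros t a. unfold g. rewrite (proj2 HS). unfold lin; simpl. ring. }
  set (q := (((g (basis 0), g (basis 1)), (g (basis 2), g (basis 3))) : C * C)).
  assert (Gq : forall z, g z = rdot q z).
  { intros z. rewrite (basis_combine z) at 1. unfold combine. rewrite !Gadd, !Gsc.
    unfold rdot, q, coord; cbn [fst snd]. ring. }
  clearbody q.
  (* The dual of the l1 norm is the maximum norm: test [g] on the first coordinate of [q] itself. *)
  assert (Q1 : Cmod (fst q) <= m).
  { pose proof (Gb (fst q, RtoC 0)) as B. rewrite Gq in B. unfold rdot, l1norm in B; simpl in B.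
    rewrite Cmod_0 in B. assert (E : Cmod (fst q) ^ 2 = fst (fst q) ^ 2 + snd (fst q) ^ 2) by (rewrite Cmod2_alt; reflexivity).
    pose proof (Cmod_ge_0 (fst q)). simpl in E.
    destruct (Req_dec (Cmod (fst q)) 0) as [Z|Z]; [lra|].
    apply (Rmult_le_reg_l (Cmod (fst q))); [lra|]. nra. }
  assert (Q2 : Cmod (snd q) <= m).
  { pose proof (Gb (RtoC 0, snd q)) as B. rewrite Gq in B. unfold rdot, l1norm in B; simpl in B.
    rewrite Cmod_0 in B. assert (E : Cmod (snd q) ^ 2 = fst (snd q) ^ 2 + snd (snd q) ^ 2) by (rewrite Cmod2_alt; reflexivity).
    pose proof (Cmod_ge_0 (snd q)). simpl in E.
    destruct (Req_dec (Cmod (snd q)) 0) as [Z|Z]; [lra|].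
    apply (Rmult_le_reg_l (Cmod (snd q))); [lra|]. nra. }
  (* Equality in both Cauchy-Schwarz estimates makes the coordinates of the image nonnegative
     multiples of those of [q]; [s] and [s'] are their moduli. *)
  assert (Face : forall a, kobm c (rpt a (1 - a)) <= / m -> exists s s',
     s + s' = / m /\ T (rpt a (1 - a)) = ((RtoC (s / m) * fst q)%C, (RtoC (s' / m) * snd q)%C) /\
     (s <> 0 -> Cmod (fst q) = m) /\ (s' <> 0 -> Cmod (snd q) = m)).
  { intros a Ha. set (z := T (rpt a (1 - a))).
    assert (Gz : g z = 1).
    { unfold g, z. rewrite ST. unfold lin, rpt; simpl. ring. }
    assert (Nz : l1norm z = / m).
    { apply Rle_antisym; [unfold z; rewrite <- K; exact Ha|].
      apply (Rmult_le_reg_l m); [exact Hm|]. rewrite Rinv_r by lra. rewrite <- Gz. apply Gb. }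
    pose proof (Cmult_conj_re (fst q) (fst z)) as C1. pose proof (Cmult_conj_re (snd q) (snd z)) as C2'.
    pose proof (Cmod_ge_0 (fst z)). pose proof (Cmod_ge_0 (snd z)).
    assert (B1 : Cmod (fst q) * Cmod (fst z) <= m * Cmod (fst z)) by (apply Rmult_le_compat_r; lra).
    assert (B2 : Cmod (snd q) * Cmod (snd z) <= m * Cmod (snd z)) by (apply Rmult_le_compat_r; lra).
    assert (Sum : rdot q z = m * Cmod (fst z) + m * Cmod (snd z)).
    { rewrite <- Gq, Gz, <- Rmult_plus_distr_l. change (1 = m * l1norm z). rewrite Nz. field. lra. }
    unfold rdot in Sum.
    assert (A1 := aligned_of_equality (fst q) (fst z) m Hm Q1 ltac:(lra)).
    assert (A2 := aligned_of_equality (snd q) (snd z) m Hm Q2 ltac:(lra)).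
    exists (Cmod (fst z)), (Cmod (snd z)). split; [exact Nz|]. split.
    - apply injective_projections; assumption.
    - split; intros Ns.
      + apply (Rmult_eq_reg_r (Cmod (fst z))); [|exact Ns]. lra.
      + apply (Rmult_eq_reg_r (Cmod (snd z))); [|exact Ns]. lra. }
  destruct (Face (c1 / x)) as (s & s' & Hs & Es & Ns & Ns').
  { replace (1 - c1 / x) with (c2 / x) by (unfold x in *; field; lra). apply indicatrix_radial. }
  destruct (Face (2 * c1 / (1 + x))) as (p & p' & Hp & Ep & Np & Np').
  { apply indicatrix_parabolic. }
  set (d := c1 / x - 2 * c1 / (1 + x)).
  assert (Hd : d <> 0).
  { unfold d. replace (c1 / x - 2 * c1 / (1 + x)) with (c1 * (1 - x) / (x * (1 + x))) by (field; lra).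
    apply Rgt_not_eq. apply Rdiv_lt_0_compat; nra. }
  assert (Hsp : s <> p).
  { intros E. assert (s' = p') by lra. subst p p'. rewrite <- Ep in Es.
    apply (f_equal S) in Es. rewrite !ST in Es. injection Es as E1 _. apply Hd. unfold d. lra. }
  assert (M1 : Cmod (fst q) = m).
  { destruct (Req_dec s 0) as [Z|Z]; [|now apply Ns]. apply Np. lra. }
  assert (M2 : Cmod (snd q) = m).
  { destruct (Req_dec s' 0) as [Z|Z]; [|now apply Ns']. apply Np'. lra. }
  (* [s] is an affine function of the position on the face: it vanishes at [be] and equals [/ m] at
     [al]. *)
  set (be := c1 / x - s * d / (s - p)).
  set (al := be + d / (m * (s - p))).
  assert (TA : T (rpt (m * al) (m * (1 - al))) = ((RtoC (/ m) * fst q)%C, RtoC 0)).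
  { replace (rpt (m * al) (m * (1 - al))) with
      (vadd (rscal ((m + (1 - m * s) / (s - p))) (rpt (c1 / x) (1 - c1 / x)))
            (rscal (- ((1 - m * s) / (s - p))) (rpt (2 * c1 / (1 + x)) (1 - 2 * c1 / (1 + x))))).
    2:{ unfold rpt, vadd, rscal, vscal; simpl. rewrite <- !RtoC_mult, <- !RtoC_plus.
        f_equal; f_equal; unfold al, be, d; field; lra. }
    rewrite (proj1 HT), !(proj2 HT), Es, Ep.
    unfold vadd, rscal, vscal; simpl. rewrite !Cmult_assoc, <- !RtoC_mult, <- !Cmult_plus_distr_r, <- !RtoC_plus.
    f_equal.
    - f_equal. f_equal. field. lra.
    - replace ((m + (1 - m * s) / (s - p)) * (s' / m) + - ((1 - m * s) / (s - p)) * (p' / m)) with 0; [ring|].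
      replace s' with (/ m - s) by lra. replace p' with (/ m - p) by lra. field. lra. }
  assert (TB : T (rpt (m * be) (m * (1 - be))) = (RtoC 0, (RtoC (/ m) * snd q)%C)).
  { replace (rpt (m * be) (m * (1 - be))) with
      (vadd (rscal ((m - m * s / (s - p))) (rpt (c1 / x) (1 - c1 / x)))
            (rscal ((m * s / (s - p))) (rpt (2 * c1 / (1 + x)) (1 - 2 * c1 / (1 + x))))).
    2:{ unfold rpt, vadd, rscal, vscal; simpl. rewrite <- !RtoC_mult, <- !RtoC_plus.
        f_equal; f_equal; unfold be, d; field; lra. }
    rewrite (proj1 HT), !(proj2 HT), Es, Ep.
    unfold vadd, rscal, vscal; simpl. rewrite !Cmult_assoc, <- !RtoC_mult, <- !Cmult_plus_distr_r, <- !RtoC_plus.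
    f_equal.
    - replace ((m - m * s / (s - p)) * (s / m) + m * s / (s - p) * (p / m)) with 0; [ring|]. field. lra.
    - f_equal. f_equal. replace s' with (/ m - s) by lra. replace p' with (/ m - p) by lra. field. lra. }
  assert (Range : forall a, kobm c (rpt (m * a) (m * (1 - a))) = 1 -> c1 / (1 + x) <= a <= 1 - c2 / (1 + x)).
  { intros a Ka. pose proof (indicatrix_slice1 (m * a) (m * (1 - a))) as B1.
    pose proof (indicatrix_slice2 (m * a) (m * (1 - a))) as B2. rewrite Ka, Rmult_1_l in B1, B2.
    apply Rle_trans with (1 := Rle_abs _) in B1. apply Rle_trans with (1 := Rle_abs _) in B2.
    replace m with ((1 - x) * (1 + x)) in B1, B2 by (unfold m; ring).
    split.
    - apply (Rmult_le_reg_r (1 + x)); [lra|]. unfold Rdiv. rewrite Rmult_assoc, Rinv_l by lra.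
      apply (Rmult_le_reg_l ((1 - x) * (1 - x))); [nra|]. unfold x in *. nra.
    - assert (c2 / (1 + x) <= 1 - a); [|lra].
      apply (Rmult_le_reg_r (1 + x)); [lra|]. unfold Rdiv. rewrite Rmult_assoc, Rinv_l by lra.
      apply (Rmult_le_reg_l ((1 - x) * (1 - x))); [nra|]. unfold x in *. nra. }
  assert (Mi : Cmod (RtoC (/ m)) = / m).
  { rewrite Cmod_R. apply Rabs_pos_eq. left; now apply Rinv_0_lt_compat. }
  assert (RA : c1 / (1 + x) <= al <= 1 - c2 / (1 + x)).
  { apply Range. rewrite K, TA. unfold l1norm; simpl. rewrite Cmod_mult, Mi, M1, Cmod_0. field. lra. }
  assert (RB : c1 / (1 + x) <= be <= 1 - c2 / (1 + x)).
  { apply Range. rewrite K, TB. unfold l1norm; simpl. rewrite Cmod_mult, Mi, M2, Cmod_0. field. lra. }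
  assert (Nab : al <> be).
  { unfold al. assert (d / (m * (s - p)) <> 0); [|lra]. unfold Rdiv. apply Rmult_integral_contrapositive_currified; [exact Hd|].
    apply Rinv_neq_0_compat. apply Rmult_integral_contrapositive_currified; lra. }
  assert (Pal : 0 <= al).
  { apply Rle_trans with (2 := proj1 RA). apply Rdiv_le_0_compat; lra. }
  assert (Pbe : 0 <= be).
  { apply Rle_trans with (2 := proj1 RB). apply Rdiv_le_0_compat; lra. }
  apply (indicatrix_arith al be (kobm c (rpt 0 1)) Nab RA RB); [|apply indicatrix_e2].
  (* Combining the two extreme directions with coefficients [al] and [- be] leaves a multiple of
     [e2], while the two images lie on different axes, so that their norms add up to [al + be]. *)
  transitivity (kobm c (rscal (m * (al - be)) (rpt 0 1))).
  { rewrite kobm_rscal by apply indicatrix_in. rewrite Rabs_mult, (Rabs_pos_eq m) by lra. reflexivity. }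
  replace (rscal (m * (al - be)) (rpt 0 1)) with
    (vadd (rscal al (rpt (m * be) (m * (1 - be)))) (rscal (- be) (rpt (m * al) (m * (1 - al))))).
  2:{ unfold rpt, vadd, rscal, vscal; simpl. rewrite <- !RtoC_mult, <- !RtoC_plus.
      f_equal; f_equal; ring. }
  rewrite K, (proj1 HT), !(proj2 HT), TA, TB. unfold l1norm, vadd, rscal, vscal; simpl.
  rewrite !Cmult_0_r, Cplus_0_l, Cplus_0_r, !Cmod_mult, Mi, M1, M2, !Cmod_R, Rabs_Ropp, !Rabs_pos_eq by assumption.
  field. lra.
Qed.

End Indicatrix.

(** * Figiel's argument for distance isometries *)

(** The swap secures [c1 > 0], without which the radial and the parabolic direction would
    coincide. *)
Lemma rotate_to_real (c : C * C) : c <> vzero -> exists c1 c2 V V',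
  0 < c1 /\ 0 <= c2 /\ c1 + c2 = l1norm c /\ disc_symmetry V V' /\ V (rpt c1 c2) = c.
Proof.
  intros Hc. destruct c as [a b].
  destruct (phase_exists a) as [u [Hu Eu]]. destruct (phase_exists b) as [v [Hv Ev]].
  pose proof (Cmod_ge_0 a). pose proof (Cmod_ge_0 b).
  destruct (Req_dec (Cmod a) 0) as [Za|Za].
  - exists (Cmod b), 0, (fun z => swap (diag v 1 z)), (fun z => diag (Cconj v) (Cconj 1) (swap z)).
    apply Cmod_eq_0 in Za. subst a.
    split.
    { destruct (Req_dec (Cmod b) 0) as [Zb|Zb]; [|lra].
      exfalso. apply Hc. apply Cmod_eq_0 in Zb. now subst b. }
    split; [lra|]. split; [unfold l1norm; simpl; rewrite Cmod_0; ring|].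
    split; [apply (disc_symmetry_comp _ _ _ _ (disc_symmetry_diag v 1 Hv Cmod_1) disc_symmetry_swap)|].
    unfold swap, diag, rpt; simpl. rewrite Ev. f_equal. ring.
  - exists (Cmod a), (Cmod b), (diag u v), (diag (Cconj u) (Cconj v)).
    split; [lra|]. split; [lra|]. split; [reflexivity|]. split; [now apply disc_symmetry_diag|].
    unfold diag, rpt; simpl. now rewrite Eu, Ev.
Qed.

Lemma kobm_l1_center (c : C * C) (T : C * C -> C * C) : l1norm c < 1 -> rlinear T ->
  (forall Y, kobm c Y = l1norm (T Y)) -> c = vzero.
Proof.
  intros Hc HT K. apply Classical_Prop.NNPP. intros Hn.
  destruct (rlinear_inverse T HT) as (S & HS & TS & ST).
  { intros X E. apply l1norm_eq_0. pose proof (kobm_ge_l1norm c X Hc) as G.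
    rewrite K, E, l1norm_vzero in G. pose proof (l1norm_pos X). lra. }
  destruct (rotate_to_real c Hn) as (c1 & c2 & V & V' & H1 & H2 & H3 & HV & EV).
  assert (Hr : l1norm (rpt c1 c2) < 1) by (rewrite l1norm_rpt, !Rabs_pos_eq; lra).
  pose proof HV as (_ & _ & LV & LV' & VV' & V'V).
  apply (indicatrix_not_l1 c1 c2 H1 H2 ltac:(lra) (fun X => T (V X)) (fun X => V' (S X))).
  - now apply rlinear_comp. - now apply rlinear_comp.
  - intros X. now rewrite VV', TS. - intros X. now rewrite ST, V'V.
  - intros Y. rewrite <- K, <- EV. symmetry. now apply (disc_symmetry_kobm V V').
Qed.

Lemma kobm_l1_center' (c : C * C) (A : C * C -> C * C) : l1norm c < 1 -> rlinear A ->
  (forall X, kobm c (A X) = l1norm X) -> c = vzero.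
Proof.
  intros Hc HA K. destruct (rlinear_inverse A HA) as (S & HS & AS & SA).
  { intros X E. apply l1norm_eq_0. rewrite <- K, E. now apply kobm_vzero. }
  apply (kobm_l1_center c S Hc HS). intros Y. rewrite <- K, AS. reflexivity.
Qed.

Lemma rdot_vsub (a x y : C * C) : rdot a (vsub x y) = rdot a x - rdot a y.
Proof. unfold rdot, vsub; simpl. ring. Qed.

Lemma rdot_rscal (a x : C * C) (t : R) : rdot a (rscal t x) = t * rdot a x.
Proof. unfold rdot, rscal, vscal; simpl. ring. Qed.

Lemma rdot_vadd (a x y : C * C) : rdot a (vadd x y) = rdot a x + rdot a y.
Proof. unfold rdot, vadd; simpl. ring. Qed.

(** Second-order expansion of the modulus at [u / 2]: the square of the right side exceeds that of
    the left by at least [Cmod b ^ 2]. Points with both coordinates of modulus 1/2 are smooth points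
    of the l1 sphere. *)
Lemma Cmod_half_sub (u b : C) : Cmod u = 1 -> Cmod b <= 1 / 4 ->
  Cmod (RtoC (/ 2) * u - b)%C <= / 2 - (fst u * fst b + snd u * snd b) + 2 * Cmod b ^ 2.
Proof.
  intros Hu Hb. pose proof (Cmult_conj_re u b) as CR. rewrite Hu in CR.
  set (t := fst u * fst b + snd u * snd b) in *.
  pose proof (Cmod_ge_0 b) as Pb.
  assert (E : Cmod (RtoC (/ 2) * u - b)%C ^ 2 = (/ 2) ^ 2 * Cmod u ^ 2 - t + Cmod b ^ 2).
  { rewrite !Cmod2_alt. unfold t. destruct u as [p q], b as [x y]. unfold Re, Im; simpl. field. }
  rewrite Hu in E. pose proof (Cmod_ge_0 (RtoC (/ 2) * u - b)%C).
  assert (T : t ^ 2 <= Cmod b ^ 2).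
  { pose proof (Cmult_conj_re (- u)%C b) as CR'. rewrite Cmod_opp, Hu in CR'. simpl in CR'.
    assert (- t <= Cmod b) by (unfold t; lra). nra. }
  set (B := Cmod b ^ 2) in *. assert (HB : 0 <= B) by apply pow2_ge_0.
  apply Rnot_lt_le. intros L. assert (0 <= / 2 - t + 2 * B) by lra.
  assert ((/ 2 - t + 2 * B) ^ 2 < Cmod (RtoC (/ 2) * u - b)%C ^ 2) by nra.
  assert (0 <= / 2 - t - / 4) by lra. nra.
Qed.

(* Figiel's argument: the functional norming [F0 (r x) - F0 (- r x)], [x = (u, v) / 2], almost
   coincides on small vectors with the derivative of the source norm at [x]. *)
Lemma figiel_functional (E : C * C -> R) (F0 : C * C -> C * C) (u v : C) (eta r : R) :
  sublinear E -> 0 < eta <= / 4 -> 0 < r -> F0 vzero = vzero -> Cmod u = 1 -> Cmod v = 1 ->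
  (forall z w, l1norm z <= r -> l1norm w <= r ->
     Rabs (E (vsub (F0 z) (F0 w)) - l1norm (vsub z w)) <= eta ^ 2 * l1norm (vsub z w)) ->
  exists a, (forall Y, rdot a Y <= E Y) /\
    forall z, l1norm z <= 1 ->
      Rabs (rdot a (F0 (rscal (r * eta) z)) - r * eta * rdot (u, v) z) <= 9 * eta * (r * eta).
Proof.
  intros HE Heta Hr H0 Hu Hv H.
  set (x := ((RtoC (/ 2) * u)%C, (RtoC (/ 2) * v)%C)).
  assert (Nx : l1norm x = 1).
  { unfold x, l1norm; simpl. rewrite !Cmod_mult, Hu, Hv, Cmod_R, Rabs_pos_eq by lra. field. }
  set (xp := rscal r x). set (xm := rscal (- r) x).
  assert (Np : l1norm xp = r) by (unfold xp; rewrite l1norm_rscal, Nx, Rabs_pos_eq; lra).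
  assert (Nm : l1norm xm = r) by (unfold xm; rewrite l1norm_rscal, Nx, Rabs_left; lra).
  destruct (hahn_banach E (vsub (F0 xp) (F0 xm)) HE) as (a & Ha & Ea).
  exists a. split; [exact Ha|]. intros z Hz.
  set (y := rscal (r * eta) z). set (d := rdot (u, v) z).
  assert (Bound : forall p q, l1norm p <= r -> l1norm q <= r ->
    rdot a (F0 p) - rdot a (F0 q) <= (1 + eta ^ 2) * l1norm (vsub p q)).
  { intros p q Hp Hq. rewrite <- rdot_vsub. apply Rle_trans with (1 := Ha _).
    pose proof (H p q Hp Hq) as K. apply Rabs_le_between in K. lra. }
  pose proof (Cmod_ge_0 (fst z)) as P1. pose proof (Cmod_ge_0 (snd z)) as P2.
  assert (Near : forall w, l1norm w <= 1 -> l1norm (vsub x (rscal eta w)) <= 1 - eta * rdot (u, v) w + 2 * eta ^ 2).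
  { intros w Hw. unfold l1norm in Hw.
    pose proof (Cmod_ge_0 (fst w)) as W1. pose proof (Cmod_ge_0 (snd w)) as W2.
    assert (M : forall q : C, Cmod (RtoC eta * q)%C = eta * Cmod q) by (intros; rewrite Cmod_mult, Cmod_R, Rabs_pos_eq; lra).
    pose proof (Cmod_half_sub u (RtoC eta * fst w)%C Hu ltac:(rewrite M; nra)) as B1.
    pose proof (Cmod_half_sub v (RtoC eta * snd w)%C Hv ltac:(rewrite M; nra)) as B2.
    rewrite M in B1, B2.
    apply Rle_trans with (1 := Rplus_le_compat _ _ _ _ B1 B2).
    unfold rdot; cbn [fst snd]. simpl.
    assert (Cmod (fst w) ^ 2 + Cmod (snd w) ^ 2 <= 1) by nra.
    assert (eta ^ 2 * (Cmod (fst w) ^ 2 + Cmod (snd w) ^ 2) <= eta ^ 2 * 1) by (apply Rmult_le_compat_l; nra).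
    simpl in *. lra. }
  assert (D1 : l1norm (vsub xp y) <= r * (1 - eta * d + 2 * eta ^ 2)).
  { replace (vsub xp y) with (rscal r (vsub x (rscal eta z))).
    - rewrite l1norm_rscal, Rabs_pos_eq by lra. apply Rmult_le_compat_l; [lra|]. now apply Near.
    - unfold xp, y. rewrite <- rscal_mul. vring. }
  assert (D2 : l1norm (vsub y xm) <= r * (1 + eta * d + 2 * eta ^ 2)).
  { replace (vsub y xm) with (rscal r (vsub x (rscal eta (rscal (-1) z)))).
    - rewrite l1norm_rscal, Rabs_pos_eq by lra. apply Rmult_le_compat_l; [lra|].
      replace (1 + eta * d + 2 * eta ^ 2) with (1 - eta * rdot (u, v) (rscal (-1) z) + 2 * eta ^ 2)
        by (rewrite rdot_rscal; unfold d; ring).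
      apply Near. rewrite l1norm_rscal, Rabs_left; lra.
    - unfold xm, y. rewrite <- rscal_mul. replace (- r) with (r * -1) by ring. rewrite <- rscal_mul. vring. }
  assert (Ny : l1norm y <= r).
  { unfold y. rewrite l1norm_rscal, Rabs_pos_eq by nra. pose proof (l1norm_pos z).
    apply Rle_trans with (r * eta * 1); [apply Rmult_le_compat_l; nra|nra]. }
  assert (Nz : l1norm vzero <= r) by (rewrite l1norm_vzero; lra).
  (* The functional [a] is nearly saturated between the images of [r x] and [- r x]. The two bounds
     through [y] and the two through 0 therefore confine [rdot a (F0 y)] to an interval of length of
     order [r * eta ^ 2]. *)
  pose proof (Bound xp y ltac:(lra) Ny) as B1. pose proof (Bound y xm Ny ltac:(lra)) as B2.
  pose proof (Bound xp vzero ltac:(lra) Nz) as B3. pose proof (Bound vzero xm Nz ltac:(lra)) as B4.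
  replace (vsub xp vzero) with xp in B3 by vring.
  rewrite l1norm_vsub_sym in B4. replace (vsub xm vzero) with xm in B4 by vring.
  rewrite H0 in B3, B4. rewrite Np in B3. rewrite Nm in B4.
  assert (Z0 : rdot a vzero = 0) by (unfold rdot, vzero; simpl; ring). rewrite Z0 in B3, B4.
  assert (B5 : (1 - eta ^ 2) * (2 * r) <= rdot a (F0 xp) - rdot a (F0 xm)).
  { rewrite <- rdot_vsub, Ea. pose proof (H xp xm ltac:(lra) ltac:(lra)) as K.
    replace (vsub xp xm) with (rscal (2 * r) x) in K.
    - rewrite l1norm_rscal, Nx, (Rabs_pos_eq (2 * r)) in K by lra. apply Rabs_le_between in K. lra.
    - unfold xp, xm, rscal. rewrite RtoC_opp, RtoC_mult. vring. }
  assert (Dd : Rabs d <= 1).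
  { unfold d, rdot; cbn [fst snd]. unfold l1norm in Hz.
    pose proof (Cmult_conj_re u (fst z)) as T1. pose proof (Cmult_conj_re v (snd z)) as T2.
    pose proof (Cmult_conj_re (- u)%C (fst z)) as T3. pose proof (Cmult_conj_re (- v)%C (snd z)) as T4.
    rewrite Hu in T1. rewrite Hv in T2. rewrite Cmod_opp, Hu in T3. rewrite Cmod_opp, Hv in T4.
    simpl in T3, T4.
    apply Rabs_le. lra. }
  apply Rabs_le_between in Dd.
  set (t := rdot a (F0 y)) in *. set (A := rdot a (F0 xp)) in *. set (B := rdot a (F0 xm)) in *.
  assert (Exp : forall e, -1 <= e <= 1 -> (1 + eta ^ 2) * (r * (1 + eta * e + 2 * eta ^ 2)) <= r * (1 + eta * e + 4 * eta ^ 2)).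
  { intros e He. replace ((1 + eta ^ 2) * (r * (1 + eta * e + 2 * eta ^ 2))) with
     (r * (1 + eta * e + 2 * eta ^ 2 + eta ^ 2 * (1 + eta * e + 2 * eta ^ 2))) by ring.
    apply Rmult_le_compat_l; [lra|].
    assert (eta * e <= / 4) by nra. assert (eta ^ 2 <= / 16) by nra.
    assert (eta ^ 2 * (1 + eta * e + 2 * eta ^ 2) <= eta ^ 2 * 2) by (apply Rmult_le_compat_l; nra). lra. }
  assert (Q : 0 <= 1 + eta ^ 2) by nra.
  pose proof (Rmult_le_compat_l _ _ _ Q D1) as D1'. pose proof (Rmult_le_compat_l _ _ _ Q D2) as D2'.
  pose proof (Exp d Dd) as X2. pose proof (Exp (- d) ltac:(lra)) as X1.
  replace (1 + eta * - d) with (1 - eta * d) in X1 by ring.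
  apply Rabs_le. split; nra.
Qed.

Lemma sublinear_kobm (c : C * C) : l1norm c < 1 -> sublinear (kobm c).
Proof.
  intros Hc. split; [intros; now apply kobm_vadd|].
  intros t x Ht. rewrite kobm_rscal, Rabs_pos_eq; auto.
Qed.

Lemma vsub_eq_vzero (a b : C * C) : vsub a b = vzero -> a = b.
Proof. intros H. transitivity (vadd (vsub a b) b); [vring|]. rewrite H. vring. Qed.

Lemma vzero_in : l1norm vzero < 1.
Proof. rewrite l1norm_vzero. lra. Qed.

Section Blowup.

Variable F : C * C -> C * C.
Hypothesis F_ball : forall z, l1norm z < 1 -> l1norm (F z) < 1.
Hypothesis F_iso : forall z w, l1norm z < 1 -> l1norm w < 1 -> kobd (F z) (F w) = kobd z w.

Let c := F vzero.
Let F0 := fun z => vsub (F z) c.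

Lemma blowup_c_in : l1norm c < 1.
Proof. apply F_ball, vzero_in. Qed.

Lemma blowup_F_near (rho : R) : 0 < rho -> exists r, 0 < r < 1 /\
  forall z, l1norm z < r -> l1norm (vsub (F z) c) < rho.
Proof.
  intros Hr. exists (Rmin (/ 2) (rho / 2)). split.
  { split; [apply Rmin_pos; lra|]. pose proof (Rmin_l (/ 2) (rho / 2)). lra. }
  intros z Hz. pose proof (Rmin_l (/ 2) (rho / 2)). pose proof (Rmin_r (/ 2) (rho / 2)).
  assert (Nz : l1norm z < 1) by lra. pose proof (l1norm_pos z).
  apply Rle_lt_trans with (1 := kobd_ge_l1_sub c (F z) blowup_c_in (F_ball z Nz)).
  unfold c. rewrite F_iso by (auto; apply vzero_in). rewrite kobd_vzero by exact Nz.
  apply Rle_lt_trans with (1 := artanh_upper (l1norm z) ltac:(lra)).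
  apply (Rmult_lt_reg_r (1 - l1norm z)); [lra|]. unfold Rdiv. rewrite Rmult_assoc, Rinv_l by lra. nra.
Qed.

(** Near a point the distance is asymptotic to the metric frozen at that point, both at 0 and at
    [c]; this replaces differentiability of [F]. *)
Lemma blowup_near_isometry (eps : R) : 0 < eps <= 1 -> exists r, 0 < r < 1 /\
  forall z w, l1norm z <= r -> l1norm w <= r ->
    Rabs (kobm c (vsub (F0 z) (F0 w)) - l1norm (vsub z w)) <= eps * l1norm (vsub z w).
Proof.
  (* The comparison constant enters once at 0 and once at [c]; it suffices that [s * s] is at least
     [1 - eps / 2] and that [(1 - eps / 2) * (1 + eps)] is at least 1. *)
  intros He. set (s := 1 - eps / 4). assert (Hs : 0 < s < 1) by (unfold s; lra).
  destruct (kobd_near_lower c s blowup_c_in Hs) as [r1 [R1 K1]].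
  destruct (kobd_near_upper c s blowup_c_in Hs) as [r2 [R2 K2]].
  destruct (kobd_near_lower vzero s vzero_in Hs) as [r3 [R3 K3]].
  destruct (kobd_near_upper vzero s vzero_in Hs) as [r4 [R4 K4]].
  destruct (blowup_F_near (Rmin r1 r2)) as [r5 [R5 K5]]; [now apply Rmin_pos|].
  set (r := Rmin r5 (Rmin r3 r4) / 2).
  assert (Pr : 0 < Rmin r5 (Rmin r3 r4)) by (repeat apply Rmin_pos; lra).
  pose proof (Rmin_l r5 (Rmin r3 r4)). pose proof (Rmin_r r5 (Rmin r3 r4)).
  pose proof (Rmin_l r3 r4). pose proof (Rmin_r r3 r4). pose proof (Rmin_l r1 r2). pose proof (Rmin_r r1 r2).
  exists r. split; [unfold r; lra|]. intros z w Hz Hw.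
  assert (Vz : forall p, vsub p vzero = p) by (intros; vring).
  assert (Ez : kobm c (vsub (F0 z) (F0 w)) = kobm c (vsub (F w) (F z))).
  { rewrite kobm_vsub_sym by apply blowup_c_in. f_equal. unfold F0. vring. }
  rewrite Ez, (l1norm_vsub_sym z w).
  assert (Nz : l1norm z < r5) by (unfold r in *; lra). assert (Nw : l1norm w < r5) by (unfold r in *; lra).
  pose proof (K5 z Nz). pose proof (K5 w Nw).
  pose proof (K1 (F z) (F w) ltac:(lra) ltac:(lra)) as U1. pose proof (K2 (F z) (F w) ltac:(lra) ltac:(lra)) as U2.
  pose proof (K3 z w ltac:(rewrite Vz; unfold r in *; lra) ltac:(rewrite Vz; unfold r in *; lra)) as U3.
  pose proof (K4 z w ltac:(rewrite Vz; unfold r in *; lra) ltac:(rewrite Vz; unfold r in *; lra)) as U4.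
  rewrite kobm_at_vzero in U3, U4. rewrite F_iso in U1, U2 by lra.
  set (E := kobm c (vsub (F w) (F z))) in *. set (N := l1norm (vsub w z)) in *.
  assert (HN : 0 <= N) by apply l1norm_pos.
  assert (S2 : 1 - eps / 2 <= s * s) by (unfold s; nra).
  apply Rabs_le. split.
  - assert (s * s * N <= E) by (apply (Rmult_le_compat_l s) in U3; lra). nra.
  - assert (s * s * E <= N) by (apply (Rmult_le_compat_l s) in U1; lra). assert (0 <= E) by (apply kobm_pos, blowup_c_in).
    assert ((1 - eps / 2) * E <= N) by nra.
    assert (E <= (1 + eps) * N); [|lra].
    apply (Rmult_le_reg_l (1 - eps / 2)); [lra|].
    assert (P : 1 <= (1 - eps / 2) * (1 + eps)) by nra.
    apply (Rmult_le_compat_r N) in P; lra.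
Qed.

(** Two scales: the isometry defect is [eta ^ 2] relative to vectors of size [r], and [F0] is
    examined on vectors of size [r * eta], where this becomes a relative error of order [eta]. The
    four functionals have unimodular entries, as smooth points require, and together determine all
    real coordinates. *)
Lemma blowup_step (n : nat) : exists (sg : R) (a : (C * C) * (C * C) * ((C * C) * (C * C))),
  let eta := / (INR n + 4) in
  0 < sg <= eta /\
  (forall Y, rdot (fst (fst a)) Y <= kobm c Y /\ rdot (snd (fst a)) Y <= kobm c Y /\
             rdot (fst (snd a)) Y <= kobm c Y /\ rdot (snd (snd a)) Y <= kobm c Y) /\
  forall z, l1norm z <= 1 -> let Y := rscal (/ sg) (F0 (rscal sg z)) in
    Rabs (rdot (fst (fst a)) Y - rdot (RtoC 1, RtoC 1) z) <= 9 * eta /\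
    Rabs (rdot (snd (fst a)) Y - rdot (RtoC 1, (- RtoC 1)%C) z) <= 9 * eta /\
    Rabs (rdot (fst (snd a)) Y - rdot (Ci, Ci) z) <= 9 * eta /\
    Rabs (rdot (snd (snd a)) Y - rdot (Ci, (- Ci)%C) z) <= 9 * eta /\
    Rabs (kobm c Y - l1norm z) <= eta.
Proof.
  set (eta := / (INR n + 4)). pose proof (pos_INR n).
  assert (Heta : 0 < eta <= / 4).
  { unfold eta. split; [apply Rinv_0_lt_compat; lra|]. apply Rinv_le_contravar; lra. }
  destruct (blowup_near_isometry (eta ^ 2)) as [r [Hr K]]; [split; nra|].
  assert (Z0 : F0 vzero = vzero) by (unfold F0; apply vsub_diag).
  assert (Fig : forall u v, Cmod u = 1 -> Cmod v = 1 -> exists a, (forall Y, rdot a Y <= kobm c Y) /\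
     forall z, l1norm z <= 1 ->
      Rabs (rdot a (rscal (/ (r * eta)) (F0 (rscal (r * eta) z))) - rdot (u, v) z) <= 9 * eta).
  { intros u v Hu Hv.
    destruct (figiel_functional (kobm c) F0 u v eta r (sublinear_kobm c blowup_c_in) Heta ltac:(lra) Z0 Hu Hv K) as (a & A1 & A2).
    exists a. split; [exact A1|]. intros z Hz. specialize (A2 z Hz).
    assert (P : 0 < r * eta) by nra. rewrite rdot_rscal.
    apply (Rmult_le_reg_l (r * eta)); [exact P|].
    rewrite <- (Rabs_pos_eq (r * eta)) at 1 by lra. rewrite <- Rabs_mult.
    replace (r * eta * (/ (r * eta) * rdot a (F0 (rscal (r * eta) z)) - rdot (u, v) z)) with
      (rdot a (F0 (rscal (r * eta) z)) - r * eta * rdot (u, v) z) by (field; lra). lra. }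
  pose proof Cmod_1 as M1. pose proof Cmod_Ci as Mi.
  assert (M1' : Cmod (- RtoC 1)%C = 1) by now rewrite Cmod_opp.
  assert (Mi' : Cmod (- Ci)%C = 1) by now rewrite Cmod_opp.
  destruct (Fig _ _ M1 M1) as (a0 & A0 & B0). destruct (Fig _ _ M1 M1') as (a1 & A1 & B1).
  destruct (Fig _ _ Mi Mi) as (a2 & A2 & B2). destruct (Fig _ _ Mi Mi') as (a3 & A3 & B3).
  exists (r * eta), ((a0, a1), (a2, a3)). cbv zeta. cbn [fst snd].
  split; [nra|]. split; [auto|]. intros z Hz. repeat split; auto.
  assert (P : 0 < r * eta) by nra.
  assert (N1 : l1norm (rscal (r * eta) z) <= r).
  { rewrite l1norm_rscal, Rabs_pos_eq by lra. pose proof (l1norm_pos z). nra. }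
  pose proof (K (rscal (r * eta) z) vzero N1 ltac:(rewrite l1norm_vzero; lra)) as Kz. rewrite Z0 in Kz.
  replace (vsub (F0 (rscal (r * eta) z)) vzero) with (F0 (rscal (r * eta) z)) in Kz by vring.
  replace (vsub (rscal (r * eta) z) vzero) with (rscal (r * eta) z) in Kz by vring.
  rewrite l1norm_rscal, (Rabs_pos_eq (r * eta)) in Kz by lra.
  rewrite kobm_rscal by apply blowup_c_in. rewrite (Rabs_pos_eq (/ (r * eta))) by (left; now apply Rinv_0_lt_compat).
  apply (Rmult_le_reg_l (r * eta)); [exact P|].
  rewrite <- (Rabs_pos_eq (r * eta)) at 1 by lra. rewrite <- Rabs_mult.
  replace (r * eta * (/ (r * eta) * kobm c (F0 (rscal (r * eta) z)) - l1norm z)) with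
    (kobm c (F0 (rscal (r * eta) z)) - r * eta * l1norm z) by (field; lra).
  apply Rle_trans with (1 := Kz). pose proof (l1norm_pos z). assert (eta ^ 2 * l1norm z <= eta) by nra. nra.
Qed.

End Blowup.

Lemma coord_rdot_basis (i : nat) (a : C * C) : coord i a = rdot a (basis i).
Proof. destruct i as [|[|[|i]]]; unfold rdot, coord, basis; simpl; ring. Qed.

(** Supplies the bound needed to extract limits of the norming functionals. *)
Lemma functional_bounded (c a : C * C) : l1norm c < 1 -> (forall Y, rdot a Y <= kobm c Y) ->
  l1norm a <= 4 / (1 - l1norm c).
Proof.
  intros Hc H.
  assert (B : forall i, Rabs (coord i a) <= / (1 - l1norm c)).
  { intros i. rewrite coord_rdot_basis.
    assert (Nb : l1norm (basis i) = 1).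
    { destruct i as [|[|[|i]]]; unfold l1norm, basis; simpl; rewrite Cmod_0, ?Cmod_1, ?Cmod_Ci; ring. }
    apply Rabs_le. split.
    - pose proof (H (rscal (-1) (basis i))) as T. rewrite rdot_rscal in T.
      pose proof (kobm_upper c (rscal (-1) (basis i)) Hc) as U.
      rewrite l1norm_rscal, Nb, Rabs_left in U by lra. unfold Rdiv in U. lra.
    - pose proof (H (basis i)) as T. pose proof (kobm_upper c (basis i) Hc) as U.
      rewrite Nb in U. unfold Rdiv in U. lra. }
  apply Rle_trans with (1 := l1norm_le_coords a).
  pose proof (B 0%nat). pose proof (B 1%nat). pose proof (B 2%nat). pose proof (B 3%nat). unfold Rdiv. lra.
Qed.

Lemma rdot_le (a x : C * C) : Rabs (rdot a x) <= l1norm a * l1norm x.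
Proof.
  unfold rdot, l1norm.
  assert (A : forall p q : C, Rabs (fst p * fst q + snd p * snd q) <= Cmod p * Cmod q).
  { intros p q. pose proof (Cmult_conj_re p q) as T1. pose proof (Cmult_conj_re (- p)%C q) as T2.
    rewrite Cmod_opp in T2. simpl in T2. apply Rabs_le. lra. }
  pose proof (A (fst a) (fst x)). pose proof (A (snd a) (snd x)).
  pose proof (Cmod_ge_0 (fst a)). pose proof (Cmod_ge_0 (snd a)).
  pose proof (Cmod_ge_0 (fst x)). pose proof (Cmod_ge_0 (snd x)).
  set (P := fst (fst a) * fst (fst x) + snd (fst a) * snd (fst x)) in *.
  replace (P + fst (snd a) * fst (snd x) + snd (snd a) * snd (snd x)) with
    (P + (fst (snd a) * fst (snd x) + snd (snd a) * snd (snd x))) by ring.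
  eapply Rle_trans; [apply Rabs_triang|]. nra.
Qed.

(* Recovers a vector [z] from [Re z1 + Re z2], [Re z1 - Re z2], [Im z1 + Im z2], [Im z1 - Im z2]. *)
Definition assemble (a : (C * C) * (C * C) * ((C * C) * (C * C))) (Y : C * C) : C * C :=
  ((((rdot (fst (fst a)) Y + rdot (snd (fst a)) Y) / 2), ((rdot (fst (snd a)) Y + rdot (snd (snd a)) Y) / 2)),
   (((rdot (fst (fst a)) Y - rdot (snd (fst a)) Y) / 2), ((rdot (fst (snd a)) Y - rdot (snd (snd a)) Y) / 2))).

Lemma rlinear_assemble a : rlinear (assemble a).
Proof.
  split; intros; unfold assemble; rewrite ?rdot_vadd, ?rdot_rscal; unfold vadd, rscal, vscal, RtoC; simpl;
    repeat apply injective_projections; simpl; field.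
Qed.

Lemma assemble_near a Y z (e : R) :
  Rabs (rdot (fst (fst a)) Y - rdot (RtoC 1, RtoC 1) z) <= e ->
  Rabs (rdot (snd (fst a)) Y - rdot (RtoC 1, (- RtoC 1)%C) z) <= e ->
  Rabs (rdot (fst (snd a)) Y - rdot (Ci, Ci) z) <= e ->
  Rabs (rdot (snd (snd a)) Y - rdot (Ci, (- Ci)%C) z) <= e ->
  l1norm (vsub (assemble a Y) z) <= 4 * e.
Proof.
  intros H0 H1 H2 H3. apply Rle_trans with (1 := l1norm_le_coords _).
  unfold rdot at 2 in H0. unfold rdot at 2 in H1. unfold rdot at 2 in H2. unfold rdot at 2 in H3.
  unfold Ci in H2, H3. simpl in H0, H1, H2, H3. unfold coord, vsub, assemble; simpl.
  apply Rabs_le_between in H0. apply Rabs_le_between in H1. apply Rabs_le_between in H2. apply Rabs_le_between in H3.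
  repeat match goal with |- context [Rabs ?x] =>
    let H := fresh in assert (H : Rabs x <= e) by (apply Rabs_le; lra);
    let y := fresh in set (y := Rabs x) in *; clearbody y end. lra.
Qed.

(** [T], assembled from limits of the norming functionals, satisfies [T (Y z n) -> z]. Convergence
    of [Y z n] itself is not known at first: its cluster points only show that each [z] has a
    preimage of metric [l1norm z]. Finite dimension then makes [T] bijective, after which the
    convergence follows. *)
Lemma kobd_isometry_blowup (F : C * C -> C * C) :
  (forall z, l1norm z < 1 -> l1norm (F z) < 1) ->
  (forall z w, l1norm z < 1 -> l1norm w < 1 -> kobd (F z) (F w) = kobd z w) ->
  F vzero = vzero /\ exists U sg, rlinear U /\ (forall z, l1norm (U z) = l1norm z) /\
    (forall n, 0 < sg n < 1) /\
    forall z, l1norm z <= 1 -> conv_V (fun n => rscal (/ sg n) (F (rscal (sg n) z))) (U z).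
Proof.
  intros F_ball F_iso.
  set (c := F vzero). assert (Hc : l1norm c < 1) by apply F_ball, vzero_in.
  destruct (choice _ (blowup_step F F_ball F_iso)) as [sg Hsg].
  destruct (choice _ Hsg) as [a Ha]. clear Hsg. cbv zeta in Ha. fold c in Ha.
  set (F0 := fun z => vsub (F z) c) in Ha.
  set (K := 4 / (1 - l1norm c)).
  assert (Bd : forall n, l1norm (fst (fst (a n))) <= K /\ l1norm (snd (fst (a n))) <= K /\
     l1norm (fst (snd (a n))) <= K /\ l1norm (snd (snd (a n))) <= K).
  { intros n. destruct (Ha n) as (_ & B & _).
    repeat split; apply functional_bounded; auto; intros Y; apply (B Y). }
  destruct (bolzano_weierstrass (fun n => fst (fst (a n))) K) as (s0 & b0 & E0 & K0); [intros; apply Bd|].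
  destruct (bolzano_weierstrass (fun n => snd (fst (a (s0 n)))) K) as (s1 & b1 & E1 & K1); [intros; apply Bd|].
  destruct (bolzano_weierstrass (fun n => fst (snd (a (s0 (s1 n))))) K) as (s2 & b2 & E2 & K2); [intros; apply Bd|].
  destruct (bolzano_weierstrass (fun n => snd (snd (a (s0 (s1 (s2 n)))))) K) as (s3 & b3 & E3 & K3); [intros; apply Bd|].
  set (s := fun n => s0 (s1 (s2 (s3 n)))).
  pose proof (extraction_comp _ _ E2 E3) as E23. pose proof (extraction_comp _ _ E1 E23) as E123.
  pose proof (extraction_comp _ _ E0 E123) as Es. change (extraction s) in Es.
  pose proof (conv_V_extract _ _ _ E123 K0) as C0. pose proof (conv_V_extract _ _ _ E23 K1) as C1.
  pose proof (conv_V_extract _ _ _ E3 K2) as C2'. rename K3 into C3. clear K0 K1 K2.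
  set (b := ((b0, b1), (b2, b3))). set (T := assemble b).
  assert (HT : rlinear T) by apply rlinear_assemble.
  set (Y := fun z n => rscal (/ sg (s n)) (F0 (rscal (sg (s n)) z))).
  assert (Eta : conv_R (fun n => / (INR (s n) + 4)) 0).
  { intros eps He. destruct (archimed_cor1 eps He) as [N [HN HN0]]. exists N. intros n Hn.
    assert (N <= s n)%nat by (pose proof (extraction_ge s Es n); lia).
    apply lt_0_INR in HN0. apply le_INR in H. rewrite Rminus_0_r, Rabs_pos_eq.
    - apply Rle_lt_trans with (2 := HN). apply Rinv_le_contravar; lra.
    - left. apply Rinv_0_lt_compat. lra. }
  assert (EY : forall z, l1norm z <= 1 -> conv_R (fun n => kobm c (Y z n)) (l1norm z)).
  { intros z Hz eps He. destruct (Eta eps He) as [N HN]. exists N. intros n Hn.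
    specialize (HN n Hn). rewrite Rminus_0_r in HN. apply Rle_lt_trans with (2 := HN).
    apply Rle_trans with (2 := Rle_abs _). apply (Ha (s n)); exact Hz. }
  assert (YB : forall z n, l1norm z <= 1 -> l1norm (Y z n) <= 2).
  { intros z n Hz. apply Rle_trans with (1 := kobm_ge_l1norm c _ Hc).
    destruct (Ha (s n)) as (_ & _ & A). destruct (A z Hz) as (_ & _ & _ & _ & A5).
    change (Rabs (kobm c (Y z n) - l1norm z) <= / (INR (s n) + 4)) in A5.
    apply Rabs_le_between in A5. pose proof (pos_INR (s n)).
    assert (/ (INR (s n) + 4) <= / 1) by (apply Rinv_le_contravar; lra). lra. }
  assert (TY : forall z, l1norm z <= 1 -> conv_V (fun n => T (Y z n)) z).
  { intros z Hz eps He.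
    destruct (Eta (eps / 100) ltac:(lra)) as [N HN].
    destruct (C0 (eps / 100) ltac:(lra)) as [n0 N0]. destruct (C1 (eps / 100) ltac:(lra)) as [n1 N1].
    destruct (C2' (eps / 100) ltac:(lra)) as [n2 N2]. destruct (C3 (eps / 100) ltac:(lra)) as [n3 N3].
    exists (N + n0 + n1 + n2 + n3)%nat. intros n Hn.
    specialize (HN n ltac:(lia)). specialize (N0 n ltac:(lia)). specialize (N1 n ltac:(lia)).
    specialize (N2 n ltac:(lia)). specialize (N3 n ltac:(lia)).
    rewrite Rminus_0_r in HN. apply Rle_lt_trans with (1 := Rle_abs _) in HN.
    destruct (Ha (s n)) as (_ & _ & A). destruct (A z Hz) as (A1 & A2 & A3 & A4 & _).
    fold (Y z n) in A1, A2, A3, A4. change (s0 (s1 (s2 (s3 n)))) with (s n) in N0, N1, N2, N3.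
    assert (Sw : forall al be d, l1norm (vsub al be) < eps / 100 -> Rabs (rdot al (Y z n) - d) <= 9 * / (INR (s n) + 4) ->
      Rabs (rdot be (Y z n) - d) <= 12 * (eps / 100)).
    { intros al be d D1 D2. replace (rdot be (Y z n) - d) with
        ((rdot al (Y z n) - d) + - rdot (vsub al be) (Y z n)) by (unfold rdot, vsub; simpl; ring).
      eapply Rle_trans; [apply Rabs_triang|]. rewrite Rabs_Ropp.
      pose proof (rdot_le (vsub al be) (Y z n)). pose proof (YB z n Hz). pose proof (l1norm_pos (Y z n)).
      pose proof (l1norm_pos (vsub al be)). nra. }
    apply Rle_lt_trans with (4 * (12 * (eps / 100))); [|lra].
    apply assemble_near; eapply Sw; eassumption. }
  assert (Sur1 : forall z, l1norm z <= 1 -> exists X, T X = z /\ kobm c X = l1norm z).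
  { intros z Hz. destruct (bolzano_weierstrass (Y z) 2) as (t & X & Et & Kt); [intros; now apply YB|].
    exists X. split.
    - assert (Z : l1norm (vsub (T X) z) = 0); [|now apply vsub_eq_vzero, l1norm_eq_0].
      apply Rle_antisym; [|apply l1norm_pos]. apply le_epsilon. intros eps He.
      pose proof (conv_V_extract _ _ _ Et (TY z Hz)) as Ct.
      destruct (Ct (eps / 2) ltac:(lra)) as [m0 M0].
      set (L := l1norm b0 + l1norm b1 + l1norm b2 + l1norm b3 + 1).
      pose proof (l1norm_pos b0). pose proof (l1norm_pos b1). pose proof (l1norm_pos b2). pose proof (l1norm_pos b3).
      destruct (Kt (eps / (16 * L))) as [m1 M1]; [apply Rdiv_lt_0_compat; unfold L; lra|].
      specialize (M0 (m0 + m1)%nat ltac:(lia)). specialize (M1 (m0 + m1)%nat ltac:(lia)).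
      set (W := Y z (t (m0 + m1)%nat)) in *.
      pose proof (l1norm_vsub_triangle (T X) (T W) z) as Tr.
      assert (TL : l1norm (vsub (T X) (T W)) <= 4 * (2 * L * l1norm (vsub W X))).
      { apply Rle_trans with (1 := l1norm_le_coords _).
        pose proof (l1norm_pos (vsub W X)) as PW.
        assert (Q : forall g, Rabs (rdot g X - rdot g W) <= l1norm g * l1norm (vsub W X)).
        { intros g. rewrite <- rdot_vsub, (l1norm_vsub_sym W X). apply rdot_le. }
        pose proof (Q b0) as Q0. pose proof (Q b1) as Q1. pose proof (Q b2) as Q2. pose proof (Q b3) as Q3.
        set (w := l1norm (vsub W X)) in *.
        assert (G0 : l1norm b0 * w <= L * w) by (apply Rmult_le_compat_r; unfold L; lra).
        assert (G1 : l1norm b1 * w <= L * w) by (apply Rmult_le_compat_r; unfold L; lra).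
        assert (G2 : l1norm b2 * w <= L * w) by (apply Rmult_le_compat_r; unfold L; lra).
        assert (G3 : l1norm b3 * w <= L * w) by (apply Rmult_le_compat_r; unfold L; lra).
        apply Rabs_le_between in Q0. apply Rabs_le_between in Q1. apply Rabs_le_between in Q2. apply Rabs_le_between in Q3.
        unfold coord, vsub, T, assemble, b; cbn [fst snd]. simpl.
        repeat match goal with |- context [Rabs ?x] =>
          let H := fresh in assert (H : Rabs x <= 2 * L * w) by (apply Rabs_le; lra);
          let y := fresh in set (y := Rabs x) in *; clearbody y end. lra. }
      assert (TL2 : 4 * (2 * L * l1norm (vsub W X)) <= eps / 2).
      { apply (Rmult_lt_compat_l (8 * L)) in M1; [|unfold L; lra].
        replace (8 * L * (eps / (16 * L))) with (eps / 2) in M1 by (field; unfold L; lra). lra. }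
      lra.
    - pose proof (conv_R_extract _ _ _ Et (EY z Hz)) as Ct.
      apply Rminus_diag_uniq.
      assert (Z : Rabs (kobm c X - l1norm z) <= 0); [|pose proof (Rabs_pos (kobm c X - l1norm z)); apply Rabs_le_between in Z; lra].
      apply le_epsilon. intros eps He. rewrite Rplus_0_l.
      destruct (Ct (eps / 2) ltac:(lra)) as [m0 M0].
      destruct (Kt (eps / 2 * (1 - l1norm c))) as [m1 M1]; [nra|].
      specialize (M0 (m0 + m1)%nat ltac:(lia)). specialize (M1 (m0 + m1)%nat ltac:(lia)).
      set (W := Y z (t (m0 + m1)%nat)) in *.
      pose proof (kobm_upper c (vsub W X) Hc) as U.
      assert (U' : l1norm (vsub W X) / (1 - l1norm c) <= eps / 2).
      { apply (Rmult_le_reg_r (1 - l1norm c)); [lra|]. unfold Rdiv at 1. rewrite Rmult_assoc, Rinv_l; lra. }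
      pose proof (kobm_vadd c (vsub W X) X Hc) as T1. replace (vadd (vsub W X) X) with W in T1 by vring.
      pose proof (kobm_vadd c (vsub X W) W Hc) as T2. replace (vadd (vsub X W) W) with X in T2 by vring.
      rewrite (kobm_vsub_sym c X W Hc) in T2.
      apply Rabs_def2 in M0. apply Rabs_le. lra. }
  assert (Sur : forall z, exists X, T X = z /\ kobm c X = l1norm z).
  { intros z. pose proof (l1norm_pos z). set (k := l1norm z + 1).
    assert (Pk : 0 < / k) by (apply Rinv_0_lt_compat; unfold k; lra).
    destruct (Sur1 (rscal (/ k) z)) as (X & X1 & X2).
    { rewrite l1norm_rscal, Rabs_pos_eq by lra. apply (Rmult_le_reg_l k); [unfold k; lra|].
      rewrite <- Rmult_assoc, Rinv_r; unfold k; lra. }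
    exists (rscal k X). split.
    - rewrite (proj2 HT), X1, rscal_mul, Rinv_r, rscal_1; [reflexivity|unfold k; lra].
    - rewrite kobm_rscal, X2, l1norm_rscal by exact Hc.
      rewrite !Rabs_pos_eq by (unfold k in *; lra). field. unfold k; lra. }
  assert (Inj : forall x, T x = vzero -> x = vzero).
  { apply rlinear_injective; [exact HT|]. intros y. destruct (Sur y) as (X & HX & _). now exists X. }
  destruct (rlinear_inverse T HT Inj) as (U & HU & TU & UT).
  (* By injectivity every vector is the preimage found above for its own image. *)
  assert (KT : forall X, kobm c X = l1norm (T X)).
  { intros X. destruct (Sur (T X)) as (X' & H1 & H2). rewrite <- H2. f_equal.
    rewrite <- (UT X), <- (UT X'). now rewrite H1. }
  assert (c0 : c = vzero) by now apply (kobm_l1_center c T).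
  split; [exact c0|].
  assert (NU : forall z, l1norm (U z) = l1norm z).
  { intros z. rewrite <- kobm_at_vzero, <- c0, KT, TU. reflexivity. }
  exists U, (fun n => sg (s n)). split; [exact HU|]. split; [exact NU|]. split.
  - intros n. destruct (Ha (s n)) as (A & _). pose proof (pos_INR (s n)).
    assert (/ (INR (s n) + 4) < / 1) by (apply Rinv_lt_contravar; lra). lra.
  - intros z Hz eps He. destruct (TY z Hz eps He) as [N HN]. exists N. intros n Hn. specialize (HN n Hn).
    assert (EF : rscal (/ sg (s n)) (F (rscal (sg (s n)) z)) = Y z n).
    { unfold Y, F0. rewrite c0. f_equal. vring. }
    (* [Y z n - U z] is the image under [U] of [T (Y z n) - z], and [U] preserves the norm. *)
    rewrite EF. rewrite <- (NU (vsub (T (Y z n)) z)) in HN.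
    replace (vsub (Y z n) (U z)) with (U (vsub (T (Y z n)) z)); [exact HN|].
    replace (vsub (T (Y z n)) z) with (vadd (T (Y z n)) (rscal (-1) z)) by vring.
    rewrite (proj1 HU), (proj2 HU), UT. vring.
Qed.

(** * Rigidity of non-expanding maps with a linear blow-up *)

Lemma RtoC_inj' (a b : R) : RtoC a = RtoC b -> a = b.
Proof. intros H. now injection H. Qed.

Lemma re_eq_Cmod (z : C) : fst z = Cmod z -> z = RtoC (Cmod z).
Proof.
  intros H. pose proof (Cmod2_alt z) as E. unfold Re, Im in E. rewrite <- H in E |- *.
  destruct z as [a b]; simpl in *. unfold RtoC. f_equal. nra.
Qed.

(** Equality case of the triangle inequality for 0, [zeta] and [N] in the Poincare disc: [zeta] must
    lie on the radius. *)
Lemma disc_point_determined (zeta : C) (tau N : R) : 0 <= tau -> tau <= N -> 0 < N < 1 ->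
  Cmod zeta = tau -> Cmod (mob zeta (RtoC N)) <= (N - tau) / (1 - tau * N) -> zeta = RtoC tau.
Proof.
  intros Ht HtN HN Hz H. rewrite <- Hz. apply re_eq_Cmod. rewrite Hz.
  assert (MN : Cmod (RtoC N) = N) by (rewrite Cmod_R, Rabs_pos_eq; lra).
  assert (Nd : (1 - Cconj zeta * RtoC N)%C <> 0%C) by (apply mob_den; lra).
  pose proof (mob_identity zeta (RtoC N)) as I. rewrite MN, Hz in I.
  unfold mob in H. rewrite Cmod_div in H by exact Nd.
  apply Cmod_gt_0 in Nd. set (d := Cmod (1 - Cconj zeta * RtoC N)%C) in *.
  set (e := Cmod (RtoC N - zeta)%C) in *.
  assert (He : 0 <= e) by apply Cmod_ge_0.
  assert (P : 0 < 1 - tau * N) by nra.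
  assert (H1 : e * (1 - tau * N) <= (N - tau) * d).
  { apply (Rmult_le_compat_r (d * (1 - tau * N))) in H; [|nra].
    replace (e / d * (d * (1 - tau * N))) with (e * (1 - tau * N)) in H by (field; lra).
    replace ((N - tau) / (1 - tau * N) * (d * (1 - tau * N))) with ((N - tau) * d) in H by (field; lra). exact H. }
  assert (H2 : e ^ 2 * (1 - tau * N) ^ 2 <= (N - tau) ^ 2 * d ^ 2).
  { rewrite <- !Rpow_mult_distr. apply pow_incr. split; [nra|exact H1]. }
  (* The inequality [Cmod (1 - Cconj zeta * N) <= 1 - tau * N] forces the real part of [zeta] up to
     [tau]. *)
  assert (H3 : d ^ 2 <= (1 - tau * N) ^ 2).
  { assert (E : e ^ 2 = d ^ 2 - (1 - tau ^ 2) * (1 - N ^ 2)) by lra. rewrite E in H2.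
    assert (Q : 0 < (1 - tau ^ 2) * (1 - N ^ 2)) by (apply Rmult_lt_0_compat; nra).
    apply (Rmult_le_reg_l ((1 - tau ^ 2) * (1 - N ^ 2))); [exact Q|].
    replace ((N - tau) ^ 2) with ((1 - tau * N) ^ 2 - (1 - tau ^ 2) * (1 - N ^ 2)) in H2 by ring. nra. }
  pose proof (Cmod2_alt (1 - Cconj zeta * RtoC N)%C) as D. fold d in D.
  pose proof (Cmod2_alt zeta) as Z. rewrite Hz in Z. pose proof (re_le_Cmod zeta) as R1. rewrite Hz in R1.
  apply Rle_trans with (1 := Rle_abs _) in R1.
  destruct zeta as [p q]. unfold Re, Im in *. simpl in *. nra.
Qed.

(* By the last field a coordinate of [U z] vanishes where that of [F z] does and otherwise has the same
   argument: choose [u1], [u2] so that [u1 z1 + u2 z2] attains its maximum on the sphere at [F z]. *)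
Record rigid (F U : C * C -> C * C) : Prop := {
  rigid_ball : forall z, l1norm z < 1 -> l1norm (F z) < 1;
  rigid_nonexp : forall z w, l1norm z < 1 -> l1norm w < 1 -> kobd (F z) (F w) <= kobd z w;
  rigid_norm : forall z, l1norm z < 1 -> l1norm (F z) = l1norm z;
  rigid_lin : rlinear U;
  rigid_unorm : forall z, l1norm (U z) = l1norm z;
  rigid_align : forall z, l1norm z < 1 -> forall u1 u2, Cmod u1 = 1 -> Cmod u2 = 1 ->
    lin u1 u2 (F z) = RtoC (l1norm z) -> lin u1 u2 (U z) = RtoC (l1norm z) }.

Lemma lin_vsub (u1 u2 : C) (x y : C * C) : lin u1 u2 (vsub x y) = (lin u1 u2 x - lin u1 u2 y)%C.
Proof. unfold lin, vsub; simpl. ring. Qed.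

Lemma lin_rscal (u1 u2 : C) (t : R) (x : C * C) : lin u1 u2 (rscal t x) = (RtoC t * lin u1 u2 x)%C.
Proof. unfold lin, rscal, vscal; simpl. ring. Qed.

(* [F] maps radial segments from [0] to geodesics from [0]; along these the coordinates keep
   their arguments, hence they have the arguments of the coordinates of the blow-up [U]. *)
Lemma rigid_of_blowup (F U : C * C -> C * C) (sg : nat -> R) :
  (forall z, l1norm z < 1 -> l1norm (F z) < 1) ->
  (forall z w, l1norm z < 1 -> l1norm w < 1 -> kobd (F z) (F w) <= kobd z w) ->
  (forall z, l1norm z < 1 -> l1norm (F z) = l1norm z) ->
  rlinear U -> (forall z, l1norm (U z) = l1norm z) -> (forall n, 0 < sg n < 1) ->
  (forall z, l1norm z <= 1 -> conv_V (fun n => rscal (/ sg n) (F (rscal (sg n) z))) (U z)) ->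
  rigid F U.
Proof.
  intros FB FN FI UL UN Hsg Hc. constructor; auto.
  intros z Hz u1 u2 Hu1 Hu2 E.
  destruct (Req_dec (l1norm z) 0) as [Z|Z].
  { apply l1norm_eq_0 in Z. subst z. rewrite rlinear_vzero by exact UL. rewrite l1norm_vzero.
    unfold lin, vzero; simpl. ring. }
  pose proof (l1norm_pos z). set (N := l1norm z) in *.
  assert (Step : forall n, lin u1 u2 (rscal (/ sg n) (F (rscal (sg n) z))) = RtoC N).
  { intros n. specialize (Hsg n). set (s := sg n) in *. set (tau := s * N).
    assert (Ht : 0 <= tau <= N) by (unfold tau; nra).
    assert (Ns : l1norm (rscal s z) = tau) by (rewrite l1norm_rscal, Rabs_pos_eq by lra; reflexivity).
    assert (Hs : l1norm (rscal s z) < 1) by lra.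
    set (zeta := lin u1 u2 (F (rscal s z))).
    assert (D : kobd (F (rscal s z)) (F z) <= artanh N - artanh tau).
    { apply Rle_trans with (1 := FN _ _ Hs Hz).
      pose proof (kobd_radial z s 1 Hz ltac:(lra) ltac:(lra) ltac:(lra)) as K.
      rewrite rscal_1, Rmult_1_l in K. exact K. }
    assert (HL : hol_fun (lin u1 u2) (fun _ v => lin u1 u2 v)) by (apply hol_fun_lin; lra).
    assert (MN : Cmod (RtoC N) = N) by (rewrite Cmod_R, Rabs_pos_eq; lra).
    assert (Zt : Cmod zeta <= tau).
    { unfold zeta. rewrite <- Ns, <- FI by exact Hs. apply lin_le; lra. }
    (* The upper bound comes from preservation of the norm; the lower one holds because [zeta] is
       within [artanh N - artanh tau] of [N]. *)
    assert (Zz : Cmod zeta = tau).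
    { apply Rle_antisym; [exact Zt|].
      pose proof (kobd_ge_artanh _ _ (F (rscal s z)) (F z) HL (FB _ Hs) (FB _ Hz)) as B.
      fold zeta in B. rewrite E, MN in B. apply artanh_le_inv; [lra|apply Cmod_ge_0|lra]. }
    assert (Ez : zeta = RtoC tau).
    { apply (disc_point_determined zeta tau N); try lra.
      pose proof (kobd_ge_mob _ _ (F (rscal s z)) (F z) HL (FB _ Hs) (FB _ Hz)) as B.
      fold zeta in B. rewrite E in B.
      assert (Pd : 0 < 1 - tau * N) by nra.
      assert (R : 0 <= (N - tau) / (1 - tau * N) < 1).
      { split; [apply Rdiv_le_0_compat; lra|]. apply (Rmult_lt_reg_r (1 - tau * N)); [lra|].
        unfold Rdiv. rewrite Rmult_assoc, Rinv_l by lra. nra. }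
      pose proof (artanh_add ((N - tau) / (1 - tau * N)) tau R ltac:(lra)) as A.
      replace (((N - tau) / (1 - tau * N) + tau) / (1 + (N - tau) / (1 - tau * N) * tau)) with N in A.
      2:{ field. split; nra. }
      apply artanh_le_inv.
      - split; [apply Cmod_ge_0|]. apply mob_lt_1; lra.
      - lra.
      - lra. }
    rewrite lin_rscal. fold zeta. rewrite Ez. unfold tau. rewrite <- RtoC_mult. f_equal. field. lra. }
  assert (L0 : Cmod (lin u1 u2 (U z) - RtoC N)%C = 0).
  { apply Rle_antisym; [|apply Cmod_ge_0]. apply le_epsilon. intros eps He.
    destruct (Hc z ltac:(unfold N in *; lra) eps He) as [n0 K]. specialize (K n0 (le_n _)).
    rewrite <- (Step n0), <- lin_vsub.
    apply Rle_trans with (l1norm (vsub (U z) (rscal (/ sg n0) (F (rscal (sg n0) z))))); [apply lin_le; lra|].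
    rewrite l1norm_vsub_sym. lra. }
  apply Cmod_eq_0 in L0. replace (lin u1 u2 (U z)) with ((lin u1 u2 (U z) - RtoC N) + RtoC N)%C by ring.
  rewrite L0. ring.
Qed.

Lemma phase_conj_exists (q : C) : exists u, Cmod u = 1 /\ (u * q)%C = RtoC (Cmod q).
Proof.
  destruct (phase_exists q) as [u [Hu Eu]]. exists (Cconj u).
  rewrite Cmod_conj. split; [exact Hu|]. rewrite <- Eu at 1.
  rewrite Cmult_assoc, unit_conj_mul by exact Hu. ring.
Qed.

Lemma lin_equality (u1 u2 : C) (z : C * C) : Cmod u1 = 1 -> Cmod u2 = 1 -> lin u1 u2 z = RtoC (l1norm z) ->
  (u1 * fst z)%C = RtoC (Cmod (fst z)) /\ (u2 * snd z)%C = RtoC (Cmod (snd z)).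
Proof.
  intros H1 H2 E. unfold lin, l1norm in E.
  assert (M1 : Cmod (u1 * fst z)%C = Cmod (fst z)) by (rewrite Cmod_mult, H1; ring).
  assert (M2 : Cmod (u2 * snd z)%C = Cmod (snd z)) by (rewrite Cmod_mult, H2; ring).
  pose proof (re_le_Cmod (u1 * fst z)%C) as B1. pose proof (re_le_Cmod (u2 * snd z)%C) as B2.
  apply Rle_trans with (1 := Rle_abs _) in B1. apply Rle_trans with (1 := Rle_abs _) in B2.
  rewrite M1 in B1. rewrite M2 in B2. unfold Re in *.
  assert (S : fst (u1 * fst z)%C + fst (u2 * snd z)%C = Cmod (fst z) + Cmod (snd z)).
  { apply (f_equal (fun w : C => fst w)) in E. exact E. }
  split; [rewrite <- M1|rewrite <- M2]; apply re_eq_Cmod; [rewrite M1|rewrite M2]; lra.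
Qed.

(** Equality of arguments written without division, so that vanishing coordinates need no separate
    case. *)
Lemma rigid_coordinates (F U : C * C -> C * C) (z : C * C) : rigid F U -> l1norm z < 1 ->
  (fst (F z) * RtoC (Cmod (fst (U z))))%C = (RtoC (Cmod (fst (F z))) * fst (U z))%C /\
  (snd (F z) * RtoC (Cmod (snd (U z))))%C = (RtoC (Cmod (snd (F z))) * snd (U z))%C.
Proof.
  intros R Hz. destruct (phase_conj_exists (fst (F z))) as [u1 [H1 E1]].
  destruct (phase_conj_exists (snd (F z))) as [u2 [H2 E2]].
  assert (L : lin u1 u2 (F z) = RtoC (l1norm z)).
  { rewrite <- (rigid_norm _ _ R z Hz). unfold lin, l1norm. now rewrite E1, E2, RtoC_plus. }
  pose proof (rigid_align _ _ R z Hz u1 u2 H1 H2 L) as L'. rewrite <- (rigid_unorm _ _ R z) in L'.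
  destruct (lin_equality u1 u2 (U z) H1 H2 L') as [A1 A2].
  rewrite <- A1, <- A2, <- E1, <- E2. split; ring.
Qed.

(** * Maps acting on each coordinate by rotation or reflection *)

Definition cj (k : bool) (z : C) : C := if k then Cconj z else z.

Definition normal_map (o1 o2 : C) (k1 k2 : bool) (z : C * C) : C * C :=
  ((o1 * cj k1 (fst z))%C, (o2 * cj k2 (snd z))%C).

Lemma Cmod_cj (k : bool) (z : C) : Cmod (cj k z) = Cmod z.
Proof. destruct k; simpl; [apply Cmod_conj|reflexivity]. Qed.

Lemma cj_cj (k : bool) (z : C) : cj k (cj k z) = z.
Proof. destruct k; simpl; [apply Cconj_conj|reflexivity]. Qed.

Lemma rigid_ext (F U V : C * C -> C * C) : (forall z, U z = V z) -> rigid F U -> rigid F V.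
Proof.
  intros E [A1 A2 A3 [B1 B2] C' D]. constructor; auto.
  - split; intros; rewrite <- !E; auto.
  - intros; rewrite <- E; auto.
  - intros; rewrite <- E; eauto.
Qed.

Lemma lin_swap (u1 u2 : C) (z : C * C) : lin u1 u2 (swap z) = lin u2 u1 z.
Proof. unfold lin, swap; simpl. ring. Qed.

Lemma kobd_swap (z w : C * C) : l1norm z < 1 -> l1norm w < 1 -> kobd (swap z) (swap w) = kobd z w.
Proof. apply (disc_symmetry_kobd swap swap). apply disc_symmetry_swap. Qed.

Lemma rigid_swap_l (F U : C * C -> C * C) : rigid F U -> rigid (fun z => swap (F z)) (fun z => swap (U z)).
Proof.
  intros R. pose proof (rigid_ball _ _ R) as FB. constructor.
  - intros z Hz. rewrite l1norm_swap. auto.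
  - intros z w Hz Hw. rewrite kobd_swap by auto. now apply (rigid_nonexp _ _ R).
  - intros z Hz. rewrite l1norm_swap. now apply (rigid_norm _ _ R).
  - apply rlinear_comp; [apply (rigid_lin _ _ R)|apply rlinear_swap].
  - intros z. rewrite l1norm_swap. apply (rigid_unorm _ _ R).
  - intros z Hz u1 u2 H1 H2. rewrite !lin_swap. now apply (rigid_align _ _ R).
Qed.

Lemma rigid_swap_r (F U : C * C -> C * C) : rigid F U -> rigid (fun z => F (swap z)) (fun z => U (swap z)).
Proof.
  intros R. pose proof (rigid_ball _ _ R) as FB.
  constructor.
  - intros z Hz. apply FB. now rewrite l1norm_swap.
  - intros z w Hz Hw. rewrite <- (kobd_swap z w) by auto. apply (rigid_nonexp _ _ R); now rewrite l1norm_swap.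
  - intros z Hz. rewrite (rigid_norm _ _ R) by now rewrite l1norm_swap. apply l1norm_swap.
  - apply rlinear_comp; [apply rlinear_swap|apply (rigid_lin _ _ R)].
  - intros z. rewrite (rigid_unorm _ _ R). apply l1norm_swap.
  - intros z Hz u1 u2 H1 H2. rewrite <- (l1norm_swap z). apply (rigid_align _ _ R); auto. now rewrite l1norm_swap.
Qed.

Section NormalForm.

Variables o1 o2 : C.
Variables k1 k2 : bool.
Hypothesis Ho1 : Cmod o1 = 1.
Hypothesis Ho2 : Cmod o2 = 1.

(** A nonzero second coordinate at [(z1, 0)] would survive a small perturbation. But the
    perturbation can be chosen so that the second coordinate of the linear model points in the
    opposite direction, and alignment then turns that of [F] around as well. *)
Lemma rigid_axis (F : C * C -> C * C) (z1 : C) : rigid F (normal_map o1 o2 k1 k2) -> Cmod z1 < 1 ->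
  snd (F (z1, RtoC 0)) = 0%C.
Proof.
  intros R Hz1. apply Classical_Prop.NNPP. intros Nf. set (f := snd (F (z1, RtoC 0))) in *.
  assert (Pf : 0 < Cmod f) by now apply Cmod_gt_0.
  assert (Nz : l1norm (z1, RtoC 0) < 1) by (unfold l1norm; simpl; rewrite Cmod_0; lra).
  destruct (phase_exists f) as [p [Hp Ep]].
  (* The perturbation moves [F] by at most [2 * y0], which is less than [Cmod f]. *)
  set (y0 := Rmin (/ 2) (Cmod f / 3)).
  assert (Y0 : 0 < y0) by (apply Rmin_pos; lra).
  assert (Y1 : y0 <= / 2) by apply Rmin_l. assert (Y2 : y0 <= Cmod f / 3) by apply Rmin_r.
  set (e := y0 * (1 - Cmod z1)). assert (Pe : 0 < e) by (unfold e; nra).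
  (* Solves [o2 * cj k2 y = - p], opposite to the phase of [f]. *)
  set (y := cj k2 (- (Cconj o2 * p))%C).
  assert (My : Cmod y = 1) by (unfold y; rewrite Cmod_cj, Cmod_opp, Cmod_mult, Cmod_conj, Ho2, Hp; ring).
  set (z' := (z1, (RtoC e * y)%C)).
  assert (Dz : l1norm (vsub z' (z1, RtoC 0)) = e).
  { unfold l1norm, vsub, z'; simpl. replace (z1 - z1)%C with (RtoC 0) by ring.
    replace (RtoC e * y - 0)%C with (RtoC e * y)%C by ring.
    rewrite Cmod_0, Cmod_mult, My, Cmod_R, Rabs_pos_eq; lra. }
  assert (N0 : l1norm (z1, RtoC 0) = Cmod z1) by (unfold l1norm; simpl; rewrite Cmod_0; ring).
  destruct (kobd_local (z1, RtoC 0) z' Nz) as [Nz' K]; [rewrite Dz, N0; unfold e; nra|].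
  rewrite Dz, N0 in K. replace (e / (1 - Cmod z1)) with y0 in K by (unfold e; field; lra).
  pose proof (rigid_ball _ _ R) as FB.
  assert (Cl : l1norm (vsub (F z') (F (z1, RtoC 0))) <= 2 * y0).
  { apply Rle_trans with (1 := kobd_ge_l1_sub _ _ (FB _ Nz) (FB _ Nz')).
    apply Rle_trans with (1 := rigid_nonexp _ _ R _ _ Nz Nz'). apply Rle_trans with (1 := K).
    apply Rle_trans with (1 := artanh_upper y0 ltac:(lra)).
    apply (Rmult_le_reg_r (1 - y0)); [lra|]. unfold Rdiv. rewrite Rmult_assoc, Rinv_l by lra. nra. }
  destruct (rigid_coordinates _ _ z' R Nz') as [_ A].
  assert (U2 : snd (normal_map o1 o2 k1 k2 z') = (- (RtoC e * p))%C).
  { unfold normal_map, z'; simpl.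
    replace (cj k2 (RtoC e * y)) with (RtoC e * cj k2 y)%C.
    - unfold y. rewrite cj_cj. transitivity (- (RtoC e * ((Cconj o2 * o2) * p)))%C; [ring|].
      rewrite unit_conj_mul by exact Ho2. ring.
    - destruct k2; simpl; [rewrite Cmult_conj, Cconj_RtoC|]; reflexivity. }
  rewrite U2, Cmod_opp, Cmod_mult, Hp, Cmod_R, Rabs_pos_eq in A by lra.
  set (g := snd (F z')) in *.
  assert (Eg : g = (- (RtoC (Cmod g) * p))%C).
  { assert (En : RtoC e <> 0%C) by (intros Q; apply RtoC_inj' in Q; lra).
    transitivity (g * RtoC (e * 1) / RtoC e)%C; [rewrite Rmult_1_r; field; exact En|].
    rewrite A. field. exact En. }
  assert (B : Cmod (g - f)%C <= 2 * y0).
  { apply Rle_trans with (2 := Cl). unfold l1norm, vsub; simpl. fold g f.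
    pose proof (Cmod_ge_0 (fst (F z') - fst (F (z1, RtoC 0)))%C). lra. }
  assert (B' : Cmod (g - f)%C = Cmod g + Cmod f).
  { rewrite Eg at 1. rewrite <- Ep at 1.
    replace (- (RtoC (Cmod g) * p) - p * RtoC (Cmod f))%C with (- (p * (RtoC (Cmod g) + RtoC (Cmod f))))%C by ring.
    rewrite Cmod_opp, Cmod_mult, Hp, <- RtoC_plus, Cmod_R, Rabs_pos_eq.
    - ring. - pose proof (Cmod_ge_0 g). lra. }
  pose proof (Cmod_ge_0 g). lra.
Qed.

(** Compares distances to the first axis: an affine disc bounds that of [z] from above, and a slice
    function bounds that of [F z] from below since [F a] stays on the axis. As the norms agree, the
    quotients of [Cmod snd] by [1 - Cmod fst] are ordered like the numerators. *)
Lemma rigid_snd_le (F : C * C -> C * C) (z : C * C) : rigid F (normal_map o1 o2 k1 k2) -> l1norm z < 1 ->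
  Cmod (snd (F z)) <= Cmod (snd z).
Proof.
  intros R Hz. pose proof (rigid_ball _ _ R) as FB. pose proof (rigid_norm _ _ R z Hz) as NZ.
  pose proof (Cmod_ge_0 (fst z)). pose proof (Cmod_ge_0 (snd z)).
  pose proof (Cmod_ge_0 (fst (F z))). pose proof (Cmod_ge_0 (snd (F z))).
  set (a := (fst z, RtoC 0)).
  assert (Na : l1norm a = Cmod (fst z)) by (unfold a, l1norm; simpl; rewrite Cmod_0; ring).
  assert (Ha : l1norm a < 1) by (unfold l1norm in Hz; lra).
  assert (Dz : l1norm (vsub z a) = Cmod (snd z)).
  { unfold a, l1norm, vsub; simpl. replace (fst z - fst z)%C with (RtoC 0) by ring.
    replace (snd z - 0)%C with (snd z) by ring. rewrite Cmod_0. ring. }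
  destruct (kobd_local a z Ha) as [_ K]; [rewrite Dz, Na; unfold l1norm in Hz; lra|].
  rewrite Dz, Na in K.
  destruct (phase_conj_exists (fst (F z))) as [th [Hth Eth]].
  assert (HG : hol_fun (slice_fun th) (slice_fun_d th)) by (apply hol_fun_slice; lra).
  pose proof (kobd_ge_artanh _ _ (F a) (F z) HG (FB _ Ha) (FB _ Hz)) as L.
  assert (G0 : slice_fun th (F a) = 0%C).
  { unfold slice_fun, a. rewrite rigid_axis by (auto; unfold l1norm in Hz; lra). unfold Cdiv. ring. }
  rewrite G0, Cmod_0, artanh_0 in L.
  assert (NF : Cmod (fst (F z)) + Cmod (snd (F z)) = Cmod (fst z) + Cmod (snd z)) by exact NZ.
  unfold l1norm in Hz.
  assert (G1 : Cmod (slice_fun th (F z)) = Cmod (snd (F z)) / (1 - Cmod (fst (F z)))).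
  { unfold slice_fun. rewrite Eth, <- RtoC_minus. rewrite Cmod_div, Cmod_R, Rabs_pos_eq; [reflexivity|lra|].
    intros Q. apply RtoC_inj' in Q. lra. }
  rewrite G1 in L.
  assert (I : Cmod (snd (F z)) / (1 - Cmod (fst (F z))) <= Cmod (snd z) / (1 - Cmod (fst z))).
  { apply artanh_le_inv.
    - split; [apply Rdiv_le_0_compat; lra|]. apply (Rmult_lt_reg_r (1 - Cmod (fst (F z)))); [lra|].
      unfold Rdiv. rewrite Rmult_assoc, Rinv_l; lra.
    - apply Rdiv_le_0_compat; lra.
    - pose proof (rigid_nonexp _ _ R a z Ha Hz). lra. }
  apply (Rmult_le_compat_r ((1 - Cmod (fst (F z))) * (1 - Cmod (fst z)))) in I; [|apply Rmult_le_pos; lra].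
  replace (Cmod (snd (F z)) / (1 - Cmod (fst (F z))) * ((1 - Cmod (fst (F z))) * (1 - Cmod (fst z)))) with
    (Cmod (snd (F z)) * (1 - Cmod (fst z))) in I by (field; lra).
  replace (Cmod (snd z) / (1 - Cmod (fst z)) * ((1 - Cmod (fst (F z))) * (1 - Cmod (fst z)))) with
    (Cmod (snd z) * (1 - Cmod (fst (F z)))) in I by (field; lra).
  nra.
Qed.

End NormalForm.

Lemma aligned_equal (a b : C) : (a * RtoC (Cmod b))%C = (RtoC (Cmod a) * b)%C -> Cmod a = Cmod b -> a = b.
Proof.
  intros E M. destruct (Req_dec (Cmod b) 0) as [Z|Z].
  - rewrite Z in M. apply Cmod_eq_0 in M. apply Cmod_eq_0 in Z. now subst.
  - assert (En : RtoC (Cmod b) <> 0%C) by (intros Q; apply RtoC_inj' in Q; lra).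
    rewrite M in E. transitivity (a * RtoC (Cmod b) / RtoC (Cmod b))%C; [field; exact En|].
    rewrite E. field. exact En.
Qed.

(** Exchanging the coordinates gives the other inequality; as the sums of the moduli agree, both are
    equalities, and the arguments are already known. *)
Lemma rigid_eq_normal_map (F : C * C -> C * C) (o1 o2 : C) (k1 k2 : bool) (z : C * C) :
  Cmod o1 = 1 -> Cmod o2 = 1 -> rigid F (normal_map o1 o2 k1 k2) -> l1norm z < 1 ->
  F z = normal_map o1 o2 k1 k2 z.
Proof.
  intros Ho1 Ho2 R Hz.
  pose proof (rigid_snd_le o1 o2 k1 k2 Ho2 F z R Hz) as S2.
  assert (R' : rigid (fun z => swap (F (swap z))) (normal_map o2 o1 k2 k1)).
  { eapply rigid_ext; [|apply (rigid_swap_l (fun z => F (swap z))), (rigid_swap_r F); exact R]. reflexivity. }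
  pose proof (rigid_snd_le o2 o1 k2 k1 Ho1 _ (swap z) R' ltac:(now rewrite l1norm_swap)) as S1.
  cbv beta in S1. replace (swap (swap z)) with z in S1 by (destruct z; reflexivity). simpl in S1.
  pose proof (rigid_norm _ _ R z Hz) as NZ. unfold l1norm in NZ.
  destruct (rigid_coordinates _ _ z R Hz) as [A1 A2].
  apply injective_projections; apply aligned_equal; auto; simpl;
    rewrite Cmod_mult, Cmod_cj, ?Ho1, ?Ho2; lra.
Qed.

(** The parabolic disc for [u = Ci] passes, at the parameters 1/2 and -1/2, through points whose
    coordinates sum to 1/2 and -1/2. Conjugating one coordinate adds the same imaginary part to both
    sums; this pushes them away from the origin and increases their Poincare distance. *)
Lemma normal_map_not_mixed (o1 o2 : C) (k1 k2 : bool) : Cmod o1 = 1 -> Cmod o2 = 1 ->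
  (forall z w, l1norm z < 1 -> l1norm w < 1 ->
     kobd (normal_map o1 o2 k1 k2 z) (normal_map o1 o2 k1 k2 w) <= kobd z w) -> k1 = k2.
Proof.
  intros Ho1 Ho2 H.
  assert (Main : forall s : R, Rabs s = 3 / 16 ->
    lin (Cconj o1) (Cconj o2) (normal_map o1 o2 k1 k2 ((1 / 4, 3 / 16), (1 / 4, - (3 / 16)))) = (1 / 2, 2 * s) ->
    lin (Cconj o1) (Cconj o2) (normal_map o1 o2 k1 k2 ((- (1 / 4), 3 / 16), (- (1 / 4), - (3 / 16)))) = (- (1 / 2), 2 * s) -> False).
  { intros s Hs EP EQ.
    pose proof (hdisc_parabolic Ci Cmod_Ci) as Hp. set (phi := fun l : C => _) in Hp.
    assert (Mh : Cmod (RtoC (1 / 2)) < 1) by (rewrite Cmod_R, Rabs_pos_eq; lra).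
    assert (Mh' : Cmod (RtoC (- (1 / 2))) < 1) by (rewrite Cmod_R, Rabs_left; lra).
    assert (I4 : (Ci / 4)%C = (0, 1 / 4)).
    { unfold Ci, Cdiv, Cinv, Cmult, RtoC; simpl. f_equal; field. }
    assert (P : phi (RtoC (1 / 2)) = ((1 / 4, 3 / 16), (1 / 4, - (3 / 16)))).
    { unfold phi. rewrite I4. unfold Ci, Cconj, Cmult, Cplus, Cminus, Copp, RtoC; simpl.
      repeat apply injective_projections; simpl; field. }
    assert (Q : phi (RtoC (- (1 / 2))) = ((- (1 / 4), 3 / 16), (- (1 / 4), - (3 / 16)))).
    { unfold phi. rewrite I4. unfold Ci, Cconj, Cmult, Cplus, Cminus, Copp, RtoC; simpl.
      repeat apply injective_projections; simpl; field. }
    pose proof (proj2 (Hp _ Mh)) as BP. pose proof (proj2 (Hp _ Mh')) as BQ.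
    pose proof (kobd_le_segment _ _ _ BP BQ (segment_of_disc phi _ _ Hp Mh Mh')) as Up.
    rewrite P, Q in Up. rewrite P in BP. rewrite Q in BQ.
    set (p := ((1 / 4, 3 / 16), (1 / 4, - (3 / 16)))) in *.
    set (q := ((- (1 / 4), 3 / 16), (- (1 / 4), - (3 / 16)))) in *.
    assert (Bn : forall z, l1norm (normal_map o1 o2 k1 k2 z) = l1norm z).
    { intros z. unfold l1norm, normal_map; simpl. rewrite !Cmod_mult, !Cmod_cj, Ho1, Ho2. ring. }
    assert (HL : hol_fun (lin (Cconj o1) (Cconj o2)) (fun _ v => lin (Cconj o1) (Cconj o2) v)).
    { apply hol_fun_lin; rewrite Cmod_conj; lra. }
    pose proof (kobd_ge_mob _ _ (normal_map o1 o2 k1 k2 p) (normal_map o1 o2 k1 k2 q) HL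
      ltac:(rewrite Bn; exact BP) ltac:(rewrite Bn; exact BQ)) as Lo.
    rewrite EP, EQ in Lo. pose proof (H p q BP BQ) as Hpq.
    assert (Es : s * s = 9 / 256).
    { replace (s * s) with (Rabs s * Rabs s); [rewrite Hs; field|]. rewrite <- Rabs_mult. apply Rabs_pos_eq. nra. }
    set (P0 := (1 / 2, 2 * s)) in *. set (Q0 := (- (1 / 2), 2 * s)) in *.
    change C in (type of P0). change C in (type of Q0).
    assert (M1 : Cmod P0 < 1).
    { apply Rsqr_incrst_0; [|apply Cmod_ge_0|lra]. rewrite !Rsqr_pow2, Cmod2_alt. unfold Re, Im; simpl. nra. }
    assert (M2 : Cmod Q0 < 1).
    { apply Rsqr_incrst_0; [|apply Cmod_ge_0|lra]. rewrite !Rsqr_pow2, Cmod2_alt. unfold Re, Im; simpl. nra. }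
    assert (E5 : Cmod ((RtoC (1 / 2) - RtoC (- (1 / 2))) / (1 - Cconj (RtoC (- (1 / 2))) * RtoC (1 / 2)))%C = 4 / 5).
    { rewrite Cconj_RtoC, <- RtoC_mult, <- !RtoC_minus, <- RtoC_div by lra.
      replace ((1 / 2 - - (1 / 2)) / (1 - - (1 / 2) * (1 / 2))) with (4 / 5) by field.
      rewrite Cmod_R, Rabs_pos_eq; lra. }
    rewrite E5 in Up.
    assert (Le : Cmod (mob P0 Q0) <= 4 / 5).
    { apply artanh_le_inv; [split; [apply Cmod_ge_0|now apply mob_lt_1]|lra|lra]. }
    unfold mob in Le. pose proof (mob_den _ _ M1 M2) as Nd. rewrite Cmod_div in Le by exact Nd.
    apply Cmod_gt_0 in Nd. set (d := Cmod (1 - Cconj P0 * Q0)%C) in *.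
    assert (En : Cmod (Q0 - P0)%C = 1).
    { replace (Q0 - P0)%C with (RtoC (-1)).
      - rewrite Cmod_R, Rabs_left; lra. - unfold Cminus, Cplus, Copp, RtoC; simpl. f_equal; field. }
    rewrite En in Le.
    assert (Ld : 5 / 4 <= d).
    { apply (Rmult_le_compat_r d) in Le; [|lra]. unfold Rdiv at 1 in Le. rewrite Rmult_assoc, Rinv_l in Le by lra. lra. }
    (* Less than [(5 / 4) ^ 2 = 6400 / 4096]. *)
    assert (Ed : d ^ 2 = 5617 / 4096).
    { unfold d. rewrite Cmod2_alt. unfold Re, Im; simpl.
      replace (1 + - (1 / 2 * - (1 / 2) - - (2 * s) * (2 * s))) with (1 + 1 / 4 - 4 * (s * s)) by field.
      replace (0 + - (1 / 2 * (2 * s) + - (2 * s) * - (1 / 2))) with (- (2 * s)) by field.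
      rewrite Es. replace (- (2 * s) * (- (2 * s) * 1)) with (4 * (s * s)) by ring. rewrite Es. field. }
    nra. }
  assert (L : forall z, lin (Cconj o1) (Cconj o2) (normal_map o1 o2 k1 k2 z) = (cj k1 (fst z) + cj k2 (snd z))%C).
  { intros z. unfold lin, normal_map; simpl. rewrite !Cmult_assoc, !unit_conj_mul by assumption. ring. }
  destruct k1, k2; try reflexivity; exfalso.
  - apply (Main (- (3 / 16))); [rewrite Rabs_left; lra| |]; rewrite L; unfold cj, Cconj, Cplus; simpl; f_equal; field.
  - apply (Main (3 / 16)); [rewrite Rabs_pos_eq; lra| |]; rewrite L; unfold cj, Cconj, Cplus; simpl; f_equal; field.
Qed.

(** * Real linear isometries of the l1 norm *)

Lemma disjoint_of_l1 (a b : C * C) : l1norm (vadd a b) = l1norm a + l1norm b ->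
  l1norm (vsub a b) = l1norm a + l1norm b ->
  (fst a = 0%C \/ fst b = 0%C) /\ (snd a = 0%C \/ snd b = 0%C).
Proof.
  unfold l1norm, vadd, vsub; simpl. intros H1 H2.
  assert (S : forall x y : C, Cmod (x - y)%C <= Cmod x + Cmod y).
  { intros x y. unfold Cminus. rewrite <- (Cmod_opp y). apply Cmod_triangle. }
  pose proof (Cmod_triangle (fst a) (fst b)). pose proof (Cmod_triangle (snd a) (snd b)).
  pose proof (S (fst a) (fst b)). pose proof (S (snd a) (snd b)).
  (* If sum and difference both have the largest possible modulus, the parallelogram law leaves
     [Cmod x * Cmod y = 0]. *)
  assert (Z : forall x y : C, Cmod (x + y)%C = Cmod x + Cmod y -> Cmod (x - y)%C = Cmod x + Cmod y -> x = 0%C \/ y = 0%C).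
  { intros x y E1 E2. assert (P : Cmod (x + y)%C ^ 2 + Cmod (x - y)%C ^ 2 = 2 * Cmod x ^ 2 + 2 * Cmod y ^ 2).
    { rewrite !Cmod2_alt. destruct x, y; unfold Re, Im; simpl; ring. }
    rewrite E1, E2 in P. assert (M : Cmod x * Cmod y = 0) by nra.
    apply Rmult_integral in M. destruct M as [M|M]; apply Cmod_eq_0 in M; auto. }
  split; apply Z; lra.
Qed.

(** The columns [a] and [a'] are orthonormal with determinant 1 or -1: a rotation, possibly preceded
    by conjugation. *)
Lemma plane_isometry (a a' : C) : (forall s t : R, Cmod (RtoC s * a + RtoC t * a')%C = Cmod (s, t)) ->
  Cmod a = 1 /\ exists k, forall z : C, (RtoC (fst z) * a + RtoC (snd z) * a')%C = (a * cj k z)%C.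
Proof.
  intros H.
  assert (A : Cmod a = 1).
  { pose proof (H 1 0) as E. replace (RtoC 1 * a + RtoC 0 * a')%C with a in E by ring.
    rewrite E. change (Cmod (RtoC 1) = 1). apply Cmod_1. }
  assert (A' : Cmod a' = 1).
  { pose proof (H 0 1) as E. replace (RtoC 0 * a + RtoC 1 * a')%C with a' in E by ring.
    rewrite E. change (Cmod Ci = 1). apply Cmod_Ci. }
  assert (S : Cmod (a + a')%C ^ 2 = 2).
  { pose proof (H 1 1) as E. replace (RtoC 1 * a + RtoC 1 * a')%C with (a + a')%C in E by ring.
    rewrite E, Cmod2_alt. unfold Re, Im; simpl. ring. }
  split; [exact A|].
  assert (Q1 : Cmod a ^ 2 = 1) by (rewrite A; ring). assert (Q2 : Cmod a' ^ 2 = 1) by (rewrite A'; ring).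
  rewrite Cmod2_alt in Q1, Q2, S. destruct a as [p q], a' as [p' q']. unfold Re, Im in *. simpl in Q1, Q2, S.
  assert (Orth : p * p' + q * q' = 0) by nra.
  assert (Det : (p * q' - q * p') ^ 2 = 1).
  { replace ((p * q' - q * p') ^ 2) with ((p * p + q * q) * (p' * p' + q' * q') - (p * p' + q * q') ^ 2) by ring.
    rewrite Orth. replace (p * p + q * q) with 1 by lra. replace (p' * p' + q' * q') with 1 by lra. ring. }
  assert (D : p * q' - q * p' = 1 \/ p * q' - q * p' = -1).
  { assert (M : (p * q' - q * p' - 1) * (p * q' - q * p' + 1) = 0) by nra.
    apply Rmult_integral in M. destruct M; [left|right]; lra. }
  destruct D as [D|D].
  - assert (E1 : p' = - q).
    { transitivity (p' * (p * p + q * q)); [replace (p * p + q * q) with 1 by lra; ring|].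
      transitivity (p * (p * p' + q * q') - q * (p * q' - q * p')); [ring|]. rewrite Orth, D. ring. }
    assert (E2 : q' = p).
    { transitivity (q' * (p * p + q * q)); [replace (p * p + q * q) with 1 by lra; ring|].
      transitivity (q * (p * p' + q * q') + p * (p * q' - q * p')); [ring|]. rewrite Orth, D. ring. }
    exists false. intros [x y]. subst p' q'. unfold cj, Cmult, Cplus, RtoC; simpl. f_equal; ring.
  - assert (E1 : p' = q).
    { transitivity (p' * (p * p + q * q)); [replace (p * p + q * q) with 1 by lra; ring|].
      transitivity (p * (p * p' + q * q') - q * (p * q' - q * p')); [ring|]. rewrite Orth, D. ring. }
    assert (E2 : q' = - p).
    { transitivity (q' * (p * p + q * q)); [replace (p * p + q * q) with 1 by lra; ring|].
      transitivity (q * (p * p' + q * q') + p * (p * q' - q * p')); [ring|]. rewrite Orth, D. ring. }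
    exists true. intros [x y]. subst p' q'. unfold cj, Cconj, Cmult, Cplus, RtoC; simpl. f_equal; ring.
Qed.

(** Vectors supported in different coordinates are characterised by additivity of the norm on their
    sum and difference, which [U] preserves. So [U] permutes the two coordinate planes, and the
    hypothesis on the first basis vector selects the order. *)
Lemma l1_isometry_normal (U : C * C -> C * C) : rlinear U -> (forall z, l1norm (U z) = l1norm z) ->
  fst (U (basis 0)) <> 0%C ->
  exists o1 o2 k1 k2, Cmod o1 = 1 /\ Cmod o2 = 1 /\ forall z, U z = normal_map o1 o2 k1 k2 z.
Proof.
  intros HU NU Ha.
  assert (Nb : forall i, l1norm (U (basis i)) = 1).
  { intros i. rewrite NU. destruct i as [|[|[|i]]]; unfold l1norm, basis; simpl; rewrite Cmod_0, ?Cmod_1, ?Cmod_Ci; ring. }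
  assert (Dj : forall i j, (i < 2)%nat -> (2 <= j < 4)%nat ->
    (fst (U (basis i)) = 0%C \/ fst (U (basis j)) = 0%C) /\ (snd (U (basis i)) = 0%C \/ snd (U (basis j)) = 0%C)).
  { intros i j Hi Hj.
    assert (S : forall t, Rabs t = 1 -> l1norm (vadd (U (basis i)) (rscal t (U (basis j)))) = l1norm (U (basis i)) + l1norm (U (basis j))).
    { intros t Ht. rewrite !Nb, <- (proj2 HU), <- (proj1 HU), NU.
      destruct i as [|[|i]]; try lia; destruct j as [|[|[|[|j]]]]; try lia;
        unfold l1norm, vadd, rscal, vscal, basis; simpl; rewrite ?Cmult_0_r, ?Cplus_0_l, ?Cplus_0_r, ?Cmod_mult, ?Cmod_1, ?Cmod_Ci, ?Cmod_R, ?Ht, ?Rabs_R1; ring. }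
    apply disjoint_of_l1.
    - pose proof (S 1 Rabs_R1) as E. now rewrite rscal_1 in E.
    - pose proof (S (-1) ltac:(rewrite Rabs_left; lra)) as E.
      replace (vsub (U (basis i)) (U (basis j))) with (vadd (U (basis i)) (rscal (-1) (U (basis j)))) by vring. exact E. }
  assert (F2 : fst (U (basis 2)) = 0%C) by (destruct (Dj 0%nat 2%nat ltac:(lia) ltac:(lia)) as [[?|?] _]; [contradiction|assumption]).
  assert (F3 : fst (U (basis 3)) = 0%C) by (destruct (Dj 0%nat 3%nat ltac:(lia) ltac:(lia)) as [[?|?] _]; [contradiction|assumption]).
  assert (S2 : snd (U (basis 2)) <> 0%C).
  { intros Z. pose proof (Nb 2%nat) as N. unfold l1norm in N. rewrite F2, Z, Cmod_0 in N. lra. }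
  assert (S0 : snd (U (basis 0)) = 0%C) by (destruct (Dj 0%nat 2%nat ltac:(lia) ltac:(lia)) as [_ [?|?]]; [assumption|contradiction]).
  assert (S1 : snd (U (basis 1)) = 0%C) by (destruct (Dj 1%nat 2%nat ltac:(lia) ltac:(lia)) as [_ [?|?]]; [assumption|contradiction]).
  assert (Uz : forall z, U z = ((RtoC (fst (fst z)) * fst (U (basis 0)) + RtoC (snd (fst z)) * fst (U (basis 1)))%C,
     (RtoC (fst (snd z)) * snd (U (basis 2)) + RtoC (snd (snd z)) * snd (U (basis 3)))%C)).
  { intros z. rewrite (basis_combine z) at 1. rewrite rlinear_combine by exact HU.
    unfold combine, vadd, rscal, vscal; cbn [fst snd coord]. rewrite F2, F3, S0, S1. f_equal; ring. }
  destruct (plane_isometry (fst (U (basis 0))) (fst (U (basis 1)))) as [M1 [k1 K1]].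
  { intros s t. pose proof (NU ((s, t), RtoC 0)) as E. rewrite Uz in E. unfold l1norm in E. cbn [fst snd RtoC] in E.
    change (0, 0) with (RtoC 0) in E. rewrite Cmod_0 in E. replace (RtoC 0 * snd (U (basis 2)) + RtoC 0 * snd (U (basis 3)))%C with (RtoC 0) in E by ring.
    rewrite Cmod_0 in E. lra. }
  destruct (plane_isometry (snd (U (basis 2))) (snd (U (basis 3)))) as [M2 [k2 K2]].
  { intros s t. pose proof (NU (RtoC 0, (s, t))) as E. rewrite Uz in E. unfold l1norm in E. cbn [fst snd RtoC] in E.
    change (0, 0) with (RtoC 0) in E. rewrite Cmod_0 in E. replace (RtoC 0 * fst (U (basis 0)) + RtoC 0 * fst (U (basis 1)))%C with (RtoC 0) in E by ring.
    rewrite Cmod_0 in E. lra. }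
  exists (fst (U (basis 0))), (snd (U (basis 2))), k1, k2. split; [exact M1|]. split; [exact M2|].
  intros z. rewrite Uz, K1, K2. reflexivity.
Qed.

Definition standard_isometry (F : C * C -> C * C) : Prop :=
  exists (omega1 omega2 : C) (sigma : C * C -> C * C),
      Cmod omega1 = 1%R /\ Cmod omega2 = 1%R /\
      coordinate_permutation sigma /\
      ((forall z : C * C, l1_ball z ->
          F z = (Cmult omega1 (fst (sigma z)), Cmult omega2 (snd (sigma z))))
       \/
       (forall z : C * C, l1_ball z ->
          F z = (Cmult omega1 (Cconj (fst (sigma z))),
                 Cmult omega2 (Cconj (snd (sigma z)))))).

Lemma rigid_normal_form (F : C * C -> C * C) (o1 o2 : C) (k1 k2 : bool) :
  Cmod o1 = 1 -> Cmod o2 = 1 -> rigid F (normal_map o1 o2 k1 k2) ->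
  k1 = k2 /\ forall z, l1norm z < 1 -> F z = normal_map o1 o2 k1 k2 z.
Proof.
  intros H1 H2 R.
  assert (E : forall z, l1norm z < 1 -> F z = normal_map o1 o2 k1 k2 z).
  { intros z Hz. now apply rigid_eq_normal_map. }
  split; [|exact E]. apply (normal_map_not_mixed o1 o2); auto.
  intros z w Hz Hw. rewrite <- !E by assumption. now apply (rigid_nonexp _ _ R).
Qed.

(** If the blow-up exchanges the two coordinate planes, a swap after [F] and [U] leads back to the
    other case. *)
Lemma rigid_standard (F U : C * C -> C * C) : rigid F U -> standard_isometry F.
Proof.
  intros R. pose proof (rigid_lin _ _ R) as HU. pose proof (rigid_unorm _ _ R) as NU.
  destruct (classic (fst (U (basis 0)) = 0%C)) as [Z|Z].
  - destruct (l1_isometry_normal (fun z => swap (U z))) as (o1 & o2 & k1 & k2 & H1 & H2 & E).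
    + apply rlinear_comp; [exact HU|apply rlinear_swap].
    + intros z. now rewrite l1norm_swap.
    + change (snd (U (basis 0)) <> 0%C). intros Z'. pose proof (NU (basis 0)) as N. unfold l1norm in N. rewrite Z, Z' in N.
      simpl in N. rewrite Cmod_0, Cmod_1 in N. lra.
    + destruct (rigid_normal_form (fun z => swap (F z)) o1 o2 k1 k2 H1 H2) as [<- EF].
      { eapply rigid_ext; [exact E|]. now apply rigid_swap_l. }
      exists o2, o1, (fun z => (snd z, fst z)). split; [exact H2|]. split; [exact H1|].
      split; [now right|].
      destruct k1; [right|left]; intros z Hz; specialize (EF z Hz);
        apply (f_equal swap) in EF; destruct (F z) as [f g]; exact EF.
  - destruct (l1_isometry_normal U HU NU Z) as (o1 & o2 & k1 & k2 & H1 & H2 & E).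
    destruct (rigid_normal_form F o1 o2 k1 k2 H1 H2) as [<- EF].
    { eapply rigid_ext; [exact E|]. exact R. }
    exists o1, o2, (fun z => z). split; [exact H1|]. split; [exact H2|]. split; [now left|].
    destruct k1; [right|left]; intros z Hz; exact (EF z Hz).
Qed.

(** * Differentiable isometries of the metric *)

Lemma C_R_norm (z : C) : @norm R_AbsRing C_R_NormedModule z = Cmod z.
Proof.
  change (sqrt (Rabs (fst z) ^ 2 + Rabs (snd z) ^ 2) = sqrt (fst z ^ 2 + snd z ^ 2)).
  now rewrite !pow2_abs.
Qed.

Lemma C2_R_norm_l1 (u : C * C) :
  @norm R_AbsRing C2_R u <= l1norm u <= 2 * @norm R_AbsRing C2_R u.
Proof.
  replace (@norm R_AbsRing C2_R u) with (@norm C_AbsRing C2 u); [apply C2_norm_l1|].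
  change (sqrt (Cmod (fst u) ^ 2 + Cmod (snd u) ^ 2) =
    sqrt (@norm R_AbsRing C_R_NormedModule (fst u) ^ 2 + @norm R_AbsRing C_R_NormedModule (snd u) ^ 2)).
  now rewrite !C_R_norm.
Qed.

Lemma C2_R_scal (t : R) (z : C * C) : @scal R_AbsRing C2_R t z = rscal t z.
Proof.
  change (((t * fst (fst z), t * snd (fst z)), (t * fst (snd z), t * snd (snd z))) = rscal t z).
  unfold rscal, vscal, Cmult, RtoC; simpl. repeat apply injective_projections; simpl; ring.
Qed.

Lemma real_differential (F L : C * C -> C * C) (z : C * C) :
  @filterdiff R_AbsRing C2_R C2_R F (@locally C2_R z) L ->
  rlinear L /\ forall eps, 0 < eps -> exists delta, 0 < delta /\ forall w, l1norm (vsub w z) < delta ->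
    l1norm (vsub (F w) (vadd (F z) (L (vsub w z)))) <= eps * l1norm (vsub w z).
Proof.
  intros [HL HD]. split.
  - split; [exact (@linear_plus R_AbsRing C2_R C2_R L HL)|]. intros t x. rewrite <- !C2_R_scal. exact (@linear_scal R_AbsRing C2_R C2_R L HL t x).
  - intros eps He. assert (He2 : 0 < eps / 2) by lra.
    specialize (HD z (fun P HP => HP) (mkposreal _ He2)).
    apply (locally_norm_le_locally (K := R_AbsRing) (V := C2_R)) in HD. destruct HD as [dl Hd].
    exists dl. split; [apply cond_pos|]. intros w Hw. specialize (Hd w).
    assert (B : @ball_norm R_AbsRing C2_R z dl w).
    { apply Rle_lt_trans with (2 := Hw). apply (C2_R_norm_l1 (vsub w z)). }
    specialize (Hd B). simpl in Hd.
    change (@norm R_AbsRing C2_R (vsub (vsub (F w) (F z)) (L (vsub w z))) <= eps / 2 * @norm R_AbsRing C2_R (vsub w z)) in Hd.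
    replace (vsub (F w) (vadd (F z) (L (vsub w z)))) with (vsub (vsub (F w) (F z)) (L (vsub w z))) by vring.
    pose proof (C2_R_norm_l1 (vsub (vsub (F w) (F z)) (L (vsub w z)))) as N1.
    pose proof (C2_R_norm_l1 (vsub w z)) as N2.
    apply Rle_trans with (1 := proj2 N1). nra.
Qed.

Lemma C1_differential_of_linear (F S : C * C -> C * C) :
  (forall z, l1norm z < 1 -> F z = S z) -> rlinear S -> (forall z, l1norm (S z) = l1norm z) ->
  C1_differential l1_ball F (fun _ => S).
Proof.
  intros E HS NS. split.
  - intros z Hz. apply (filterdiff_ext_locally (K := R_AbsRing) (U := C2_R) (V := C2_R) S F).
    + apply (locally_le_locally_norm (K := R_AbsRing) (V := C2_R)).
      assert (P : 0 < (1 - l1norm z) / 2) by (unfold l1_ball in Hz; fold (l1norm z) in Hz; lra).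
      exists (mkposreal _ P). intros w Hw. symmetry. apply E.
      change (@norm R_AbsRing C2_R (vsub w z) < (1 - l1norm z) / 2) in Hw.
      pose proof (C2_R_norm_l1 (vsub w z)). pose proof (l1norm_le_vsub w z). lra.
    + apply filterdiff_linear. split.
      * apply HS.
      * intros t x. rewrite !C2_R_scal. apply HS.
      * exists 2. split; [lra|]. intros x.
        pose proof (C2_R_norm_l1 x). pose proof (C2_R_norm_l1 (S x)). rewrite NS in *. lra.
  - intros X z Hz. apply (continuous_const (U := C2_R) (V := C2_R)).
Qed.

Section Differentiable.

Variable F : C * C -> C * C.
Variable dF : C * C -> C * C -> C * C.
Hypothesis F_ball : forall z, l1norm z < 1 -> l1norm (F z) < 1.
Hypothesis dF_lin : forall z, l1norm z < 1 -> rlinear (dF z).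
Hypothesis dF_diff : forall z, l1norm z < 1 -> forall eps, 0 < eps -> exists delta, 0 < delta /\
  forall w, l1norm (vsub w z) < delta ->
    l1norm (vsub (F w) (vadd (F z) (dF z (vsub w z)))) <= eps * l1norm (vsub w z).
Hypothesis dF_iso : forall z X, l1norm z < 1 -> kobm (F z) (dF z X) = kobm z X.

Lemma differential_bound (z X : C * C) : l1norm z < 1 -> l1norm (dF z X) <= l1norm X / (1 - l1norm z).
Proof.
  intros Hz. apply Rle_trans with (1 := kobm_ge_l1norm (F z) _ (F_ball z Hz)).
  rewrite dF_iso by exact Hz. now apply kobm_upper.
Qed.

(** The expansion is needed along curves tangent to [X], not only along the line; the bound on
    [dF z] coming from the isometry absorbs the deviation. *)
Lemma differential_along (z X : C * C) (eps : R) : l1norm z < 1 -> 0 < eps -> exists delta, 0 < delta /\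
  forall h w, Rabs h < delta -> l1norm (vsub w (vadd z (rscal h X))) <= delta * Rabs h ->
    l1norm (vsub (F w) (vadd (F z) (rscal h (dF z X)))) <= eps * Rabs h.
Proof.
  intros Hz He. pose proof (l1norm_pos X) as PX. pose proof (l1norm_pos z) as Pz.
  set (a := 1 - l1norm z). assert (Ha : 0 < a) by (unfold a; lra).
  set (M := l1norm X + 1). assert (HM : 1 <= M) by (unfold M; lra).
  destruct (dF_diff z Hz (eps / (2 * M))) as [d1 [D1 K1]]; [apply Rdiv_lt_0_compat; lra|].
  set (d := Rmin (Rmin 1 (d1 / M)) (eps * a / 2)).
  assert (P1 : 0 < d1 / M) by (apply Rdiv_lt_0_compat; lra).
  assert (Pd : 0 < d) by (repeat apply Rmin_pos; try lra; nra).
  assert (L1 : d <= 1) by (eapply Rle_trans; [apply Rmin_l|apply Rmin_l]).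
  assert (L2 : d <= d1 / M) by (eapply Rle_trans; [apply Rmin_l|apply Rmin_r]).
  assert (L3 : d <= eps * a / 2) by apply Rmin_r.
  exists d. split; [exact Pd|]. intros h w Hh Hw. pose proof (Rabs_pos h) as Ph.
  assert (Dw : l1norm (vsub w z) <= M * Rabs h).
  { pose proof (l1norm_vsub_triangle w (vadd z (rscal h X)) z) as T.
    replace (vsub (vadd z (rscal h X)) z) with (rscal h X) in T by vring.
    rewrite l1norm_rscal in T. unfold M. nra. }
  assert (Dw1 : l1norm (vsub w z) < d1).
  { apply Rle_lt_trans with (1 := Dw). apply Rlt_le_trans with (M * (d1 / M)); [apply Rmult_lt_compat_l; lra|].
    right. field. lra. }
  specialize (K1 w Dw1).
  pose proof (differential_bound z (vsub w (vadd z (rscal h X))) Hz) as B. fold a in B.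
  destruct (dF_lin z Hz) as [Ladd Lsc].
  assert (Ew : dF z (vsub w z) = vadd (dF z (vsub w (vadd z (rscal h X)))) (rscal h (dF z X))).
  { rewrite <- Lsc, <- Ladd. f_equal. vring. }
  pose proof (l1norm_vsub_triangle (F w) (vadd (F z) (dF z (vsub w z))) (vadd (F z) (rscal h (dF z X)))) as T.
  replace (vsub (vadd (F z) (dF z (vsub w z))) (vadd (F z) (rscal h (dF z X)))) with
    (dF z (vsub w (vadd z (rscal h X)))) in T by (rewrite Ew; vring).
  assert (B1 : l1norm (vsub w (vadd z (rscal h X))) / a <= eps / 2 * Rabs h).
  { apply (Rmult_le_reg_r a); [lra|]. unfold Rdiv at 1. rewrite Rmult_assoc, Rinv_l by lra.
    pose proof (Rmult_le_compat_r (Rabs h) _ _ Ph L3). lra. }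
  assert (B2 : eps / (2 * M) * l1norm (vsub w z) <= eps / 2 * Rabs h).
  { apply Rle_trans with (eps / (2 * M) * (M * Rabs h)).
    - apply Rmult_le_compat_l; [|exact Dw]. apply Rdiv_le_0_compat; lra.
    - right. field. lra. }
  lra.
Qed.

(** The function [kobd (F z) (F p)] of [p] grows to first order at most like the metric, since [dF]
    preserves the metric. *)
Lemma differential_nonexpanding (z w : C * C) : l1norm z < 1 -> l1norm w < 1 -> kobd (F z) (F w) <= kobd z w.
Proof.
  intros Hz Hw.
  pose proof (kobd_infinitesimal_lipschitz (fun p => kobd (F z) (F p)) 1 ltac:(lra)) as L.
  cbv beta in L. specialize (L) with (z := z) (w := w).
  rewrite kobd_refl, Rminus_0_r, Rmult_1_l in L by auto. apply L; auto. clear L w Hw.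
  intros p X eps Hp He.
  destruct (kobd_infinitesimal (F p) (dF p X) eps (F_ball p Hp) He) as [d1 [D1 K1]].
  destruct (differential_along p X d1 Hp D1) as [d2 [D2 K2]].
  exists (Rmin d1 d2). split; [now apply Rmin_pos|]. intros h w Hh Nw Hw.
  pose proof (Rmin_l d1 d2). pose proof (Rmin_r d1 d2). pose proof (Rabs_pos h).
  specialize (K2 h w ltac:(lra) ltac:(nra)).
  destruct (K1 h (F w) ltac:(lra) K2) as [_ K].
  rewrite dF_iso in K by exact Hp. rewrite Rmult_1_l.
  pose proof (kobd_triangle (F z) (F p) (F w) (F_ball z Hz) (F_ball p Hp) (F_ball w Nw)).
  pose proof (kobd_triangle (F z) (F w) (F p) (F_ball z Hz) (F_ball w Nw) (F_ball p Hp)).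
  rewrite (kobd_sym (F w) (F p)) in * by auto.
  apply Rle_trans with (2 := K). apply Rabs_le. lra.
Qed.

Lemma differential_fixes_zero : F vzero = vzero.
Proof.
  apply (kobm_l1_center' (F vzero) (dF vzero)).
  - apply F_ball, vzero_in. - apply dF_lin, vzero_in.
  - intros X. rewrite dF_iso by apply vzero_in. apply kobm_at_vzero.
Qed.

(** The differential at [z] identifies the indicatrix there with that of the origin, so [z] is the
    origin too. *)
Lemma differential_zero_fiber (z : C * C) : l1norm z < 1 -> F z = vzero -> z = vzero.
Proof.
  intros Hz E. apply (kobm_l1_center z (dF z)); auto.
  intros X. rewrite <- dF_iso, E by exact Hz. apply kobm_at_vzero.
Qed.

Lemma differential_surjective (z : C * C) : l1norm z < 1 -> forall y, exists x, dF z x = y.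
Proof.
  intros Hz. apply rlinear_surjective; [now apply dF_lin|]. intros x E.
  apply l1norm_eq_0. pose proof (kobm_ge_l1norm z x Hz) as B.
  rewrite <- dF_iso, E, kobm_vzero in B by auto. pose proof (l1norm_pos x). lra.
Qed.

(* Ekeland's principle in a proper space: minimize the perturbed functional. *)
Lemma penalized_minimum (z0 : C * C) (th : R) : l1norm z0 < 1 -> 0 < th < 1 ->
  exists zs, l1norm zs < 1 /\ forall z, l1norm z < 1 ->
    artanh (l1norm (F zs)) + th * kobd z0 zs <= artanh (l1norm (F z)) + th * kobd z0 z.
Proof.
  intros Hz0 Hth.
  set (phi := fun z => artanh (l1norm (F z)) + th * kobd z0 z).
  assert (Phi_pos : forall z, l1norm z < 1 -> 0 <= phi z).
  { intros z Hz. unfold phi. pose proof (F_ball z Hz). pose proof (l1norm_pos (F z)).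
    pose proof (artanh_pos (l1norm (F z)) ltac:(lra)). pose proof (kobd_pos z0 z Hz0 Hz). nra. }
  assert (Phi_lip : forall z w, l1norm z < 1 -> l1norm w < 1 -> phi w - phi z <= 2 * kobd z w).
  { intros z w Hz Hw. unfold phi.
    pose proof (kobd_ge_l1 (F z) (F w) (F_ball z Hz) (F_ball w Hw)).
    pose proof (differential_nonexpanding z w Hz Hw).
    pose proof (kobd_triangle z0 z w Hz0 Hz Hw). pose proof (kobd_pos z w Hz Hw). nra. }
  destruct (glb_real_spec (fun y => exists z, l1norm z < 1 /\ y = phi z) 0 (phi z0)) as [G1 G2].
  { intros y (z & Hz & ->). now apply Phi_pos. }
  { exists z0. auto. }
  set (m := real _) in *.
  assert (Seq : forall n, exists z, l1norm z < 1 /\ phi z <= m + / (INR n + 1)).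
  { intros n. apply Classical_Prop.NNPP. intros N. pose proof (pos_INR n).
    assert (P : 0 < / (INR n + 1)) by (apply Rinv_0_lt_compat; lra).
    assert (B : m + / (INR n + 1) <= m); [|lra].
    apply G2. intros y (z & Hz & ->). apply Rnot_lt_le. intros L. apply N. exists z. split; [exact Hz|lra]. }
  destruct (choice _ Seq) as [u Hu].
  pose proof (l1norm_pos z0) as Pz0.
  assert (Pa : 0 <= artanh (l1norm z0)) by (apply artanh_pos; lra).
  assert (Pm : 0 <= m) by (apply G2; intros y (z & Hz & ->); now apply Phi_pos).
  (* Points of penalized value at most [m + 1] are at bounded distance from [z0], hence stay in a
     ball of radius [rho < 1]. *)
  destruct (artanh_bounded (artanh (l1norm z0) + (m + 1) / th)) as (rho & Hrho & Brho).
  { assert (0 <= (m + 1) / th) by (apply Rdiv_le_0_compat; lra). lra. }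
  assert (Bu : forall n, l1norm (u n) <= rho).
  { intros n. destruct (Hu n) as [Nu Pu]. pose proof (l1norm_pos (u n)). apply Brho; [lra|].
    pose proof (kobd_ge_l1 z0 (u n) Hz0 Nu) as K.
    assert (Q : / (INR n + 1) <= 1).
    { rewrite <- Rinv_1. apply Rinv_le_contravar; [lra|]. pose proof (pos_INR n). lra. }
    assert (T : th * kobd z0 (u n) <= m + 1).
    { pose proof (F_ball (u n) Nu). pose proof (l1norm_pos (F (u n))).
      pose proof (artanh_pos (l1norm (F (u n))) ltac:(lra)). unfold phi in Pu. lra. }
    assert (kobd z0 (u n) <= (m + 1) / th).
    { apply (Rmult_le_reg_l th); [lra|]. replace (th * ((m + 1) / th)) with (m + 1) by (field; lra). exact T. }
    lra. }
  destruct (bolzano_weierstrass u rho Bu) as (s & zs & Es & Ks).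
  assert (Ns : l1norm zs < 1).
  { destruct (Ks ((1 - rho) / 2) ltac:(lra)) as [n Kn]. specialize (Kn n (le_n _)).
    pose proof (l1norm_le_vsub zs (u (s n))) as T. rewrite l1norm_vsub_sym in T. pose proof (Bu (s n)). lra. }
  exists zs. split; [exact Ns|]. intros z Hz.
  change (phi zs <= phi z). apply Rle_trans with m; [|apply G1; now exists z].
  apply le_epsilon. intros eps He. set (a := 1 - l1norm zs) in *.
  set (y := Rmin (/ 2) (eps / 8)).
  assert (Y0 : 0 < y) by (apply Rmin_pos; lra).
  assert (Y1 : y <= / 2) by apply Rmin_l. assert (Y2 : y <= eps / 8) by apply Rmin_r.
  destruct (Ks (a * y)) as [n1 K1]; [unfold a; nra|].
  destruct (archimed_cor1 (eps / 2) ltac:(lra)) as [n2 [K2 N2]].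
  specialize (K1 (n1 + n2)%nat ltac:(lia)). set (w := u (s (n1 + n2)%nat)) in *.
  destruct (Hu (s (n1 + n2)%nat)) as [Nw Pw]. fold w in Nw, Pw.
  destruct (kobd_local zs w Ns) as [_ KL]; [fold a; unfold a in *; nra|]. fold a in KL.
  assert (A : kobd zs w <= 2 * y).
  { apply Rle_trans with (1 := KL). pose proof (l1norm_pos (vsub w zs)).
    assert (Q : l1norm (vsub w zs) / a <= y).
    { apply (Rmult_le_reg_r a); [unfold a; lra|]. unfold Rdiv. rewrite Rmult_assoc, Rinv_l by (unfold a; lra). lra. }
    assert (Q0 : 0 <= l1norm (vsub w zs) / a) by (apply Rdiv_le_0_compat; unfold a; lra).
    apply Rle_trans with (artanh y); [apply artanh_le; lra|].
    apply Rle_trans with (1 := artanh_upper y ltac:(lra)).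
    apply (Rmult_le_reg_r (1 - y)); [lra|]. unfold Rdiv. rewrite Rmult_assoc, Rinv_l by lra. nra. }
  pose proof (Phi_lip w zs Nw Ns) as PL. rewrite (kobd_sym w zs Nw Ns) in PL.
  assert (/ (INR (s (n1 + n2)%nat) + 1) <= / INR n2).
  { apply Rinv_le_contravar; [now apply lt_0_INR|].
    assert (n2 <= s (n1 + n2))%nat by (pose proof (extraction_ge s Es (n1 + n2)%nat); lia).
    apply le_INR in H. lra. }
  lra.
Qed.

(** Suppose [F zs = w] is not 0 and take [X] with image [- w] under the differential. A step [h X]
    lowers [artanh] of the norm of [F] at the rate [q = N / (1 - N ^ 2)], while the metric of [X] is
    at most [q], so that the penalty grows at most at the rate [th * q]. *)
Lemma penalized_minimum_is_zero (z0 zs : C * C) (th : R) : l1norm z0 < 1 -> 0 < th < 1 -> l1norm zs < 1 ->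
  (forall z, l1norm z < 1 ->
    artanh (l1norm (F zs)) + th * kobd z0 zs <= artanh (l1norm (F z)) + th * kobd z0 z) ->
  F zs = vzero.
Proof.
  intros Hz0 Hth Hzs Min. apply l1norm_eq_0. apply Classical_Prop.NNPP. intros Nn.
  set (w := F zs) in *. set (N := l1norm w) in *.
  assert (PN : 0 < N) by (pose proof (l1norm_pos w); unfold N in *; lra).
  assert (Nw : l1norm w < 1) by (apply F_ball; exact Hzs). assert (N1 : N < 1) by exact Nw.
  destruct (differential_surjective zs Hzs (rscal (-1) w)) as [X HX].
  set (q := N / (1 - N ^ 2)).
  assert (Pq : 0 < q) by (apply Rdiv_lt_0_compat; nra).
  assert (KX : kobm zs X <= q).
  { rewrite <- dF_iso, HX by exact Hzs. fold w. rewrite kobm_rscal, Rabs_left by (lra || exact Nw).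
    pose proof (kobm_radial w Nw). unfold q, N. lra. }
  (* The net gain is [(1 - th) q h]; the errors from [artanh], from the distance to [v] and from the
     deviation of [F v] from [(1 - h) w] take at most an eighth of it each. *)
  set (e := (1 - th) * q / 8). set (e' := (1 - th) * q * (1 - N) / 16).
  assert (Pe : 0 < e) by (unfold e; assert (0 < (1 - th) * q) by nra; lra).
  assert (Pe' : 0 < e').
  { unfold e'. assert (0 < (1 - th) * q) by nra. assert (0 < (1 - th) * q * (1 - N)) by nra. lra. }
  destruct (derivable_pt_lim_le artanh N _ (artanh_derive N ltac:(lra)) e Pe) as [d1 [D1 K1]].
  destruct (kobd_infinitesimal zs X e Hzs Pe) as [d2 [D2 K2]].
  destruct (differential_along zs X e' Hzs Pe') as [d3 [D3 K3]].
  set (y0 := e' / (1 - N)).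
  assert (Py : 0 < y0) by (apply Rdiv_lt_0_compat; lra).
  set (h := Rmin (Rmin d1 d2) (Rmin (Rmin d3 1) (/ (2 * y0))) / 2).
  assert (Pi : 0 < / (2 * y0)) by (apply Rinv_0_lt_compat; lra).
  assert (Pm : 0 < Rmin (Rmin d1 d2) (Rmin (Rmin d3 1) (/ (2 * y0)))) by (repeat apply Rmin_pos; lra).
  pose proof (Rmin_l (Rmin d1 d2) (Rmin (Rmin d3 1) (/ (2 * y0)))).
  pose proof (Rmin_r (Rmin d1 d2) (Rmin (Rmin d3 1) (/ (2 * y0)))).
  pose proof (Rmin_l d1 d2). pose proof (Rmin_r d1 d2).
  pose proof (Rmin_l (Rmin d3 1) (/ (2 * y0))). pose proof (Rmin_r (Rmin d3 1) (/ (2 * y0))).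
  pose proof (Rmin_l d3 1). pose proof (Rmin_r d3 1).
  assert (Ph : 0 < h) by (unfold h; lra).
  assert (Hh : h < d1 /\ h < d2 /\ h < d3 /\ h < 1 /\ h <= / (2 * y0)) by (unfold h; lra).
  destruct Hh as (h1 & h2 & h3 & h4 & h5).
  assert (Ah : Rabs h = h) by (apply Rabs_pos_eq; lra).
  set (v := vadd zs (rscal h X)).
  assert (Dv : l1norm (vsub v (vadd zs (rscal h X))) = 0).
  { unfold v. rewrite vsub_diag. apply l1norm_vzero. }
  destruct (K2 h v) as [Nv Kv]; [lra|rewrite Dv, Ah; nra|]. rewrite Ah in Kv.
  specialize (K3 h v ltac:(lra) ltac:(rewrite Dv, Ah; nra)). rewrite Ah, HX in K3. fold w in K3.
  set (p := rscal (1 - h) w).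
  assert (Ep : vadd w (rscal h (rscal (-1) w)) = p).
  { unfold p, rscal. rewrite RtoC_minus. vring. }
  rewrite Ep in K3.
  assert (Np : l1norm p = (1 - h) * N) by (unfold p; rewrite l1norm_rscal, Rabs_pos_eq by lra; reflexivity).
  assert (Np1 : l1norm p <= N) by (rewrite Np; nra).
  specialize (K1 (- h * N)). assert (Ahn : Rabs (- h * N) = h * N).
  { rewrite Rabs_mult, Rabs_Ropp, Ah, Rabs_pos_eq; lra. }
  rewrite Ahn in K1. specialize (K1 ltac:(nra)).
  replace (N + - h * N) with (l1norm p) in K1 by (rewrite Np; ring).
  apply Rabs_le_between in K1.
  assert (Hy : h * y0 <= / 2).
  { apply Rle_trans with (/ (2 * y0) * y0); [apply Rmult_le_compat_r; lra|]. right. field. lra. }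
  assert (Ey : e' * h = h * y0 * (1 - N)) by (unfold y0; field; lra).
  pose proof (l1norm_pos (vsub (F v) p)) as Pfp.
  assert (P1N : 0 < 1 - N) by lra.
  destruct (kobd_local p (F v)) as [_ KL]; [lra|nra|].
  assert (AL : kobd p (F v) <= 2 * (h * y0)).
  { apply Rle_trans with (1 := KL).
    assert (Q : l1norm (vsub (F v) p) / (1 - l1norm p) <= h * y0).
    { apply (Rmult_le_reg_r (1 - l1norm p)); [lra|]. unfold Rdiv. rewrite Rmult_assoc, Rinv_l by lra.
      rewrite Rmult_1_r. apply Rle_trans with (1 := K3). rewrite Ey. apply Rmult_le_compat_l; nra. }
    assert (Q0 : 0 <= l1norm (vsub (F v) p) / (1 - l1norm p)) by (apply Rdiv_le_0_compat; lra).
    apply Rle_trans with (artanh (h * y0)); [apply artanh_le; lra|].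
    apply Rle_trans with (1 := artanh_upper (h * y0) ltac:(lra)).
    apply (Rmult_le_reg_r (1 - h * y0)); [lra|]. unfold Rdiv. rewrite Rmult_assoc, Rinv_l by lra. nra. }
  pose proof (kobd_ge_l1 p (F v) ltac:(lra) (F_ball v Nv)) as B1.
  pose proof (kobd_triangle z0 zs v Hz0 Hzs Nv) as B2.
  pose proof (Min v Nv) as M. fold N in M.
  assert (Eq : / (1 - N ^ 2) * (- h * N) = - (h * q)) by (unfold q; field; nra).
  rewrite Eq in K1.
  assert (Y8 : 2 * (h * y0) = h * ((1 - th) * q) / 8) by (unfold y0, e'; field; lra).
  assert (Kv' : th * kobd zs v <= th * (q * h) + e * h).
  { assert (kobd zs v <= (q + e) * h).
    { apply Rle_trans with (1 := Kv). apply Rmult_le_compat_r; lra. }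
    assert (th * (e * h) <= e * h) by (assert (0 < e * h) by nra; nra).
    apply (Rmult_le_compat_l th) in H7; lra. }
  assert (EN : e * (h * N) <= e * h) by (assert (0 < e * h) by nra; nra).
  assert (B2' : th * kobd z0 v <= th * kobd z0 zs + th * kobd zs v) by (apply (Rmult_le_compat_l th) in B2; lra).
  assert (Pp : 0 < h * ((1 - th) * q)) by (apply Rmult_lt_0_compat; [lra|nra]).
  assert (E8 : e * h = h * ((1 - th) * q) / 8) by (unfold e; field).
  nra.
Qed.

(** One inequality is non-expansion together with [F 0 = 0]. For the other the minimization starts
    at [z]: the minimizer is the only zero of [F], the origin, and comparison with the value at [z]
    itself gives [th * kobd z vzero <= artanh (l1norm (F z))]. *)
Lemma differential_norm (z : C * C) : l1norm z < 1 -> l1norm (F z) = l1norm z.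
Proof.
  intros Hz. pose proof (l1norm_pos z). pose proof (l1norm_pos (F z)). pose proof (F_ball z Hz) as NF.
  apply Rle_antisym.
  - apply artanh_le_inv; try lra. rewrite <- !kobd_vzero by assumption.
    rewrite <- differential_fixes_zero at 1. apply differential_nonexpanding; [apply vzero_in|exact Hz].
  - apply artanh_le_inv; try lra. set (A := artanh (l1norm z)). set (B := artanh (l1norm (F z))).
    assert (PB : 0 <= B) by (apply artanh_pos; lra).
    assert (St : forall th, 0 < th < 1 -> th * A <= B).
    { intros th Hth. destruct (penalized_minimum z th Hz Hth) as (zs & Ns & Min).
      pose proof (penalized_minimum_is_zero z zs th Hz Hth Ns Min) as E.
      pose proof (differential_zero_fiber zs Ns E) as Ez. subst zs.
      pose proof (Min z Hz) as M. rewrite E, l1norm_vzero, artanh_0, (kobd_refl z Hz) in M.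
      rewrite (kobd_sym z vzero), kobd_vzero in M by (auto; apply vzero_in). unfold A, B. lra. }
    apply Rnot_lt_le. intros L.
    (* If [B < A], this [th] lies between 0 and 1, and [th * A] is the midpoint of [A] and [B]. *)
    pose proof (St ((A + B) / (2 * A))) as T.
    assert (Q : (A + B) / (2 * A) * A <= B).
    { apply T. split; [apply Rdiv_lt_0_compat; lra|]. apply (Rmult_lt_reg_r (2 * A)); [lra|].
      unfold Rdiv. rewrite Rmult_assoc, Rinv_l; lra. }
    replace ((A + B) / (2 * A) * A) with ((A + B) / 2) in Q by (field; lra). lra.
Qed.

(** The differential at 0 is the blow-up. Any null sequence of scales in (0, 1) would serve. *)
Lemma differential_rigid : rigid F (dF vzero).
Proof.
  pose proof vzero_in as Z.
  apply (rigid_of_blowup F (dF vzero) (fun n => / (INR n + 2))).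
  - exact F_ball.
  - exact differential_nonexpanding.
  - exact differential_norm.
  - now apply dF_lin.
  - intros z. rewrite <- !kobm_at_vzero. rewrite <- differential_fixes_zero at 1. now apply dF_iso.
  - intros n. pose proof (pos_INR n). split; [apply Rinv_0_lt_compat; lra|].
    rewrite <- Rinv_1. apply Rinv_lt_contravar; lra.
  - intros z Hz eps He.
    destruct (differential_along vzero z (eps / 2) Z ltac:(lra)) as [d [D K]].
    destruct (archimed_cor1 d D) as [n0 [K0 N0]]. exists n0. intros n Hn.
    pose proof (pos_INR n). set (s := / (INR n + 2)).
    assert (Ps : 0 < s) by (apply Rinv_0_lt_compat; lra).
    assert (Hs : s < d).
    { apply Rle_lt_trans with (2 := K0). apply Rinv_le_contravar; [now apply lt_0_INR|].
      apply le_INR in Hn. lra. }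
    specialize (K s (rscal s z)). rewrite (Rabs_pos_eq s) in K by lra.
    specialize (K Hs). replace (vadd vzero (rscal s z)) with (rscal s z) in K by vring.
    rewrite vsub_diag, l1norm_vzero, differential_fixes_zero in K. specialize (K ltac:(nra)).
    replace (vsub (rscal (/ s) (F (rscal s z))) (dF vzero z)) with
      (rscal (/ s) (vsub (F (rscal s z)) (vadd vzero (rscal s (dF vzero z))))).
    + rewrite l1norm_rscal, Rabs_pos_eq by (left; now apply Rinv_0_lt_compat).
      apply Rle_lt_trans with (/ s * (eps / 2 * s)).
      * apply Rmult_le_compat_l; [left; now apply Rinv_0_lt_compat|exact K].
      * replace (/ s * (eps / 2 * s)) with (eps / 2) by (field; lra). lra.
    + transitivity (vsub (rscal (/ s) (F (rscal s z))) (rscal (/ s * s) (dF vzero z))).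
      * rewrite <- rscal_mul. vring.
      * rewrite Rinv_l, rscal_1 by lra. reflexivity.
Qed.

End Differentiable.

(** * The explicit maps are isometries, and conclusion *)

Lemma standard_isometry_symmetry (F : C * C -> C * C) : standard_isometry F ->
  exists S S', disc_symmetry S S' /\ (forall z, l1norm (S z) = l1norm z) /\ forall z, l1norm z < 1 -> F z = S z.
Proof.
  intros (o1 & o2 & sg & H1 & H2 & Hsg & H).
  assert (Perm : exists T, disc_symmetry T T /\ (forall z, T z = sg z) /\ forall z, l1norm (T z) = l1norm z).
  { destruct Hsg as [E|E].
    - exists (fun z => swap (swap z)). split; [exact (disc_symmetry_comp _ _ _ _ disc_symmetry_swap disc_symmetry_swap)|].
      split; [intros z; rewrite E; destruct z; reflexivity|]. intros z. now rewrite !l1norm_swap.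
    - exists swap. split; [apply disc_symmetry_swap|]. split; [intros z; now rewrite E|]. apply l1norm_swap. }
  destruct Perm as (T & HT & ET & NT).
  pose proof (disc_symmetry_diag o1 o2 H1 H2) as HD.
  destruct H as [H|H].
  - eexists _, _. split; [exact (disc_symmetry_comp _ _ _ _ HT HD)|]. split.
    + intros z. cbv beta. now rewrite l1norm_diag, NT.
    + intros z Hz. rewrite (H z Hz). unfold diag. now rewrite ET.
  - eexists _, _. split; [exact (disc_symmetry_comp _ _ _ _ HT (disc_symmetry_comp _ _ _ _ disc_symmetry_vconj HD))|]. split.
    + intros z. cbv beta. now rewrite l1norm_diag, l1norm_vconj, NT.
    + intros z Hz. rewrite (H z Hz). unfold diag, vconj. now rewrite ET.
Qed.

Theorem theorem1p1 (F : C * C -> C * C)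
    (F_ball : forall z : C * C, l1_ball z -> l1_ball (F z)) :
  ((exists dF : C * C -> C * C -> C * C,
      C1_differential l1_ball F dF /\
      forall z X : C * C, l1_ball z ->
        @kobayashi_metric C2 l1_ball (F z) (dF z X) =
        @kobayashi_metric C2 l1_ball z X)
   <->
   (forall z w : C * C, l1_ball z -> l1_ball w ->
      @kobayashi_dist C2 l1_ball (F z) (F w) =
      @kobayashi_dist C2 l1_ball z w))
  /\
  ((forall z w : C * C, l1_ball z -> l1_ball w ->
      @kobayashi_dist C2 l1_ball (F z) (F w) =
      @kobayashi_dist C2 l1_ball z w)
   <->
   (exists (omega1 omega2 : C) (sigma : C * C -> C * C),
      Cmod omega1 = 1%R /\ Cmod omega2 = 1%R /\
      coordinate_permutation sigma /\
      ((forall z : C * C, l1_ball z ->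
          F z = (Cmult omega1 (fst (sigma z)), Cmult omega2 (snd (sigma z))))
       \/
       (forall z : C * C, l1_ball z ->
          F z = (Cmult omega1 (Cconj (fst (sigma z))),
                 Cmult omega2 (Cconj (snd (sigma z)))))))).
Proof.
  change (forall z, l1norm z < 1 -> l1norm (F z) < 1) in F_ball.
  (* Both isometry conditions are compared with the explicit form; their mutual equivalence follows
     from this. *)
  assert (P13 : (exists dF : C * C -> C * C -> C * C,
      C1_differential l1_ball F dF /\
      forall z X : C * C, l1_ball z ->
        @kobayashi_metric C2 l1_ball (F z) (dF z X) = @kobayashi_metric C2 l1_ball z X) -> standard_isometry F).
  { intros (dF & [HD _] & HK). apply (rigid_standard F (dF vzero)). apply differential_rigid; auto.
    - intros z Hz. exact (proj1 (real_differential F (dF z) z (HD z Hz))).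
    - intros z Hz. exact (proj2 (real_differential F (dF z) z (HD z Hz))).
    - intros z X Hz. unfold kobm. now rewrite HK. }
  assert (P23 : (forall z w : C * C, l1_ball z -> l1_ball w ->
      @kobayashi_dist C2 l1_ball (F z) (F w) = @kobayashi_dist C2 l1_ball z w) -> standard_isometry F).
  { intros HK.
    assert (K : forall z w, l1norm z < 1 -> l1norm w < 1 -> kobd (F z) (F w) = kobd z w).
    { intros z w Hz Hw. unfold kobd. now rewrite HK. }
    destruct (kobd_isometry_blowup F F_ball K) as (F0 & U & sg & HU & NU & Hsg & Hc).
    apply (rigid_standard F U). apply (rigid_of_blowup F U sg); auto.
    - intros z w Hz Hw. rewrite K by assumption. lra.
    - intros z Hz. pose proof (F_ball z Hz) as NF. pose proof (l1norm_pos z). pose proof (l1norm_pos (F z)).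
      (* [F] fixes the origin, and the distance to the origin is [artanh] of the norm. *)
      assert (E : artanh (l1norm (F z)) = artanh (l1norm z)).
      { rewrite <- !kobd_vzero by assumption. rewrite <- F0 at 1. apply K; [apply vzero_in|exact Hz]. }
      apply Rle_antisym; apply artanh_le_inv; lra. }
  assert (P31 : standard_isometry F -> exists dF : C * C -> C * C -> C * C,
      C1_differential l1_ball F dF /\
      forall z X : C * C, l1_ball z ->
        @kobayashi_metric C2 l1_ball (F z) (dF z X) = @kobayashi_metric C2 l1_ball z X).
  { intros HF. destruct (standard_isometry_symmetry F HF) as (S & S' & HS & NS & E).
    exists (fun _ => S). split.
    - apply C1_differential_of_linear; auto. apply HS.
    - intros z X Hz. rewrite (proj1 (kobm_spec (F z) (S X) (F_ball z Hz))), (proj1 (kobm_spec z X Hz)).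
      f_equal. rewrite (E z Hz). now apply (disc_symmetry_kobm S S'). }
  assert (P32 : standard_isometry F -> forall z w : C * C, l1_ball z -> l1_ball w ->
      @kobayashi_dist C2 l1_ball (F z) (F w) = @kobayashi_dist C2 l1_ball z w).
  { intros HF. destruct (standard_isometry_symmetry F HF) as (S & S' & HS & NS & E). intros z w Hz Hw.
    rewrite (proj1 (kobd_spec (F z) (F w) (F_ball z Hz) (F_ball w Hw))), (proj1 (kobd_spec z w Hz Hw)).
    f_equal. rewrite (E z Hz), (E w Hw). now apply (disc_symmetry_kobd S S'). }
  split; split; auto.
Qed.
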